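(* Let $k\in\{2,3\}$. Then there exists a non-split finitely presented group $G$ with a sharply $k$-transitive action on an infinite set, where the sharply $k$-transitive action has characteristic $2$. If $k=2$, one may take $G=(\mathtt{S}_2\times \mathtt{F}_2)\ast \mathtt{F}_2$. If $k=3$, letting $\sigma\in\mathtt{S}_3$ be an involution and $\tau\in\mathtt{S}_3$ an element of order $3$, one may take $$G=\bigl((\mathtt{S}_3\ast_{\langle\sigma\rangle}(\langle\sigma\rangle\times \mathtt{F}_2))\ast_{\langle\tau\rangle}(\langle\tau\rangle\times \mathtt{F}_2)\bigr)\ast \mathtt{F}_2 .$$
   Context: $\mathtt{S}_k$ is the symmetric group on $k$ points, $\mathtt{F}_2$ is the free group of rank $2$, $\ast$ denotes free product and $\ast_C$ denotes amalgamated free product over the common subgroup $C$ (embedded by inclusion in both factors). An action of a group $G$ on a set $U$ with $|U|\ge k$ is sharply $k$-transitive if for any two $k$-tuples $\bar a,\bar b$ of distinct elements of $U$ there is a unique $g\in G$ with $\bar a\cdot g=\bar b$. Characteristic $2$: a sharply $2$-transitive action has characteristic $2$ if every involution of $G$ acts without fixed points; a sharply $3$-transitive action has characteristic $2$ if every involution of $G$ has exactly one fixed point (equivalently, the sharply $2$-transitive actions of the point-stabilisers on the remaining points have characteristic $2$). Non-split: a sharply $2$-transitive group $G$ is non-split if it has no non-trivial abelian normal subgroup; a group $G$ with a sharply $3$-transitive action is non-split if each point-stabiliser of the action (which acts sharply $2$-transitively on the remaining points) has no non-trivial abelian normal subgroup. *)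

(* Defs.v *)
From HB Require Import structures.
From mathcomp Require Import all_boot all_fingroup.
From mathcomp Require Import generic_quotient boolp classical_sets cardinality.

Set Implicit Arguments.
Unset Strict Implicit.
Unset Printing Implicit Defensive.

Local Open Scope group_scope.
Local Open Scope classical_set_scope.
Local Open Scope quotient_scope.

(* The letter (x, false) stands for x and (x, true) for its inverse. *)
Definition word (X : choiceType) := seq (X * bool).

Definition flip_letter (X : choiceType) (l : X * bool) := (l.1, ~~ l.2).

Definition inv_word (X : choiceType) (w : word X) : word X :=
  rev (map (@flip_letter X) w).

Section Presented.
Variables (X : choiceType) (R : set (word X)).

(* The congruence on words generated by free cancellation and r = 1, r in R. *)
Inductive word_eqv : word X -> word X -> Prop :=
  | word_eqv_refl u : word_eqv u u
  | word_eqv_sym u v : word_eqv u v -> word_eqv v u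
  | word_eqv_trans u v w : word_eqv u v -> word_eqv v w -> word_eqv u w
  | word_eqv_cancel u l v : word_eqv (u ++ [:: l; flip_letter l] ++ v) (u ++ v)
  | word_eqv_rel u r v : R r -> word_eqv (u ++ r ++ v) (u ++ v).

Let eqvb (u v : word X) := `[< word_eqv u v >].

Fact eqvb_refl : reflexive eqvb.
Proof. by move=> u; apply/asboolP; exact: word_eqv_refl. Qed.

Fact eqvb_sym : symmetric eqvb.
Proof.
by move=> u v; apply/asboolP/asboolP; exact: word_eqv_sym.
Qed.

Fact eqvb_trans : transitive eqvb.
Proof.
by move=> v u w /asboolP uv /asboolP vw; apply/asboolP; exact: word_eqv_trans vw.
Qed.

Canonical word_eqv_equiv := EquivRel eqvb eqvb_refl eqvb_sym eqvb_trans.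

Definition presented := {eq_quot word_eqv_equiv}.
HB.instance Definition _ := Quotient.on presented.
HB.instance Definition _ := Choice.on presented.

Definition class_of (w : word X) : presented := \pi_presented w.

Lemma class_ofP u v : class_of u = class_of v <-> word_eqv u v.
Proof. by split=> [/eqmodP/asboolP|uv] //; apply/eqmodP/asboolP. Qed.

Lemma class_of_repr (x : presented) : class_of (repr x) = x.
Proof. exact: reprK. Qed.

Lemma repr_class_of w : word_eqv (repr (class_of w)) w.
Proof. by apply/class_ofP; rewrite class_of_repr. Qed.

Lemma word_eqv_cat u u' v v' :
  word_eqv u u' -> word_eqv v v' -> word_eqv (u ++ v) (u' ++ v').
Proof.
move=> uu' vv'; apply: (@word_eqv_trans _ (u' ++ v)).
  elim: uu' => {u u'} [u|u w _|u w z _ + _|u l w|u r w Rr].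
  - exact: word_eqv_refl.
  - exact: word_eqv_sym.
  - exact: word_eqv_trans.
  - by rewrite -!catA; exact: word_eqv_cancel.
  - by rewrite -!catA; exact: word_eqv_rel.
elim: vv' => {v v'} [v|v w _|v w z _ + _|v l w|v r w Rr].
- exact: word_eqv_refl.
- exact: word_eqv_sym.
- exact: word_eqv_trans.
- by rewrite !(catA u'); exact: word_eqv_cancel.
- by rewrite !(catA u'); exact: word_eqv_rel.
Qed.

Lemma flip_letterK : involutive (@flip_letter X).
Proof. by case=> x b; rewrite /flip_letter /= negbK. Qed.

Lemma inv_wordK : involutive (@inv_word X).
Proof. by move=> w; rewrite /inv_word map_rev revK mapK //; exact: flip_letterK. Qed.

Lemma inv_word_cat (u v : word X) : inv_word (u ++ v) = inv_word v ++ inv_word u.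
Proof. by rewrite /inv_word map_cat rev_cat. Qed.

Lemma word_eqv_mulV w : word_eqv (w ++ inv_word w) [::].
Proof.
elim/last_ind: w => [|w l IH]; first exact: word_eqv_refl.
rewrite -cats1 inv_word_cat -catA; apply: word_eqv_trans IH.
exact: word_eqv_cancel.
Qed.

Lemma word_eqv_Vmul w : word_eqv (inv_word w ++ w) [::].
Proof. by rewrite -{2}(inv_wordK w); exact: word_eqv_mulV. Qed.

Lemma word_eqv_inv u v : word_eqv u v -> word_eqv (inv_word u) (inv_word v).
Proof.
move=> uv; apply: (@word_eqv_trans _ (inv_word u ++ (v ++ inv_word v))).
  rewrite -{1}(cats0 (inv_word u)); apply: word_eqv_cat; first exact: word_eqv_refl.
  exact/word_eqv_sym/word_eqv_mulV.
rewrite catA -{2}(cat0s (inv_word v)); apply: word_eqv_cat; last exact: word_eqv_refl.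
apply: word_eqv_trans (word_eqv_Vmul u).
by apply: word_eqv_cat; [exact: word_eqv_refl | exact: word_eqv_sym].
Qed.

Definition pmul (x y : presented) : presented := class_of (repr x ++ repr y).
Definition pone : presented := class_of [::].
Definition pinv (x : presented) : presented := class_of (inv_word (repr x)).

Lemma pmulE u v : pmul (class_of u) (class_of v) = class_of (u ++ v).
Proof. by apply/class_ofP/word_eqv_cat; exact: repr_class_of. Qed.

Lemma pinvE u : pinv (class_of u) = class_of (inv_word u).
Proof. by apply/class_ofP/word_eqv_inv; exact: repr_class_of. Qed.

Fact pmulA : associative pmul.
Proof.
move=> x y z; rewrite -(class_of_repr x) -(class_of_repr y) -(class_of_repr z).
by rewrite !pmulE catA.
Qed.

Fact pmul1 : left_id pone pmul.
Proof. by move=> x; rewrite -(class_of_repr x) pmulE. Qed.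

Fact pmulr1 : right_id pone pmul.
Proof. by move=> x; rewrite -(class_of_repr x) pmulE cats0. Qed.

Fact pmulV : left_inverse pone pinv pmul.
Proof.
move=> x; rewrite -(class_of_repr x) pinvE pmulE.
exact/class_ofP/word_eqv_Vmul.
Qed.

Fact pmulrV : right_inverse pone pinv pmul.
Proof.
move=> x; rewrite -(class_of_repr x) pinvE pmulE.
exact/class_ofP/word_eqv_mulV.
Qed.

HB.instance Definition _ :=
  isGroup.Build presented pmulA pmul1 pmulr1 pmulV pmulrV.

Definition presented_group : groupType := presented.

Definition gen (x : X) : presented_group := class_of [:: (x, false)].

End Presented.

Definition isomorphic (G H : groupType) : Prop :=
  exists f : {multiplicative G -> H}, bijective f.

Definition finitely_presented (G : groupType) : Prop :=
  exists (n : nat) (r : seq (word 'I_n)),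
    isomorphic G (presented_group [set` r]).

Definition free_group (X : choiceType) : groupType := presented_group (@set0 (word X)).

Section Amalgam.
Variables (A B : groupType) (C : Type) (iA : C -> A) (iB : C -> B).

(* Multiplication tables of A and B, and the identification of iA c with iB c. *)
Inductive amalgam_rel : word (A + B)%type -> Prop :=
  | amalgam_rel_l a a' :
      amalgam_rel [:: (inl a, false); (inl a', false); (inl (a * a'), true)]
  | amalgam_rel_r b b' :
      amalgam_rel [:: (inr b, false); (inr b', false); (inr (b * b'), true)]
  | amalgam_rel_id c : amalgam_rel [:: (inl (iA c), false); (inr (iB c), true)].

(* This is A *_C B when C is a group and iA, iB are injective homomorphisms. *)
Definition amalgam : groupType := presented_group amalgam_rel.

Definition amalgam_l (a : A) : amalgam := gen amalgam_rel (inl a).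
Definition amalgam_r (b : B) : amalgam := gen amalgam_rel (inr b).

End Amalgam.

Definition free_product (A B : groupType) : groupType :=
  amalgam (of_void A) (of_void B).

Notation F2 := (free_group 'I_2).

Definition group2 : groupType := free_product ('S_2 * F2)%type F2.

Section Group3.
Variables s t : 'S_3.

(* S_3 *_<s> (<s> x F_2), with <s> embedded in <s> x F_2 by c |-> (c, 1). *)
Definition group3_s : groupType :=
  @amalgam 'S_3 ([subg <[s]> ] * F2)%type [subg <[s]> ] sgval (fun c => (c, 1)).

(* group3_s *_<t> (<t> x F_2), where <t> <= S_3 <= group3_s. *)
Definition group3_st : groupType :=
  @amalgam group3_s ([subg <[t]> ] * F2)%type [subg <[t]> ]
    (fun c => amalgam_l _ _ (sgval c)) (fun c => (c, 1)).

Definition group3 : groupType := free_product group3_st F2.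

End Group3.

Section Actions.
Variables (G : groupType) (U : Type) (act : U -> G -> U).

Definition right_action : Prop :=
  (forall x, act x 1 = x) /\ (forall x g h, act x (g * h) = act (act x g) h).

(* A tuple of distinct elements is an injective map from 'I_k. *)
Definition sharply_transitive (k : nat) : Prop :=
  [/\ right_action,
      (exists a : 'I_k -> U, injective a) &
      forall a b : 'I_k -> U, injective a -> injective b ->
        exists! g : G, forall i, act (a i) g = b i].

Definition stabiliser (x : U) : set G := [set g | act x g = x].

End Actions.

Definition involution (G : groupType) (g : G) : Prop := g <> 1 /\ g * g = 1.

(* The notion is only defined for k = 2 and k = 3. *)
Definition characteristic2 (k : nat) (G : groupType) (U : Type)
    (act : U -> G -> U) : Prop :=
  match k with
  | 2 => forall g, involution g -> forall x, act x g <> x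
  | 3 => forall g, involution g -> exists! x, act x g = x
  | _ => False
  end.

Definition subgroup (G : groupType) (N : set G) : Prop :=
  [/\ N 1, (forall x y, N x -> N y -> N (x * y)) & (forall x, N x -> N x^-1)].

Definition no_abelian_normal (G : groupType) (H : set G) : Prop :=
  forall N : set G, N `<=` H -> subgroup N ->
    (forall x h, N x -> H h -> N (x ^ h)) ->
    (forall x y, N x -> N y -> x * y = y * x) ->
    N = [set 1].

(* The notion is only defined for k = 2 and k = 3. *)
Definition non_split (k : nat) (G : groupType) (U : Type)
    (act : U -> G -> U) : Prop :=
  match k with
  | 2 => no_abelian_normal [set: G]
  | 3 => forall x, no_abelian_normal (stabiliser act x)
  | _ => False
  end.

Definition has_nonsplit_char2_action (k : nat) (G : groupType) : Prop :=
  exists (U : Type) (act : U -> G -> U),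
    [/\ infinite_set [set: U], sharply_transitive act k,
        characteristic2 k act & non_split k act].

(* Main.v *)
Require Import Defs.
From HB Require Import structures.
From mathcomp Require Import all_boot all_fingroup.
From mathcomp Require Import boolp classical_sets cardinality.

(* Both groups are multiple HNN extensions of 'S_k with stable letters
   centralising subgroups C j: the trivial group, 'S_2 for k = 2, <s> and <t>
   for k = 3. Starting from an action of 'S_k on a countable set, finite partial
   actions of the stable letters are extended step by step to an action of the
   whole group G, keeping the induced partial action on k-tuples of distinct
   points free. Freeness is witnessed by an equivariant map from tuples to free
   G-sets, which is easily updated when a component of the graph of tuples is
   attached to another one by a single orbit of edges. New images are chosen
   among fresh points, so that all but one of the new edges of tuples lead to
   fresh components. A component is joined to that of the base tuple by a stable
   letter whose C j is the stabiliser of the component under permutation of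
   coordinates. In the limit, the tuples form a regular orbit.

   For k = 3, involutions of G are conjugate into 'S_3, because G is a semidirect
   product of a free group, with permuted basis, by 'S_3; those of 'S_3 have
   exactly one fixed point. An abelian normal subgroup of a point stabiliser (of
   G for k = 2) would contain all its involutions, but two of them are seen not
   to commute in a quotient 'S_3 of G. *)

Set Implicit Arguments.
Unset Strict Implicit.
Unset Printing Implicit Defensive.

Local Open Scope group_scope.

(** * Free partial actions on tuples *)

(** The obstacle is the step that joins a tuple [T] to [base]. A letter acts on points, so
    prescribing it on the entries of [T] also creates edges at all tuples that mix entries of [T]
    with points where the letter was already defined; these edges must neither close a loop nor
    merge old components. The cure is to send [T] to the end [Z] of a long chain of fresh points
    issuing from the component of [base]. A tuple mixing entries of [Z] with old points then has as
    its component a short piece of chain, because its old entries cannot be pulled back as far as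
    the new ones. One letter has to be nilpotent for this, and a second letter of the same type
    makes the join: this is what rank 2 of the free groups provides. Permutations of coordinates
    commute with [G], so an edge from [T] to [Z] comes with all its translates; those by
    permutations that preserve the component of [T] are harmless when the letter commutes with them.
    For k = 3 the stabiliser of a component is, up to conjugacy, trivial, [<[s]>] or [<[t]>], or the
    component is that of [base]: hence three copies of F_2. *)

Section Homs.
Variables (G H : groupType) (f : G -> H).

Definition is_hom := {morph f : x y / x * y}.

Lemma hom1 : is_hom -> f 1 = 1.
Proof. by move=> fM; apply: (mulgI (f 1)); rewrite -fM !mulg1. Qed.

Lemma homV : is_hom -> {morph f : x / x^-1}.
Proof. by move=> fM x; apply: (mulgI (f x)); rewrite -fM !mulgV hom1. Qed.

End Homs.

(** * Tuples of distinct points and the two commuting actions of 'S_k on them *)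

Section Tuples.
Variable k : nat.

(* k points permuted naturally by 'S_k, and countably many regular orbits. *)
Definition pt := ('I_k + 'S_k * nat)%type.

Definition pact (p : pt) (u : 'S_k) : pt :=
  match p with inl i => inl (u i) | inr (v, n) => inr (v * u, n) end.

Definition level (p : pt) : nat := if p is inr (_, n) then n.+1 else 0%N.

Lemma pact1 p : pact p 1 = p.
Proof. by case: p => [i|[v n]]; rewrite /= ?perm1 ?mulg1. Qed.

Lemma pactM p u v : pact (pact p u) v = pact p (u * v).
Proof. by case: p => [i|[w n]]; rewrite /= ?permM ?mulgA. Qed.

Lemma level_pact p u : level (pact p u) = level p.
Proof. by case: p => [i|[w n]]. Qed.

Lemma pact_inj u : injective (pact^~ u).
Proof. by apply: (can_inj (g := pact^~ u^-1)) => p; rewrite pactM mulgV pact1. Qed.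

Lemma pact_free p u : level p != 0%N -> pact p u = p -> u = 1.
Proof. by case: p => [//|[v n]] _ [] /(canRL (mulKg v)); rewrite mulVg. Qed.

Definition tup := {T : {ffun 'I_k -> pt} | injectiveb T}.

Definition tfun (T : tup) : 'I_k -> pt := val T.
Coercion tfun : tup >-> Funclass.

Lemma tup_inj (T : tup) : injective T. Proof. by apply/injectiveP; case: T. Qed.

Lemma tupP (T T' : tup) : (forall i, T i = T' i) -> T = T'.
Proof. by move=> TT'; apply/val_inj/ffunP. Qed.

Fact mktup_subproof (f : 'I_k -> pt) : injective f -> injectiveb (finfun f).
Proof. by move=> fI; apply/injectiveP => i j; rewrite !ffunE => /fI. Qed.

Definition mktup (f : 'I_k -> pt) (fI : injective f) : tup :=
  exist _ (finfun f) (mktup_subproof fI).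

Lemma mktupE f fI i : @mktup f fI i = f i.
Proof. by rewrite /tfun /= ffunE. Qed.

Lemma rs_subproof (T : tup) u : injective (fun i => pact (T i) u).
Proof. by move=> i j /pact_inj/tup_inj. Qed.
Definition rs (T : tup) u : tup := mktup (@rs_subproof T u).

Lemma ls_subproof (T : tup) (s : 'S_k) : injective (fun i => T (s i)).
Proof. by move=> i j /tup_inj/perm_inj. Qed.
Definition ls (s : 'S_k) (T : tup) : tup := mktup (@ls_subproof T s).

Lemma rsE T u i : rs T u i = pact (T i) u. Proof. exact: mktupE. Qed.
Lemma lsE s T i : ls s T i = T (s i). Proof. exact: mktupE. Qed.

Lemma rs1 T : rs T 1 = T.
Proof. by apply: tupP => i; rewrite rsE pact1. Qed.
Lemma rsM T u v : rs (rs T u) v = rs T (u * v).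
Proof. by apply: tupP => i; rewrite !rsE pactM. Qed.
Lemma ls1 T : ls 1 T = T.
Proof. by apply: tupP => i; rewrite lsE perm1. Qed.
Lemma lsM s t T : ls s (ls t T) = ls (s * t) T.
Proof. by apply: tupP => i; rewrite !lsE permM. Qed.
Lemma lrs s T u : ls s (rs T u) = rs (ls s T) u.
Proof. by apply: tupP => i; rewrite !(lsE, rsE). Qed.

Lemma ls_inj s : injective (ls s).
Proof. by apply: (can_inj (g := ls s^-1)) => T; rewrite lsM mulVg ls1. Qed.

Lemma ls_free T s : ls s T = T -> s = 1.
Proof.
move=> sT; apply/permP => i; rewrite perm1.
by apply: (@tup_inj T); rewrite -{2}sT lsE.
Qed.

Lemma base_subproof : injective (inl : 'I_k -> pt).
Proof. by move=> i j []. Qed.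
Definition base : tup := mktup base_subproof.

Lemma baseE i : base i = inl i. Proof. exact: mktupE. Qed.

(** Permuting coordinates and permuting points agree on [base]; hence the component of [base] is
    stable under all permutations of coordinates. *)
Lemma ls_base s : ls s base = rs base s.
Proof. by apply: tupP => i; rewrite lsE rsE !baseE. Qed.

Lemma tup_level0 (T : tup) : (forall i, level (T i) = 0%N) -> exists s, T = rs base s.
Proof.
move=> T0; have /boolp.choice[f fE] : forall i, exists j : 'I_k, T i = inl j.
  by move=> i; move: (T0 i); case: (T i) => [j _|[]//]; exists j.
have fI : injective f by move=> i j fij; apply: (@tup_inj T); rewrite !fE fij.
by exists (perm fI); apply: tupP => i; rewrite rsE baseE fE /= permE.
Qed.

(** An entry in a regular orbit forces [u = 1]. Otherwise [T] is a rearrangement of [base], where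
    [u] amounts to a permutation of coordinates, and those act freely. *)
Lemma rs_free T u : rs T u = T -> u = 1.
Proof.
move=> uT; have uTi i : pact (T i) u = T i by rewrite -{2}uT rsE.
have [[i Ti]|T0] := pselect (exists i, level (T i) != 0%N).
  exact: pact_free (uTi i).
have [i|s TE] := @tup_level0 T; first by apply/eqP; apply: contra_notT T0; exists i.
by apply: (@ls_free base); apply: (@ls_inj s); rewrite ls_base lrs ls_base -TE uT.
Qed.

End Tuples.
Arguments base {k}.

(** * Labelled graphs of tuples, and labellings as witnesses of freeness *)

Section LabelledGraph.
Variables (k : nat) (G : groupType) (phi : 'S_k -> G).
Hypothesis phiM : is_hom phi.

Local Notation X := (tup k).
Implicit Types (E D : X -> G -> X -> Prop) (p q r : X * G) (x y z : X).

(** The label of a path is the product of the labels met, so freeness of the partial action means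
    that closed paths have label 1. *)
Inductive path E : X -> G -> X -> Prop :=
  | path_refl x : path E x 1 x
  | path_rs x g y u : path E x g y -> path E x (g * phi u) (rs y u)
  | path_fwd x g y h z : path E x g y -> E y h z -> path E x (g * h) z
  | path_bwd x g y h z : path E x g y -> E z h y -> path E x (g * h^-1) z.

Definition conn E x y := exists g, path E x g y.

Lemma path_trans E x g y h z : path E x g y -> path E y h z -> path E x (g * h) z.
Proof.
move=> xy yz; elim: yz x g xy => {y h z}.
- by move=> y x g xy; rewrite mulg1.
- by move=> y h z u _ IH x g xy; rewrite mulgA; apply/path_rs/IH.
- by move=> y h z g0 w _ IH zw x g xy; rewrite mulgA; apply: path_fwd zw; exact: IH.
- by move=> y h z g0 w _ IH zw x g xy; rewrite mulgA; apply: path_bwd zw; exact: IH.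
Qed.

Lemma path_rs1 E x u : path E x (phi u) (rs x u).
Proof. by rewrite -[phi u]mul1g; apply/path_rs/path_refl. Qed.

Lemma path_edge E x g y : E x g y -> path E x g y.
Proof. by rewrite -{2}[g]mul1g; apply/path_fwd/path_refl. Qed.

Lemma path_sym E x g y : path E x g y -> path E y g^-1 x.
Proof.
elim=> {x g y}.
- by move=> x; rewrite invg1; exact: path_refl.
- move=> x g y u _ IH; rewrite invgM; apply: path_trans IH.
  by have := path_rs1 E (rs y u) u^-1; rewrite rsM mulgV rs1 (homV phiM).
- move=> x g y h z _ IH yz; rewrite invgM; apply: path_trans IH.
  by rewrite -[h^-1]mul1g; exact: path_bwd (path_refl _ _) yz.
- move=> x g y h z _ IH yz; rewrite invgM invgK; apply: path_trans IH.
  exact: path_edge.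
Qed.

Lemma path_incl E E' x g y :
  (forall x g y, E x g y -> path E' x g y) -> path E x g y -> path E' x g y.
Proof.
move=> EE'; elim=> {x g y}.
- by move=> x; exact: path_refl.
- by move=> *; exact: path_rs.
- by move=> x g y h z _ IH /EE'; exact: path_trans.
- by move=> x g y h z _ IH /EE' /path_sym; exact: path_trans.
Qed.

Definition ls_closed E := forall s x g y, E x g y -> E (ls s x) g (ls s y).

Lemma path_ls E s x g y : ls_closed E -> path E x g y -> path E (ls s x) g (ls s y).
Proof.
move=> Els; elim=> {x g y}.
- by move=> x; exact: path_refl.
- by move=> x g y u _ IH; rewrite lrs; exact: path_rs.
- by move=> x g y h z _ IH /(Els s); exact: path_fwd.
- by move=> x g y h z _ IH /(Els s); exact: path_bwd.
Qed.

Lemma conn_refl E x : conn E x x. Proof. by exists 1; exact: path_refl. Qed.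
Lemma conn_sym E x y : conn E x y -> conn E y x.
Proof. by case=> g /path_sym; exists g^-1. Qed.
Lemma conn_trans E x y z : conn E x y -> conn E y z -> conn E x z.
Proof. by case=> g xy [h yz]; exists (g * h); exact: path_trans yz. Qed.
Lemma conn_rs E x u : conn E x (rs x u).
Proof. by exists (phi u); exact: path_rs1. Qed.
Lemma conn_ls E s x y : ls_closed E -> conn E x y -> conn E (ls s x) (ls s y).
Proof. by move=> Els [g xy]; exists g; exact: path_ls. Qed.
Lemma conn_incl E E' x y :
  (forall x g y, E x g y -> path E' x g y) -> conn E x y -> conn E' x y.
Proof. by move=> EE' [g xy]; exists g; exact: path_incl xy. Qed.

Lemma conn_ind_class E x (P : X -> Prop) :
  P x -> (forall y u, P y -> P (rs y u)) ->
  (forall y g z, P y -> E y g z -> P z) ->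
  (forall y g z, P y -> E z g y -> P z) -> forall y, conn E x y -> P y.
Proof.
move=> Px Prs Pf Pb y [g xy]; elim: xy Px => {x g y}; first by [].
- by move=> x g y u _ IH /IH; exact: Prs.
- by move=> x g y h z _ IH yz /IH Py; exact: Pf yz.
- by move=> x g y h z _ IH yz /IH Py; exact: Pb yz.
Qed.

(* Equality of classes in the induced set X x_S G: (x u, g) ~ (x, phi u g). *)
Definition sim p q := exists u, q.1 = rs p.1 u /\ p.2 = phi u * q.2.

Lemma sim_refl p : sim p p.
Proof. by exists 1; rewrite rs1 (hom1 phiM) mul1g. Qed.

Lemma sim_sym p q : sim p q -> sim q p.
Proof.
case=> u [q1 p2]; exists u^-1; rewrite q1 rsM mulgV rs1; split=> //.
by rewrite p2 (homV phiM) mulKg.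
Qed.

Lemma sim_trans q p r : sim p q -> sim q r -> sim p r.
Proof.
case=> u [q1 p2] [v [r1 q2]]; exists (u * v); rewrite r1 q1 rsM; split=> //.
by rewrite p2 q2 phiM mulgA.
Qed.

Definition actg p g : X * G := (p.1, p.2 * g).
Definition acts s p : X * G := (ls s p.1, p.2).

Lemma actgM p g h : actg (actg p g) h = actg p (g * h).
Proof. by rewrite /actg /= mulgA. Qed.
Lemma actg1 p : actg p 1 = p.
Proof. by rewrite /actg mulg1; case: p. Qed.

Lemma sim_actg p q g : sim p q -> sim (actg p g) (actg q g).
Proof. by case=> u [q1 p2]; exists u; rewrite /= p2 mulgA. Qed.
Lemma sim_acts s p q : sim p q -> sim (acts s p) (acts s q).
Proof. by case=> u [q1 p2]; exists u; rewrite /= q1 lrs. Qed.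

Lemma sim_free p g : sim p (actg p g) -> g = 1.
Proof.
case=> u [/= /esym/rs_free -> ]; rewrite (hom1 phiM) mul1g => pg.
by apply: (mulgI p.2); rewrite mulg1.
Qed.

(* An equivariant map L to X x_S G witnesses that the partial action described
   by E is free; (L x).1 is a centre of the component of x, on which the
   stabiliser of that component under ls acts through S. *)
Definition labelling E (L : X -> X * G) :=
  [/\ forall x u, sim (L (rs x u)) (actg (L x) (phi u)),
      forall s x, sim (L (ls s x)) (acts s (L x)),
      forall x g y, E x g y -> sim (L y) (actg (L x) g) &
      forall x, conn E x (L x).1].

Definition valid E := exists L, labelling E L.

Lemma labelling_path E L x g y :
  labelling E L -> path E x g y -> sim (L y) (actg (L x) g).
Proof.
case=> Lrs _ LE _; elim=> {x g y}.
- by move=> x; rewrite actg1; exact: sim_refl.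
- move=> x g y u _ IH; apply: sim_trans (Lrs y u) _.
  by rewrite -actgM; exact: sim_actg.
- move=> x g y h z _ IH yz; apply: sim_trans (LE _ _ _ yz) _.
  by rewrite -actgM; exact: sim_actg.
- move=> x g y h z _ IH /LE yz; rewrite -actgM.
  apply: sim_trans (sim_actg h^-1 IH).
  by apply: sim_sym; move: (sim_actg h^-1 yz); rewrite actgM mulgV actg1.
Qed.

Lemma labelling_loop E L x g : labelling E L -> path E x g x -> g = 1.
Proof. by move=> EL /(labelling_path EL) /sim_free. Qed.

Lemma valid_loop E x g : valid E -> path E x g x -> g = 1.
Proof. by case=> L; exact: labelling_loop. Qed.

Lemma valid_path_unique E x y g h : valid E -> path E x g y -> path E x h y -> g = h.
Proof.
move=> vE xy /path_sym yx; have := valid_loop vE (path_trans xy yx).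
by move/(congr1 (fun g0 => g0 * h)); rewrite mulgVK mul1g.
Qed.

(** Labels are equivariant under permutations of coordinates up to [sim], so a permutation
    preserving the component moves its centre only within a right orbit. The stabiliser of a
    component thus becomes visible as symmetries of one explicit tuple. *)
Lemma valid_centre E x : valid E -> ls_closed E ->
  exists2 y, conn E x y & forall s, conn E (ls s y) y -> exists u, ls s y = rs y u.
Proof.
case=> L EL Els; case: (EL) => _ Lls _ Lc; exists (L x).1 => // s sc.
have : conn E x (ls s x).
  apply: conn_trans (Lc x) (conn_trans (conn_sym sc) _).
  exact/conn_sym/conn_ls.
case=> g /(labelling_path EL)/sim_sym Lg.
by case: (sim_trans Lg (Lls s x)) => u [/= ->]; exists u.
Qed.

(** A labelling only sees paths, so edges may be reversed, added or dropped as long as the same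
    paths result. *)
Lemma valid_same_paths E E' : valid E ->
  (forall x g y, E' x g y -> path E x g y) ->
  (forall x g y, E x g y -> path E' x g y) -> valid E'.
Proof.
case=> L EL E'E EE'; exists L; case: (EL) => Lrs Lls LE Lc; split=> //.
- by move=> x g y /E'E/(labelling_path EL).
- by move=> x; exact: conn_incl EE' (Lc x).
Qed.

Definition addE E D x g y := E x g y \/ D x g y.

Lemma addE_ls_closed E D : ls_closed E -> ls_closed D -> ls_closed (addE E D).
Proof. by move=> Els Dls s x g y [/(Els s)|/(Dls s)]; [left|right]. Qed.

Lemma conn_addE_untouched E D x y :
  (forall z g w, D z g w -> ~ conn E x z /\ ~ conn E x w) ->
  conn (addE E D) x y -> conn E x y.
Proof.
move=> xD; apply: conn_ind_class; first exact: conn_refl.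
- by move=> z u xz; apply: conn_trans xz (conn_rs _ _ _).
- move=> z g w xz [/path_edge zw|/xD[]//].
  by apply: conn_trans xz _; exists g.
- move=> z g w xz [/path_edge/path_sym zw|/xD[]//].
  by apply: conn_trans xz _; exists g^-1.
Qed.

(* The components of the targets of D are grafted, by relabelling, onto the
   components of the sources. *)
Lemma valid_graft E D : valid E -> ls_closed E -> ls_closed D ->
  (forall x g y x' g' y', D x g y -> D x' g' y' -> conn E y y' ->
     exists c, [/\ x' = rs x c, y' = rs y c & phi c * g' = g * phi c]) ->
  (forall x g y x' g' y', D x g y -> D x' g' y' -> ~ conn E x y') ->
  valid (addE E D) /\
  forall x x', (forall y g z, D y g z -> ~ conn E z x /\ ~ conn E z x') ->
    conn (addE E D) x x' -> conn E x x'.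
Proof.
move=> vE Els Dls Dtgt Dsrc; case: (vE) => L EL; case: (EL) => Lrs Lls LE Lc.
(* Here [a] encodes an edge of [D] followed by a path of [E] from its target to [x]; tuples that
   admit such an [a] are relabelled through it. *)
pose graft x (a : X * G * X * G) := D a.1.1.1 a.1.1.2 a.1.2 /\ path E a.1.2 a.2 x.
pose L' x := if pselect (exists a, graft x a) is left ex
  then let a := sval (cid ex) in actg (L a.1.1.1) (a.1.1.2 * a.2) else L x.
(* Independence of the choice: two edges into the same component are translates by some [c] that
   intertwines their labels, and validity of [E] makes the two paths differ by the same [c]. *)
have L'D x g y h z : D x g y -> path E y h z -> sim (L' z) (actg (L x) (g * h)).
  move=> Dxy yz; rewrite /L'; case: pselect => [ex|[]]; last by exists (x, g, y, h).
  case: cid => -[[[x0 g1] y0] h0] /= [/= D0 yz0].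
  have [c [xc yc gc]] := Dtgt _ _ _ _ _ _ D0 Dxy
    (conn_trans (ex_intro _ _ yz0) (conn_sym (ex_intro _ _ yz))).
  have h0E : h0 = phi c * h.
    apply: valid_path_unique vE yz0 _.
    by apply: path_trans yz; rewrite yc; exact: path_rs1.
  rewrite h0E mulgA -gc -mulgA -[actg (L x0) _]actgM xc.
  by apply: sim_actg; apply: sim_sym; exact: Lrs.
have L'E z : ~ (exists a, graft z a) -> L' z = L z.
  by move=> nex; rewrite /L'; case: pselect.
have graftP z z' : conn E z z' -> (exists a, graft z a) -> exists a, graft z' a.
  case=> g0 zz' [[[[x g] y] h] [/= Dxy yz]]; exists (x, g, y, h * g0).
  by split=> //=; exact: path_trans zz'.
(* Away from the targets of [D] the centres are those of [L]. A centre lies in the [E]-component of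
   its tuple, so two such tuples joined in the new graph were already joined in [E]. *)
suff EDL' : labelling (addE E D) L'.
  split; first by exists L'.
  move=> x x' xx' [g /(labelling_path EDL')].
  have nD w : (forall y g z, D y g z -> ~ conn E z w) -> ~ exists a, graft w a.
    by move=> wD [[[[y h] z] g'] [/= /wD zw pzw]]; apply: zw; exists g'.
  rewrite !L'E; first last.
  - by apply: nD => y h z /xx'[].
  - by apply: nD => y h z /xx'[].
  case=> u [/= x'E _]; apply: conn_trans (conn_sym (Lc x')).
  by apply: conn_trans (Lc x) _; rewrite x'E; exact/conn_sym/conn_rs.
split.
- move=> x u; case: (pselect (exists a, graft x a)) => [[[[[z g] y] h] [/= Dzy yx]]|nx].
    apply: sim_trans (L'D _ _ _ _ _ Dzy (path_trans yx (path_rs1 E x u))) _.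
    rewrite mulgA -actgM; apply/sim_actg/sim_sym; exact: L'D Dzy yx.
  rewrite !L'E //; apply: contra_not nx; apply: graftP.
  exact/conn_sym/conn_rs.
- move=> s x; case: (pselect (exists a, graft x a)) => [[[[[z g] y] h] [/= Dzy yx]]|nx].
    apply: sim_trans (L'D _ _ _ _ _ (Dls s _ _ _ Dzy) (path_ls s Els yx)) _.
    apply: sim_trans (sim_acts s (sim_sym (L'D _ _ _ _ _ Dzy yx))).
    exact: (sim_actg (g * h) (Lls s z)).
  rewrite !L'E //; apply: contra_not nx => -[[[[z g] y] h] [/= Dzy yx]].
  exists (ls s^-1 z, g, ls s^-1 y, h); split=> /=; first exact: Dls.
  by have := path_ls s^-1 Els yx; rewrite lsM mulVg ls1.
- move=> x g y [Exy|Dxy].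
    case: (pselect (exists a, graft x a)) => [[[[[z g0] w] h] [/= Dzw wx]]|nx].
      apply: sim_trans (L'D _ _ _ _ _ Dzw (path_fwd wx Exy)) _.
      rewrite mulgA -actgM; apply/sim_actg/sim_sym; exact: L'D Dzw wx.
    rewrite !L'E //; first exact: LE.
    apply: contra_not nx; apply: graftP.
    by apply: conn_sym; exists g; exact: path_edge.
  (* A source keeps its old label, since no source shares a component with a target. *)
  have := L'D _ _ _ _ _ Dxy (path_refl E y); rewrite mulg1 (L'E x) //.
  by case=> -[[[z g0] w] h] [/= Dzw wx]; case: (Dsrc _ _ _ _ _ _ Dxy Dzw);
    apply: conn_sym; exists h.
- have sub x y : conn E x y -> conn (addE E D) x y.
    by apply: conn_incl => z g w zw; apply: path_edge; left.
  move=> x; case: (pselect (exists a, graft x a)) => [[[[[z g] y] h] [/= Dzy yx]]|nx].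
    have [u [/= xE _]] := L'D _ _ _ _ _ Dzy yx.
    apply: (@conn_trans _ _ (rs (L' x).1 u)); last exact/conn_sym/conn_rs.
    rewrite -xE; apply: conn_trans (sub _ _ (Lc z)).
    apply: (@conn_trans _ _ y).
      by apply: sub; apply: conn_sym; exists h.
    by apply: conn_sym; exists g; apply: path_edge; right.
  by rewrite L'E //; exact: sub.
Qed.

End LabelledGraph.

(** * Extending finite partial actions *)

Section Chains.
Variables (T : Type) (r : T -> T -> Prop).

Fixpoint chain n (x y : T) : Prop :=
  if n is m.+1 then exists2 z, chain m x z & r z y else x = y.

Lemma chain_add m n x y z : chain m x y -> chain n y z -> chain (m + n) x z.
Proof.
move=> xy; elim: n z => [|n IH] z /=; first by move=> <-; rewrite addn0.
by case=> w /IH xw wz; rewrite addnS; exists w.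
Qed.

Lemma chainS m x y z : r x y -> chain m y z -> chain m.+1 x z.
Proof. by move=> xy; apply: (@chain_add 1 m); exists x. Qed.

Lemma chain_head m x z : chain m.+1 x z -> exists2 y, r x y & chain m y z.
Proof.
elim: m z => [|m IH] z [w xw wz]; first by exists z => //; rewrite -xw in wz *.
by have [y xy yw] := IH _ xw; exists y => //; exists w.
Qed.

End Chains.

Lemma chain_conv (T : Type) (r : T -> T -> Prop) n x y :
  chain (fun a b => r b a) n x y -> chain r n y x.
Proof.
elim: n x y => [//|n IH] x y [z xz zy].
by apply: chainS zy _; exact: IH.
Qed.

(** * Finite partial actions of the letters on points *)

Section PartialActions.
Variables (k : nat) (J : finType) (C : J -> {group 'S_k}).
Variables (G : groupType) (phi : 'S_k -> G).
Hypothesis phiM : is_hom phi.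

Local Notation letter := (J * bool)%type.
Local Notation tup := (tup k).

Implicit Types (t : letter -> G) (F : letter -> (pt k) -> (pt k) -> Prop).
Implicit Types (p q x y : (pt k)) (T : tup) (l : letter).

(** A letter commuting with [C j] sends a point fixed by [c] to a point fixed by [c]; as there is at
    most one nonfree point, the letter has no choice but to fix it. *)
Definition nonfree j p := exists c, [/\ c \in C j, c <> 1 & pact p c = p].

Hypothesis nonfree_unique : forall j p q, nonfree j p -> nonfree j q -> p = q.

Lemma nonfree_level j p : nonfree j p -> level p = 0%N.
Proof.
by case=> c [_ c1 pc]; apply: contra_notP c1 => /eqP p0; exact: pact_free p0 pc.
Qed.

Lemma nonfree_pact j p u : u \in C j -> nonfree j p -> nonfree j (pact p u).
Proof.
move=> Cu [c [Cc c1 pc]]; exists (c ^ u); split; first by rewrite groupJ.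
  by move/eqP; rewrite conjg_eq1 => /eqP.
by rewrite pactM -conjgC -pactM pc.
Qed.

Lemma pact_nonfree j p u : u \in C j -> nonfree j p -> pact p u = p.
Proof. by move=> Cu pn; apply: (nonfree_unique (nonfree_pact Cu pn) pn). Qed.

Lemma free_pact_inj j p u v : ~ nonfree j p -> u \in C j -> v \in C j ->
  pact p u = pact p v -> u = v.
Proof.
move=> pf Cu Cv puv; apply/eqP; rewrite eq_mulgV1; apply: contra_notT pf => uv.
exists (u * v^-1); split; first by rewrite groupM ?groupV.
  exact/eqP.
by rewrite -pactM puv pactM mulgV pact1.
Qed.

Definition commuting t := forall l c, c \in C l.1 -> phi c * t l = t l * phi c.

Definition edge t F T (g : G) T' :=
  exists2 l, g = t l & forall i, F l (T i) (T' i).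

Definition domF F l p := exists q, F l p q.
Definition incl F F' := forall l p q, F l p q -> F' l p q.

Lemma edge_ls_closed t F : ls_closed (edge t F).
Proof. by move=> s T g T' [l gl TT']; exists l => // i; rewrite !lsE. Qed.

Lemma edge_incl t F F' : incl F F' ->
  forall T g T', edge t F T g T' -> path phi (edge t F') T g T'.
Proof.
by move=> FF' T g T' [l gl TT']; apply: path_edge; exists l => // i; exact: FF'.
Qed.

(* Points where C j does not act freely are fixed by the letters of type j. The
   letters (j, true) are nilpotent on the other points, so that tuples can be
   moved away along them; the letters (j, false) serve to join components. *)
Record state t F (N : nat) : Prop := State {
  st_fun : forall l p q q', F l p q -> F l p q' -> q = q';
  st_inj : forall l p p' q, F l p q -> F l p' q -> p = p';
  st_equi : forall l c p q, c \in C l.1 -> F l p q -> F l (pact p c) (pact q c);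
  st_fix : forall l p, nonfree l.1 p -> F l p p;
  st_level : forall l p q, F l p q -> (level p <= N)%N /\ (level q <= N)%N;
  st_nil : forall j, exists n, forall p q,
    ~ nonfree j p -> ~ nonfree j q -> ~ chain (F (j, true)) n p q;
  st_valid : valid phi (edge t F) }.

Lemma state_le t F N N' : (N <= N')%N -> state t F N -> state t F N'.
Proof.
move=> NN' [Ff Fi Fe Fn Fl Fnil Fv]; split=> //.
by move=> l p q /Fl[pN qN]; split; exact: leq_trans NN'.
Qed.

Definition conv F l p q := F l q p.
Definition tinv t l := (t l)^-1.

Lemma commuting_tinv t : commuting t -> commuting (tinv t).
Proof.
move=> tC l c /(tC l) ct; rewrite /tinv; apply: (mulgI (t l)).
by rewrite mulgA -ct mulgK mulgA mulgV mul1g.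
Qed.

Lemma tinvK t : tinv (tinv t) = t.
Proof. by apply/funext => l; rewrite /tinv invgK. Qed.

Lemma edge_conv t F T g T' : edge t F T g T' -> edge (tinv t) (conv F) T' g^-1 T.
Proof. by case=> l -> TT'; exists l. Qed.

(** Inverting all letters exchanges domains and ranges, so every extension of a domain also serves
    to extend a range. *)
Lemma state_conv t F N : state t F N -> state (tinv t) (conv F) N.
Proof.
case=> [Ff Fi Fe Fn Fl Fnil Fv]; split=> //.
- by move=> l p q q' /Fi /[apply].
- by move=> l p q q' /Ff /[apply].
- by move=> l c p q Cc; exact: Fe.
- by move=> l p q /Fl[].
- move=> j; have [n nP] := Fnil j; exists n => p q pn qn.
  by move=> /(@chain_conv _ (F (j, true))); exact: nP.
- apply: (valid_same_paths phiM) Fv _ _ => T g T' /edge_conv E.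
    by rewrite tinvK in E; have /(path_sym phiM) := path_edge phi E; rewrite invgK.
  by have /(path_sym phiM) := path_edge phi E; rewrite invgK.
Qed.

Lemma st_free_fwd t F N l p q :
  state t F N -> F l p q -> nonfree l.1 p -> nonfree l.1 q.
Proof. by move=> st pq pn; rewrite (st_fun st pq (st_fix st pn)). Qed.

(** No letter is defined at, or reaches, a point of level above [N], so only the right action of
    'S_k moves such a tuple. *)
Lemma high_conn t F N T i T' : state t F N -> (N < level (T i))%N ->
  conn phi (edge t F) T T' -> exists u, T' = rs T u.
Proof.
move=> st NT; move: T'; apply: conn_ind_class; first by exists 1; rewrite rs1.
- by move=> T1 u [v ->]; exists (v * u); rewrite rsM.
- move=> T1 g T2 [u ->] [l _ /(_ i)]; rewrite rsE => /(st_level st)[].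
  by rewrite level_pact leqNgt NT.
- move=> T1 g T2 [u ->] [l _ /(_ i)]; rewrite rsE => /(st_level st)[_].
  by rewrite level_pact leqNgt NT.
Qed.

Definition low N T := forall i, (level (T i) <= N)%N.

(* F' arises from F by adding to the letter l arrows from P to high new points
   which lie in distinct orbits of 'S_k up to C l.1; no components are merged. *)
Record grow t l (P : (pt k) -> Prop) N F F' : Prop := Grow {
  gr_incl : incl F F';
  gr_new : forall m x y, F' m x y ->
    F m x y \/ [/\ m = l, P x, ~ domF F l x & (N < level y)%N];
  gr_orbit : forall x y x' y' u, (N < level y)%N -> F' l x y -> F' l x' y' ->
    y' = pact y u -> u \in C l.1;
  gr_conn : forall T T', low N T -> low N T' ->
    conn phi (edge t F') T T' -> conn phi (edge t F) T T' }.

Lemma grow_refl t l P N F : state t F N -> grow t l P N F F.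
Proof.
move=> st; split=> //; first by move=> m x y; left.
by move=> x y x' y' u Ny /(st_level st)[_]; rewrite leqNgt Ny.
Qed.

Lemma grow_trans t l P N F1 N2 F2 F3 : state t F2 N2 -> (N <= N2)%N ->
  grow t l P N F1 F2 -> grow t l P N2 F2 F3 -> grow t l P N F1 F3.
Proof.
move=> st2 NN2 [i12 n12 o12 c12] [i23 n23 o23 c23]; split.
- by move=> m x y /i12/i23.
- move=> m x y /n23[/n12//|[ml Px nx N2y]]; right; split=> //.
    by case=> z /i12 xz; apply: nx; exists z.
  exact: leq_ltn_trans NN2 N2y.
- move=> x y x' y' u Ny xy x'y' y'E.
  case/n23: (xy) => [xy2|[_ _ _ N2y]]; last exact: o23 xy x'y' y'E.
  case/n23: (x'y') => [x'y'2|[_ _ _]]; first exact: o12 xy2 x'y'2 y'E.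
  by rewrite y'E level_pact ltnNge (proj2 (st_level st2 xy2)).
- move=> T T' TN T'N /c23 TT'.
  by apply: c12 (TT' _ _) => // i; exact: leq_trans NN2.
Qed.

(** The point [p] is sent to a fresh point and its [C l.1]-orbit is mapped along by equivariance,
    which is consistent because [C l.1] acts freely at [p]. *)
Lemma leaf t F N l p : commuting t -> state t F N -> (level p <= N)%N ->
  exists F' N', [/\ (N <= N')%N, state t F' N', domF F' l p &
    grow t l (fun x => exists2 c, c \in C l.1 & x = pact p c) N F F'].
Proof.
move=> tC st pN; have [pd|pd] := pselect (domF F l p).
  by exists F, N; split=> //; exact: grow_refl st.
have pf : ~ nonfree l.1 p by move=> pn; apply: pd; exists p; exact: (st_fix st pn).
pose z : (pt k) := inr (1, N).
pose F' m x y := F m x y \/ m = l /\ exists c, [/\ c \in C l.1, x = pact p c & y = pact z c].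
have pcd c x : c \in C l.1 -> ~ F l (pact p c) x.
  move=> Cc /(st_equi st (groupVr Cc)); rewrite pactM mulgV pact1 => px.
  by apply: pd; eexists; exact: px.
have zlev c : level (pact z c) = N.+1 by rewrite level_pact.
have zran m c x : ~ F m x (pact z c).
  by move=> /(st_level st)[_]; rewrite zlev ltnn.
have z_inj u v : pact z u = pact z v -> u = v by case; rewrite !mul1g.
have F'lev m x y : F' m x y -> (level x <= N)%N.
  case=> [/(st_level st)[]//|[_ [c [_ -> _]]]].
  by rewrite level_pact.
have F'ran m x y : F' m x y -> (N < level y)%N ->
    m = l /\ exists c, [/\ c \in C l.1, x = pact p c & y = pact z c].
  by case=> [/(st_level st)[_]|//]; rewrite leqNgt => /negP.
have F'fun m x y y' : F' m x y -> F' m x y' -> y = y'.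
  case=> [xy|[-> [c [Cc -> ->]]]] [xy'|[ml [c' [Cc' xE ->]]]].
  - exact: (st_fun st xy xy').
  - by move: xy; rewrite ml xE => /pcd.
  - by move/pcd: xy'.
  - by rewrite (free_pact_inj pf Cc Cc' xE).
have F'inj m x x' y : F' m x y -> F' m x' y -> x = x'.
  case=> [xy|[-> [c [Cc -> ->]]]] [xy'|[ml [c' [Cc' -> yE]]]].
  - exact: (st_inj st xy xy').
  - by move: xy; rewrite yE => /zran.
  - by move/zran: xy'.
  - by rewrite (z_inj _ _ yE).
have F'equi m c x y : c \in C m.1 -> F' m x y -> F' m (pact x c) (pact y c).
  move=> Cc [xy|[ml [c' [Cc' -> ->]]]]; first by left; exact: (st_equi st Cc xy).
  by right; split=> //; exists (c' * c); rewrite !pactM groupM // -ml.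
(* The new edges end in tuples with a fresh entry, previously connected only to their own right
   translates: such components can be grafted. *)
pose D T g T' := [/\ g = t l, forall i, F' l (T i) (T' i) &
                      exists i, (N < level (T' i))%N].
have DE T g T' : D T g T' -> edge t F' T g T' by case=> gl TT' _; exists l.
have [vD cD] : valid phi (addE (edge t F) D) /\ forall T T',
    (forall T1 g T2, D T1 g T2 ->
      ~ conn phi (edge t F) T2 T /\ ~ conn phi (edge t F) T2 T') ->
    conn phi (addE (edge t F) D) T T' -> conn phi (edge t F) T T'.
  apply: (valid_graft phiM) (st_valid st) (@edge_ls_closed _ _) _ _ _.
  - move=> s T g T' [gl TT' [i Ti]]; split=> //; first by move=> j; rewrite !lsE.
    by exists (s^-1 i); rewrite lsE permKV.
  - move=> T1 g1 T1' T2 g2 T2' [-> T1F [i T1i]] [-> T2F _] /(high_conn st T1i)[u T2E].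
    have [_ [c1 [C1 _ T1z]]] := F'ran _ _ _ (T1F i) T1i.
    have : (N < level (T2' i))%N by rewrite T2E rsE level_pact.
    case/(F'ran _ _ _ (T2F i)) => _ [c2 [C2 _ T2z]].
    have Cu : u \in C l.1.
      move: T2z; rewrite T2E rsE T1z pactM => /z_inj /(canRL (mulKg _)) ->.
      by rewrite groupM ?groupV.
    exists u; split=> //; last exact: tC.
    apply: tupP => a; apply: F'inj (T2F a) _; rewrite T2E !rsE.
    exact: F'equi.
  - move=> T1 g1 T1' T2 g2 T2' [_ T1F _] [_ T2F [i T2i]] /(conn_sym phiM) c21.
    have [u T1E] := high_conn st T2i c21.
    by move: (F'lev _ _ _ (T1F i)); rewrite T1E rsE level_pact leqNgt T2i.
have F'D T g T' : edge t F' T g T' -> path phi (addE (edge t F) D) T g T'.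
  case=> m gm TT'; have [[i Ti]|nhigh] := pselect (exists i, (N < level (T' i))%N).
    have [ml _] := F'ran _ _ _ (TT' i) Ti.
    by apply: path_edge; right; split; [rewrite -ml|rewrite -ml|exists i].
  apply: path_edge; left; exists m => // i.
  case: (TT' i) => // -[_ [c [_ _ T'i]]].
  by case: nhigh; exists i; rewrite T'i zlev.
exists F', N.+1; split=> //.
- split=> //.
  + by move=> m x xn; left; exact: (st_fix st xn).
  + move=> m x y xy; split; first by apply: leqW; exact: F'lev xy.
    case: xy => [/(st_level st)[_ /leqW]//|[_ [c [_ _ ->]]]].
    by rewrite zlev.
  (* Fresh points lie outside all domains, so a new arrow can only be the last of a chain; the
     exponent grows by one. *)
  + move=> j; have [n nP] := st_nil st j; exists n.+1 => x y xf yf [w xw wy].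
    have xw' : chain (F (j, true)) n x w.
      elim: n w xw {wy nP} (F'lev _ _ _ wy) => [//|n IH] w [v xv vw] wN.
      exists v; first by apply: IH => //; exact: F'lev vw.
      case: vw => [//|[_ [c [_ _ wE]]]].
      by move: wN; rewrite wE zlev ltnn.
    apply: nP xf _ xw' => wn.
    case: wy => [wy|[jl [c [Cc wE _]]]].
      by apply: yf; exact: (st_free_fwd st wy).
    apply: pf; rewrite -jl /=.
    have := @nonfree_pact j w c^-1; rewrite wE pactM mulgV pact1; apply=> //.
      by rewrite groupV; move: Cc; rewrite -jl.
    by rewrite -wE.
  + apply: (valid_same_paths phiM) vD F'D _ => T g T' [[m gm TT']|/DE]; last exact: path_edge.
    by apply: path_edge; exists m => // i; left.
- by exists z; right; split=> //; exists 1; rewrite !pact1 group1.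
- split; first by move=> *; left.
  + move=> m x y [xy|[ml [c [Cc xE yE]]]]; [by left|right].
    split=> //; first by exists c.
      by case=> w; rewrite xE => /pcd; exact.
    by rewrite yE zlev.
  + move=> x y x' y' u Ny /F'ran/(_ Ny)[_ [c [Cc _ ->]]] x'y' y'E.
    have /(F'ran _ _ _ x'y')[_ [c' [Cc' _]]] : (N < level y')%N.
      by rewrite y'E !level_pact /=.
    rewrite y'E pactM => /z_inj /(canRL (mulKg _)) ->.
    by rewrite groupM ?groupV.
  + move=> T T' TN T'N /(conn_incl phiM F'D); apply: cD => T1 g T2 [_ _ [i T2i]].
    by split=> /(high_conn st T2i)[u TE];
      [move: (TN i)|move: (T'N i)]; rewrite TE rsE level_pact leqNgt T2i.
Qed.


Lemma grow_sub t l (P Q : pt k -> Prop) N F F' : (forall x, P x -> Q x) ->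
  grow t l P N F F' -> grow t l Q N F F'.
Proof.
move=> PQ [gi gn go gc]; split=> // m x y /gn[|[ml /PQ Qx nx Ny]]; first by left.
by right.
Qed.

(** * Moving a whole tuple along a letter *)

Definition orbits l T x := exists i c, c \in C l.1 /\ x = pact (T i) c.

Lemma step t F N l T : commuting t -> state t F N -> low N T ->
  exists F' N' T', [/\ (N <= N')%N, state t F' N', grow t l (orbits l T) N F F' &
    forall i, F' l (T i) (T' i)].
Proof.
move=> tC st TN.
suff [F' [N' [NN' st' gr dom]]] : exists F' N', [/\ (N <= N')%N, state t F' N',
    grow t l (orbits l T) N F F' & forall i, i \in enum 'I_k -> domF F' l (T i)].
  have /boolp.choice[f fP] : forall i, exists y, F' l (T i) y.
    by move=> i; apply: dom; rewrite mem_enum.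
  have fI : injective f.
    by move=> i i' fi; apply: (@tup_inj _ T); apply: (st_inj st' (fP i)); rewrite fi.
  by exists F', N', (mktup fI); split=> // i; rewrite mktupE.
elim: (enum 'I_k) => [|i s [F1 [N1 [NN1 st1 gr1 dom1]]]].
  by exists F, N; split=> //; exact: grow_refl st.
have [F2 [N2 [N12 st2 dom2 gr2]]] := leaf l tC st1 (leq_trans (TN i) NN1).
exists F2, N2; split=> //; first exact: leq_trans N12.
  apply: (grow_trans st1 NN1 gr1); apply: grow_sub gr2 => x [c Cc ->].
  by exists i, c.
move=> i'; rewrite inE => /orP[/eqP -> //|/dom1[y xy]].
by exists y; exact: gr_incl gr2 _ _ _ xy.
Qed.

Lemma chain_sub (r r' : pt k -> pt k -> Prop) n x y :
  (forall x y, r x y -> r' x y) -> chain r n x y -> chain r' n x y.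
Proof.
move=> rr'; elim: n y => [//|n IH] y [z /IH xz zy]; exists z => //; exact: rr'.
Qed.

Lemma chain_nonfree t F N l n p q :
  state t F N -> chain (F l) n p q -> nonfree l.1 p -> nonfree l.1 q.
Proof.
move=> st; elim: n q => [q <- //|n IH] q [z /IH pz zq] /pz.
exact: (st_free_fwd st zq).
Qed.

Lemma chain_fun t F N l n p q q' : state t F N ->
  chain (F l) n p q -> chain (F l) n p q' -> q = q'.
Proof.
move=> st; elim: n q q' => [q q' <- //|n IH] q q' [z pz zq] [z' pz' zq'].
by move: zq'; rewrite -(IH _ _ pz pz'); exact: (st_fun st zq).
Qed.

Lemma chain_back t F N l m n p q r : state t F N ->
  chain (F l) (n + m) p r -> chain (F l) m q r -> chain (F l) n p q.
Proof.
move=> st; elim: m r => [r|m IH r]; first by rewrite addn0 => pr ->.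
rewrite addnS => -[z pz zr] [z' qz' z'r].
by apply: IH qz'; rewrite -(st_inj st zr z'r).
Qed.

(* T' is reached from T by n applications of l, prolonging F where needed. *)
Record run t l n N F T F' T' : Prop := Run {
  run_grow : grow t l (fun=> True) N F F';
  run_dom : forall x, (N < level x)%N -> domF F' l x -> exists w, F' l w x;
  run_chain : forall i, chain (F' l) n (T i) (T' i);
  run_conn : conn phi (edge t F') T T';
  run_end : (forall i, ~ nonfree l.1 (T i) -> ~ domF F l (T i)) ->
    forall i, ~ nonfree l.1 (T i) -> ~ domF F' l (T' i) }.

Lemma run_exists t F N l n T : commuting t -> state t F N -> low N T ->
  exists F' N' T', [/\ (N <= N')%N, state t F' N', low N' T' &
    run t l n N F T F' T'].
Proof.
move=> tC st TN; elim: n => [|n [F1 [N1 [T1 [NN1 st1 T1N [gr1 d1 c1 k1 e1]]]]]].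
  exists F, N, T; split=> //; split=> //; first exact: grow_refl st.
  - by move=> x Nx [y /(st_level st)[]]; rewrite leqNgt Nx.
  - exact: conn_refl.
have [F2 [N2 [T2 [N12 st2 gr2 T12]]]] := step l tC st1 T1N.
have T2N : low N2 T2 by move=> i; case: (st_level st2 (T12 i)).
exists F2, N2, T2; split=> //; first exact: leq_trans N12.
have i2 := gr_incl gr2; split.
- by apply: (grow_trans st1 NN1 gr1); exact: grow_sub gr2.
- move=> x Nx [y /(gr_new gr2)[xy|[_ [i [c [Cc xE]]] _ _]]].
    by have [|w wx] := d1 x Nx; [exists y|exists w; exact: i2].
  have := c1 i; case: n {c1 d1 e1} => [|n] /=.
    by move=> Ti; move: Nx; rewrite xE level_pact -Ti ltnNge TN.
  case=> w _ wi; exists (pact w c); rewrite xE.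
  exact: i2 (st_equi st1 Cc wi).
- by move=> i; exists (T1 i) => //; apply: chain_sub (c1 i) => x y; exact: i2.
- apply: conn_trans (conn_incl phiM (edge_incl i2) k1) _.
  by exists (t l); apply: path_edge; exists l.
- move=> Tend i Ti [y /(gr_new gr2)].
  have hi : (N1 < level (T2 i))%N.
    case: (gr_new gr2 (T12 i)) => [T1i|[]//].
    by case: (e1 Tend i Ti); exists (T2 i).
  case=> [/(st_level st1)[]|[_ [a [c [Cc T2i]]] _ _]]; first by rewrite leqNgt hi.
  by move: hi; rewrite T2i level_pact ltnNge T1N.
Qed.

Section RunFacts.
Variables (t : letter -> G) (l : letter) (n N N' : nat) (T T' : tup).
Variables F F' : letter -> pt k -> pt k -> Prop.
Hypotheses (stF : state t F N) (stF' : state t F' N') (rn : run t l n N F T F' T').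

Lemma run_low m x y : F' m x y -> (level y <= N)%N -> F m x y.
Proof. by case/(gr_new (run_grow rn)) => // -[_ _ _]; rewrite ltnNge => /negP. Qed.

Lemma run_high m x y : F' m x y -> (N < level y)%N -> m = l.
Proof. by case/(gr_new (run_grow rn)) => [/(st_level stF)[_]|[]//]; rewrite leqNgt => /negP. Qed.

Lemma run_other m x y : F' m x y -> m <> l -> F m x y.
Proof. by case/(gr_new (run_grow rn)) => // -[]. Qed.

Lemma run_chain_low m x y : chain (F' l) m x y -> (level y <= N)%N -> chain (F l) m x y.
Proof.
elim: m y => [//|m IH] y [z xz zy] yN; have zy' := run_low zy yN.
by exists z => //; apply: IH => //; case: (st_level stF zy').
Qed.

Lemma run_chain_lowV m x y : chain (F' l) m x y -> (level y <= N)%N -> (level x <= N)%N.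
Proof.
elim: m y => [y -> //|m IH] y [z xz zy] yN; apply: (IH z) => //.
by case: (st_level stF (run_low zy yN)).
Qed.

Lemma run_chain_high m x y : ~ domF F l x -> chain (F' l) m.+1 x y -> (N < level y)%N.
Proof.
move=> xd xy; rewrite ltnNge; apply: contra_notN xd => yN.
by have [z xz _] := chain_head (run_chain_low xy yN); exists z.
Qed.

Lemma run_C x y u w w' : (N < level x)%N -> F' l w x -> y = pact x u ->
  F' l w' y -> u \in C l.1.
Proof. by move=> Nx wx yE w'y; apply: (gr_orbit (run_grow rn)) Nx wx w'y yE. Qed.

End RunFacts.

(** If [T] and [Z] are symmetric, the arrows from [T i] to [Z i] are automatically
    [C j]-equivariant, since [pact (T i) c] is [T (c i)]; a letter of type [j] may therefore send
    [T] to [Z]. *)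
Definition symmetric j T := forall c, c \in C j -> ls c T = rs T c.

Lemma symmetricE j T c i : symmetric j T -> c \in C j -> T (c i) = pact (T i) c.
Proof. by move=> Ts Cc; rewrite -lsE Ts // rsE. Qed.

(** Whether an entry is nonfree depends on its index alone, so any two symmetric tuples have their
    nonfree entries at the same places. *)
Lemma symmetric_nonfree j T i : symmetric j T ->
  nonfree j (T i) <-> exists c, [/\ c \in C j, c <> 1 & c i = i].
Proof.
move=> Ts; split=> -[c [Cc c1]] ci; exists c; split=> //.
  by apply: (@tup_inj _ T); rewrite (symmetricE _ Ts).
by rewrite -(symmetricE _ Ts) // ci.
Qed.

Lemma symmetric_nonfree_eq j T T' i : symmetric j T -> symmetric j T' ->
  nonfree j (T i) -> T' i = T i.
Proof.
move=> Ts T's Ti; apply: (nonfree_unique _ Ti).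
by apply/(symmetric_nonfree i T's)/(symmetric_nonfree i Ts).
Qed.

Lemma symmetric_base j : symmetric j base.
Proof. by move=> c _; exact: ls_base. Qed.

(** A nonfree point has level 0, hence is an entry of [base], and symmetric tuples share their
    nonfree entries with [base]. *)
Lemma symmetric_onto j T x : symmetric j T -> nonfree j x -> exists i, T i = x.
Proof.
move=> Ts xn; have: level x = 0%N := nonfree_level xn.
case: x xn => [i|[]//] xn _; exists i.
have bi : nonfree j (base i) by rewrite baseE.
by rewrite (symmetric_nonfree_eq (@symmetric_base j) Ts bi) baseE.
Qed.

Lemma symmetric_chain t F N l n T T' : state t F N -> symmetric l.1 T ->
  (forall i, chain (F l) n (T i) (T' i)) -> symmetric l.1 T'.
Proof.
move=> st Ts TT' c Cc; apply: tupP => i; rewrite lsE rsE.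
apply: (chain_fun st (TT' (c i))); rewrite (symmetricE _ Ts) //.
move: (TT' i); elim: n (T' i) {TT'} => [y <- //|n IH] y [z /IH zc zy].
by exists (pact z c) => //; exact: (st_equi st Cc zy).
Qed.

(** * Components of tuples that mix new end points with old points *)

Section PrivateClass.
Variables (t : letter -> G) (l : letter) (n N N' : nat) (B Z : tup).
Variables F F' : letter -> pt k -> pt k -> Prop.
Hypotheses (stF : state t F N) (stF' : state t F' N') (rn : run t l n N F B F' Z).
Hypothesis BF : forall i, ~ nonfree l.1 (B i) -> ~ domF F l (B i).
Hypothesis n_nil : forall p q,
  ~ nonfree l.1 p -> ~ nonfree l.1 q -> ~ chain (F l) n p q.

Lemma private_end i : ~ nonfree l.1 (Z i) -> ~ domF F' l (Z i).
Proof.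
move=> Zi; apply: (run_end rn BF) => /(chain_nonfree stF' (run_chain rn i)).
exact: Zi.
Qed.

(** By injectivity, walking back from [Z i] retraces the run; with fewer than [n] steps one stays on
    points after [B i], and these are new because [l] was undefined at [B i]. *)
Lemma private_high m x i : ~ nonfree l.1 (Z i) -> (m < n)%N ->
  chain (F' l) m x (Z i) -> (N < level x)%N /\ exists w, F' l w x.
Proof.
move=> Zi mn xZ; have Bi : ~ nonfree l.1 (B i).
  by move=> /(chain_nonfree stF' (run_chain rn i)).
have := run_chain rn i; rewrite -{1}(subnK (ltnW mn)) => /(chain_back stF')/(_ xZ).
rewrite -(ltn_predK (n := n - m) (m := 0)) ?subn_gt0 // => Bx.
split; first exact: (run_chain_high stF rn (BF Bi) Bx).
by case: Bx => w _ wx; exists w.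
Qed.

(* The component of a tuple M mixing new end points with old points is the
   l-chain ending in M. *)
Lemma private_conn (M X : tup) a i0 i1 : (0 < n)%N ->
  ~ nonfree l.1 (Z a) -> M i0 = Z a ->
  ~ nonfree l.1 (M i1) -> (level (M i1) <= N)%N ->
  conn phi (edge t F') M X ->
  exists m Y u, [/\ (m < n)%N, X = rs Y u & forall i, chain (F' l) m (Y i) (M i)].
Proof.
move=> n0 Za Mi0 M1f M1N; move: X; apply: conn_ind_class.
- by exists 0%N, M, 1; rewrite rs1.
- move=> X v [m [Y [u [mn -> YM]]]].
  by exists m, Y, (u * v); rewrite rsM.
- move=> X g X' [m [Y [u [mn -> YM]]]] [l' _ YX'].
  have YZ : chain (F' l) m (Y i0) (Z a) by rewrite -Mi0.
  have [Yhigh [w wY]] := private_high Za mn YZ.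
  have Yu : F' l' (pact (Y i0) u) (X' i0) by rewrite -rsE.
  have Yul : (N < level (pact (Y i0) u))%N by rewrite level_pact.
  have l'l : l' = l.
    case: (gr_new (run_grow rn) Yu) => [/(st_level stF)[]|[]//].
    by rewrite leqNgt Yul.
  rewrite {}l'l in YX' Yu.
  have [w' w'Y] := run_dom rn Yul (ex_intro _ _ Yu).
  have Cu := run_C rn Yhigh wY erefl w'Y.
  have YX i : F' l (Y i) (pact (X' i) u^-1).
    have := st_equi stF' (groupVr Cu) (YX' i).
    by rewrite rsE pactM mulgV pact1.
  case: m mn YM YZ => [|m] mn YM YZ.
    by case: (private_end Za); rewrite -YZ; eexists; exact: YX.
  exists m, (rs X' u^-1), u; split; first exact: ltnW.
    by rewrite rsM mulVg rs1.
  move=> i; have [y Yy yM] := chain_head (YM i).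
  by rewrite rsE (st_fun stF' (YX i) Yy).
- move=> X g X' [m [Y [u [mn -> YM]]]] [l' _ X'Y].
  have YZ : chain (F' l) m (Y i0) (Z a) by rewrite -Mi0.
  have [Yhigh [w wY]] := private_high Za mn YZ.
  have Yu : F' l' (X' i0) (pact (Y i0) u) by rewrite -rsE.
  have Yul : (N < level (pact (Y i0) u))%N by rewrite level_pact.
  have l'l := run_high stF rn Yu Yul; rewrite {}l'l in X'Y Yu.
  have Cu := run_C rn Yhigh wY erefl Yu.
  have XY i : F' l (pact (X' i) u^-1) (Y i).
    have := st_equi stF' (groupVr Cu) (X'Y i).
    by rewrite rsE pactM mulgV pact1.
  have YM' i : chain (F' l) m.+1 (rs X' u^-1 i) (M i).
    by rewrite rsE; exact: chainS (XY i) (YM i).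
  exists m.+1, (rs X' u^-1), u; split=> //; last by rewrite rsM mulVg rs1.
  (* Depth [n] is out of reach: the old entry at [i1] would be the end of a chain of [n] arrows of
     [F] between free points. *)
  rewrite ltn_neqAle mn andbT; apply/eqP => mnE; rewrite mnE in YM'.
  have c1 := run_chain_low stF rn (YM' i1) M1N.
  exact: (n_nil (fun h => M1f (chain_nonfree stF c1 h)) M1f c1).
Qed.

End PrivateClass.

Lemma conn_lsV t F s T T' : conn phi (edge t F) (ls s T) T' <->
  conn phi (edge t F) T (ls s^-1 T').
Proof.
split=> TT'.
  have := conn_ls s^-1 (@edge_ls_closed t F) TT'.
  by rewrite lsM mulVg ls1.
by have := conn_ls s (@edge_ls_closed t F) TT'; rewrite lsM mulgV ls1.
Qed.

(** * Joining two components by one letter *)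

Section Join.
Variables (t : letter -> G) (j : J) (n N N' : nat) (T B Z : tup).
Variables F F' : letter -> pt k -> pt k -> Prop.
Let f : letter := (j, true).
Let e : letter := (j, false).
Hypothesis tC : commuting t.
Hypotheses (stF : state t F N) (stF' : state t F' N') (rn : run t f n N F B F' Z).
Hypotheses (NN' : (N <= N')%N) (n0 : (0 < n)%N) (TN : low N T) (BN : low N B).
Hypotheses (Ts : symmetric j T) (Bs : symmetric j B).
Hypothesis Tstab : forall s, conn phi (edge t F) (ls s T) T -> s \in C j.
Hypothesis BT : forall s, ~ conn phi (edge t F) B (ls s T).
Hypothesis TF : forall i, ~ nonfree j (T i) -> ~ domF F e (T i).
Hypothesis BF : forall i, ~ nonfree j (B i) -> ~ domF F f (B i).
Hypothesis n_nil : forall p q, ~ nonfree j p -> ~ nonfree j q -> ~ chain (F f) n p q.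

Definition joined m x y := F' m x y \/ m = e /\ exists i, x = T i /\ y = Z i.

Let Zs : symmetric j Z.
Proof. by apply: (@symmetric_chain _ _ _ f _ _ _ stF' Bs); exact: (run_chain rn). Qed.

Let ran_Z i : exists w, F' f w (Z i).
Proof. by have := run_chain rn i; case: n n0 => // m _ [w _ wZ]; exists w. Qed.

Let high_Z i : ~ nonfree j (Z i) -> (N < level (Z i))%N.
Proof.
by move=> Zi; have [] := private_high stF stF' rn BF (i := i) (m := 0) Zi n0 erefl.
Qed.

Let Fe x y : F' e x y -> F e x y.
Proof. by move=> xy; apply: (run_other rn xy). Qed.

Let TZ_nonfree i : nonfree j (T i) -> Z i = T i.
Proof. exact: symmetric_nonfree_eq. Qed.

Let ZT_nonfree i : nonfree j (Z i) -> T i = Z i.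
Proof. exact: symmetric_nonfree_eq. Qed.

Let joined_fun m x y y' : joined m x y -> joined m x y' -> y = y'.
Proof.
have TFZ i y1 : F' e (T i) y1 -> y1 = Z i.
  move=> /Fe xy; have Ti : nonfree j (T i).
    by apply: contrapT => /TF; apply; exists y1.
  by rewrite (TZ_nonfree Ti); apply: (st_fun stF xy); exact: (st_fix stF).
case=> [xy|[-> [i [-> ->]]]] [xy'|[me [i' [xE ->]]]].
- exact: (st_fun stF' xy xy').
- by move: xy; rewrite me xE => /TFZ.
- by rewrite (TFZ _ _ xy').
- by rewrite (tup_inj xE).
Qed.

Let joined_inj m x x' y : joined m x y -> joined m x' y -> x = x'.
Proof.
have TFZ i x1 : F' e x1 (Z i) -> x1 = T i.
  move=> /Fe xy; have Zi : nonfree j (Z i).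
    by apply: contrapT => /high_Z; rewrite ltnNge; case: (st_level stF xy) => _ ->.
  by rewrite (ZT_nonfree Zi); apply: (st_inj stF xy); exact: (st_fix stF).
case=> [xy|[-> [i [-> ->]]]] [xy'|[me [i' [-> yE]]]].
- exact: (st_inj stF' xy xy').
- by move: xy; rewrite me yE => /TFZ.
- by rewrite (TFZ _ _ xy').
- by rewrite (tup_inj yE).
Qed.

Let joined_equi m c x y : c \in C m.1 -> joined m x y -> joined m (pact x c) (pact y c).
Proof.
move=> Cc [xy|[me [i [-> ->]]]]; first by left; exact: (st_equi stF').
right; split=> //; exists (c i); rewrite !(symmetricE (j := j)) //; by rewrite me in Cc.
Qed.

Let domE x y : joined e x y -> (level x <= N)%N.
Proof. by case=> [/Fe/(st_level stF)[]//|[_ [i [-> _]]]]. Qed.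

(* The new edges between T and Z are reversed, so that grafting relabels the
   component of T and not that of base, to which Z belongs. *)
Let special T1 (g : G) T2 := exists s, [/\ T1 = ls s Z, T2 = ls s T & g = (t e)^-1].

(** These are the unwanted edges: some entries follow a new arrow to [Z], while some free entry
    follows an old arrow. Their targets are tuples as in [private_conn]. *)
Let mixed T1 (g : G) T2 := [/\ g = t e, forall i, joined e (T1 i) (T2 i),
  exists i a, T2 i = Z a /\ ~ nonfree j (Z a) &
  exists i, ~ nonfree j (T2 i) /\ (level (T2 i) <= N)%N].

Let conn_old T1 T2 : low N T1 -> low N T2 ->
  conn phi (edge t F') T1 T2 -> conn phi (edge t F) T1 T2.
Proof. exact: gr_conn (run_grow rn) _ _. Qed.

Let low_ls s T1 : low N T1 -> low N (ls s T1).
Proof. by move=> T1N i; rewrite lsE. Qed.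

(** By [Tstab], permutations preserving the component of [T] lie in [C j], where symmetry turns them
    into right translations commuting with the letter; [BT] keeps sources and targets apart. *)
Let special_valid : valid phi (addE (edge t F') special).
Proof.
apply: (proj1 (valid_graft phiM (st_valid stF') (@edge_ls_closed _ _) _ _ _)).
- by move=> s T1 g T2 [u [-> -> ->]]; exists (s * u); rewrite !lsM.
- move=> T1 g1 T1' T2 g2 T2' [s1 [-> -> ->]] [s2 [-> -> ->]] /(conn_sym phiM).
  move/conn_lsV; rewrite lsM => /(conn_sym phiM)/(conn_old (low_ls _ TN) TN).
  move=> /Tstab; rewrite -groupV invgM invgK => Cc.
  have ls2 X : symmetric j X -> ls s2 X = rs (ls s1 X) (s1^-1 * s2).
    by move=> Xs; rewrite -lrs -Xs // lsM mulKVg.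
  exists (s1^-1 * s2); rewrite !ls2 //; split=> //.
  exact: (commuting_tinv tC).
- move=> T1 g1 T1' T2 g2 T2' [s1 [-> _ _]] [s2 [_ -> _]].
  move=> /conn_lsV; rewrite lsM => /(conn_trans (run_conn rn)).
  by move=> /(conn_old BN (low_ls _ TN)); exact: BT.
Qed.

(** The special edges do not touch this component. A translate of [T] has no new entry; a translate
    of [Z] with an old entry has a nonfree entry there, which would persist along the chain up to
    the free entry [T2 i1]. *)
Let mixed_class T1 g T2 X : mixed T1 g T2 -> conn phi (addE (edge t F') special) T2 X ->
  exists m Y u, [/\ (m < n)%N, X = rs Y u & forall i, chain (F' f) m (Y i) (T2 i)].
Proof.
move=> [_ _ [i0 [a [T2i0 Za]]] [i1 [T2f T2N]]].
have cl X' := @private_conn _ _ _ _ _ _ _ _ _ stF stF' rn BF n_nil T2 X' a i0 i1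
  n0 Za T2i0 T2f T2N.
move=> T2X; apply: (cl _); apply: conn_addE_untouched T2X => // T3 _ T4 [s [-> -> _]].
have Yhigh m (Y : tup) : (m < n)%N -> (forall i, chain (F' f) m (Y i) (T2 i)) ->
    (N < level (Y i0))%N /\ exists w, F' f w (Y i0).
  by move=> mn /(_ i0); rewrite T2i0; exact: (private_high stF stF' rn BF Za mn).
split=> /cl[m [Y [u [mn YE YT2]]]]; have [Yi0 [w wY]] := Yhigh _ _ mn YT2.
  have YZ i : pact (Y i) u = Z (s i) by rewrite -rsE -YE lsE.
  have Cu : u \in C j.
    have [w' w'Z] := ran_Z (s i0).
    exact: (run_C rn Yi0 wY (esym (YZ i0)) w'Z).
  have Yi1 := run_chain_lowV stF rn (YT2 i1) T2N.
  have Zn : nonfree j (Z (s i1)).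
    by apply: contrapT => /high_Z; rewrite -YZ level_pact ltnNge Yi1.
  apply: T2f; apply: (chain_nonfree stF' (YT2 i1)) => /=.
  rewrite -[Y i1]pact1 -(mulgV u) -pactM YZ.
  by apply: nonfree_pact Zn; rewrite groupV.
by move: (TN (s i0)); rewrite -lsE YE rsE level_pact leqNgt Yi0.
Qed.

(** Sources consist of points of level at most [N], whereas tuples in the component of a target have
    a higher entry. Two targets in one component both sit at the end of the chain, where [f] is
    undefined on an entry, so they differ by an element of [C j]. *)
Let mixed_valid : valid phi (addE (addE (edge t F') special) mixed).
Proof.
have sls : ls_closed special.
  by move=> s T1 g T2 [u [-> -> ->]]; exists (s * u); rewrite !lsM.
apply: (proj1 (valid_graft phiM special_valid _ _ _ _)).
- by apply: addE_ls_closed => //; exact: edge_ls_closed.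
- move=> s T1 g T2 [gE T12 [i0 [a [T2i0 Za]]] [i1 T2i1]]; split=> //.
  + by move=> i; rewrite !lsE.
  + by exists (s^-1 i0), a; rewrite lsE permKV.
  + by exists (s^-1 i1); rewrite lsE permKV.
- move=> T1 g1 T1' T2 g2 T2' m1 m2 /(mixed_class m1)[m [Y [u [mn T2E YT]]]].
  have [gE2 T2J [i2 [a2 [T2i2 Za2]]] _] := m2.
  have [gE1 T1J [i1 [a1 [T1i1 Za1]]] _] := m1.
  have Z2E : Z a2 = pact (Y i2) u by rewrite -T2i2 T2E rsE.
  case: m mn YT => [|m] mn YT.
    have YE : Y = T1' by apply: tupP => i; exact: YT.
    rewrite {Y YT Z2E}YE in T2E *.
    have Cu : u \in C j.
      have [w wZ] := ran_Z a1; have Zh := high_Z Za1.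
      have Z1E : T2' i1 = pact (Z a1) u by rewrite T2E rsE T1i1.
      case: (T2J i1) => [/Fe/(st_level stF)[_]|[_ [i [_ T2i1]]]].
        by rewrite Z1E level_pact leqNgt Zh.
      have [w' w'Z] := ran_Z i; rewrite -T2i1 in w'Z.
      exact: (run_C rn Zh wZ Z1E w'Z).
    exists u; split=> //; last by rewrite gE1 gE2; exact: tC.
    apply: tupP => i; apply: joined_inj (T2J i) _; rewrite T2E !rsE.
    exact: joined_equi.
  have [y Yy _] := chain_head (YT i2).
  have Yh : (N < level (Y i2))%N by rewrite -(level_pact _ u) -Z2E high_Z.
  have [w wY] := run_dom rn Yh (ex_intro _ _ Yy).
  have [w' w'Z] := ran_Z a2.
  have Cu := run_C rn Yh wY Z2E w'Z.
  case: (private_end stF' rn BF Za2); exists (pact y u); rewrite Z2E.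
  exact: (st_equi stF' Cu Yy).
- move=> T1 g1 T1' T2 g2 T2' m1 m2 /(conn_sym phiM) /(mixed_class m2).
  case=> m [Y [u [mn T1E YT]]].
  have [_ T1J _ _] := m1; have [_ _ [i2 [a2 [T2i2 Za2]]] _] := m2.
  move: (YT i2); rewrite T2i2 => /(private_high stF stF' rn BF Za2 mn)[Yh _].
  by move: (domE (T1J i2)); rewrite T1E rsE level_pact leqNgt Yh.
Qed.

(** A new edge using an old arrow between free points is mixed. Without such an arrow every entry
    follows some [T a] to [Z a], since nonfree points occur in [T] as well, and the edge is a
    special one reversed. *)
Let joined_paths T1 g T2 : edge t joined T1 g T2 ->
  path phi (addE (addE (edge t F') special) mixed) T1 g T2.
Proof.
case=> l -> T12.
have [old|/existsNP[i0 ni0]] := pselect (forall i, F' l (T1 i) (T2 i)).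
  by apply: path_edge; left; left; exists l.
have le : l = e by case: (T12 i0) => // -[].
rewrite {l}le in T12 ni0 *.
have [a [Ta Za]] : exists a, T1 i0 = T a /\ T2 i0 = Z a.
  by case: (T12 i0) => // -[].
have Zaf : ~ nonfree j (Z a).
  move=> Zn; apply: ni0; rewrite Ta Za (ZT_nonfree Zn).
  exact: (st_fix stF').
have [[i [Fi fi]]|nold] :=
    pselect (exists i, F' e (T1 i) (T2 i) /\ ~ nonfree j (T2 i)).
  apply: path_edge; right; split=> //; first by exists i0, a.
  by exists i; split=> //; case: (st_level stF (Fe Fi)).
have /boolp.choice[h hP] : forall i, exists a, T1 i = T a /\ T2 i = Z a.
  move=> i; case: (T12 i) => [Fi|[_ //]].
  have T2n : nonfree j (T2 i) by apply: contrapT => T2f; apply: nold; exists i.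
  have [b Zb] := symmetric_onto Zs T2n; exists b; split=> //.
  rewrite -Zb in T2n Fi *; rewrite (ZT_nonfree T2n).
  by apply: (st_inj stF' Fi); exact: (st_fix stF').
have hI : injective h.
  by move=> i i' hii; apply: (@tup_inj _ T1); case: (hP i) (hP i') => -> _ [-> _]; rewrite hii.
rewrite -[t e]mul1g -[t e]invgK; apply: path_bwd (path_refl _ _ _) _; left; right.
by exists (perm hI); split=> //; apply: tupP => i; rewrite lsE permE; case: (hP i).
Qed.

Lemma join_state : state t joined N'.
Proof.
split.
- exact: joined_fun.
- exact: joined_inj.
- exact: joined_equi.
- by move=> l p pn; left; exact: (st_fix stF').
- move=> l p q [/(st_level stF')//|[_ [i [-> ->]]]]; split.
    exact: leq_trans (TN i) NN'.
  by have [w /(st_level stF')[]] := ran_Z i.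
- move=> j'; have [m mP] := st_nil stF' j'; exists m => p q pf qf pq.
  apply: (mP p q pf qf); apply: chain_sub pq => x y [//|[]//].
- apply: (valid_same_paths phiM) mixed_valid joined_paths _.
  move=> T1 g T2 [[[l gl T12]|[s [-> -> ->]]]|[gE T12 _ _]].
  + by apply: path_edge; exists l => // i; left.
  + rewrite -[_^-1]mul1g; apply: path_bwd (path_refl _ _ _) _; exists e => // i.
    by rewrite !lsE; right; split=> //; exists (s i).
  + by apply: path_edge; exists e.
Qed.

Lemma join_conn : conn phi (edge t joined) B T.
Proof.
apply: (conn_trans (y := Z)).
  by apply: conn_incl (run_conn rn) => //; apply: edge_incl => l p q; left.
apply: (conn_sym phiM); exists (t e); apply: path_edge; exists e => // i.
by right; split=> //; exists i.
Qed.

End Join.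

(** * Fulfilling one requirement by a finite extension *)

Lemma conn_conv t F T T' :
  conn phi (edge (tinv t) (conv F)) T T' <-> conn phi (edge t F) T T'.
Proof.
split; apply: (conn_incl phiM) => T1 g T2 /edge_conv E.
  by rewrite tinvK in E; have /(path_sym phiM) := path_edge phi E; rewrite invgK.
by have /(path_sym phiM) := path_edge phi E; rewrite invgK.
Qed.

Lemma conn_mono t F F' T T' : incl F F' ->
  conn phi (edge t F) T T' -> conn phi (edge t F') T T'.
Proof. by move=> FF'; apply: (conn_incl phiM); exact: edge_incl. Qed.

(** A run as long as the nilpotency exponent cannot stay among old points, except at nonfree
    entries. *)
Lemma run_free_high t F N F' N' l n T T' : state t F N -> state t F' N' ->
  (forall p q, ~ nonfree l.1 p -> ~ nonfree l.1 q -> ~ chain (F l) n p q) ->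
  run t l n N F T F' T' -> forall i, ~ nonfree l.1 (T' i) -> (N < level (T' i))%N.
Proof.
move=> st st' nil rn i T'i; rewrite ltnNge; apply/negP => T'N.
have c := run_chain_low st rn (run_chain rn i) T'N.
exact: (nil _ _ (fun h => T'i (chain_nonfree st c h)) T'i c).
Qed.

Definition extends t F N F' N' :=
  [/\ (N <= N')%N, state t F' N' & incl F F'].

Lemma extend_dom t F N l p : commuting t -> state t F N ->
  exists F' N', extends t F N F' N' /\ domF F' l p.
Proof.
move=> tC st; have st' := state_le (leq_maxl N (level p)) st.
have [F' [N' [NN' sF' dp gr]]] := leaf l tC st' (leq_maxr _ _).
exists F', N'; split=> //; split=> //; last exact: gr_incl gr.
exact: leq_trans (leq_maxl _ _) NN'.
Qed.

Lemma extend_ran t F N l p : commuting t -> state t F N ->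
  exists F' N', extends t F N F' N' /\ domF (conv F') l p.
Proof.
move=> tC /state_conv st.
have [F' [N' [[NN' sF' FF'] dp]]] := extend_dom l p (commuting_tinv tC) st.
exists (conv F'), N'; split=> //; split=> //; last by move=> m x y /FF'.
by rewrite -(tinvK t); exact: state_conv.
Qed.

(* Every tuple is equivalent to a base tuple, or up to the actions of 'S_k on
   both sides its symmetries are exactly those in C j. *)
Hypothesis centre_class : forall T, (exists u, T = rs base u) \/
  exists j s v, symmetric j (rs (ls s T) v) /\
    forall s' u, ls s' (rs (ls s T) v) = rs (rs (ls s T) v) u -> s' \in C j.

(** Both tuples are first replaced, within their components, by tuples fit for the join: [e] must be
    undefined at the free entries of one, and [f] at those of the other. *)
Lemma extend_symmetric t F N j T : commuting t -> state t F N -> low N T ->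
  symmetric j T -> (forall s, conn phi (edge t F) (ls s T) T -> s \in C j) ->
  (forall s, ~ conn phi (edge t F) base (ls s T)) ->
  exists F' N', extends t F N F' N' /\ conn phi (edge t F') base T.
Proof.
move=> tC st TN Ts Tstab Tbase; pose f : letter := (j, true); pose e : letter := (j, false).
have ef : e <> f by case.
have [n nP] := st_nil st j.
have [F1 [N1 [T1 [NN1 st1 T1N r1]]]] := run_exists f n tC st TN.
have bN1 : low N1 base by move=> i; rewrite baseE.
have [n1 n1P] := st_nil st1 j.
have [F2 [N2 [B [N12 st2 BN r2]]]] := run_exists f n1 tC st1 bN1.
(* The letter [f] may be defined at [B], because the [f]-chain of one entry of [base] can pass
   through another entry. The free entries of [B] are new to [e], so one backward step along [e]
   leads to fresh points without [f]-arrows. *)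
have [F3c [N3 [B' [N23 st3c gr3 BB']]]] :=
  step e (commuting_tinv tC) (state_conv st2) BN.
pose F3 := conv F3c.
have st3 : state t F3 N3 by rewrite -(tinvK t); exact: state_conv st3c.
have i3 : incl F2 F3 by move=> l x y /(gr_incl gr3).
have c3 U U' : low N2 U -> low N2 U' ->
    conn phi (edge t F3) U U' -> conn phi (edge t F2) U U'.
  move=> UN U'N UU'; apply/conn_conv; apply: (gr_conn gr3) => //.
  by apply/(conn_conv (tinv t) F3c); rewrite tinvK.
(* None of the three extensions merges components of old tuples, so the bound on the stabiliser of
   the component of [T] and its separation from [base] survive. *)
have cons U U' : low N U -> low N U' ->
    conn phi (edge t F3) U U' -> conn phi (edge t F) U U'.
  have low1 V : low N V -> low N1 V by move=> VN i; exact: leq_trans NN1.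
  have low2 V : low N V -> low N2 V by move=> /low1 VN i; exact: leq_trans N12.
  move=> UN U'N /(c3 _ _ (low2 _ UN) (low2 _ U'N)).
  move=> /(gr_conn (run_grow r2) (low1 _ UN) (low1 _ U'N)).
  exact: (gr_conn (run_grow r1) UN U'N).
have i13 : incl F1 F3 by move=> l x y /(gr_incl (run_grow r2))/i3.
have TT1 : conn phi (edge t F3) T T1 := conn_mono i13 (run_conn r1).
have T1s : symmetric j T1 := symmetric_chain (l := f) st1 Ts (run_chain r1).
have Bs : symmetric j B :=
  symmetric_chain (l := f) st2 (@symmetric_base j) (run_chain r2).
have B's : symmetric j B'.
  by apply: (@symmetric_chain _ _ _ e 1 _ _ st3c Bs) => i; exists (B i).
have free_B i : ~ nonfree j (B' i) -> (N2 < level (B' i))%N.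
  move=> B'i; have Bi : ~ nonfree j (B i).
    by move=> Bn; apply: B'i; exact: (st_free_fwd st3c (BB' i) Bn).
  have Bhigh := run_free_high (l := f) st1 st2 n1P r2 Bi.
  case: (gr_new gr3 (BB' i)) => [|[]//].
  move=> /(run_other r2) -/(_ ef).
  by move=> /(st_level st1)[_]; rewrite leqNgt Bhigh.
have bB' : conn phi (edge t F3) base B'.
  apply: (conn_trans (conn_mono i3 (run_conn r2))); apply: (conn_sym phiM).
  by exists (t e); apply: path_edge; exists e.
have T1F3 i : ~ nonfree j (T1 i) -> ~ domF F3 e (T1 i).
  move=> T1i [y]; case/(gr_new gr3).
    move=> /(run_other r2) -/(_ ef).
    move=> /(run_other r1) -/(_ ef).
    by move=> /(st_level st)[]; rewrite leqNgt (run_free_high (l := f) st st1 nP r1 T1i).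
  by case=> _ _ _; rewrite ltnNge (leq_trans (T1N i) N12).
have T1N3 : low N3 T1 by move=> i; apply: leq_trans (T1N i) (leq_trans N12 N23).
have B'N3 : low N3 B' by move=> i; case: (st_level st3c (BB' i)).
have [n3 n3P] := st_nil st3 j.
(* The additional step keeps the run nonempty even when [n3] is 0. *)
have [F4 [N4 [Z [N34 st4 ZN r4]]]] := run_exists f n3.+1 tC st3 B'N3.
have n3P' p q : ~ nonfree j p -> ~ nonfree j q -> ~ chain (F3 f) n3.+1 p q.
  move=> pf qf [r pr rq]; apply: (n3P p r pf) => // rn.
  exact/qf/(st_free_fwd st3 rq rn).
have stab s : conn phi (edge t F3) (ls s T1) T1 -> s \in C j.
  move=> cT1; apply: Tstab; apply: cons => //; first by move=> i; rewrite lsE.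
  apply: (conn_trans (conn_ls s (@edge_ls_closed _ _) TT1)).
  exact: (conn_trans cT1 (conn_sym phiM TT1)).
have sep s : ~ conn phi (edge t F3) B' (ls s T1).
  move=> cB'; apply: (Tbase s); apply: cons.
  - by move=> i; rewrite baseE.
  - by move=> i; rewrite lsE.
  - apply: (conn_trans bB' (conn_trans cB' _)).
    by apply: conn_ls (conn_sym phiM TT1); exact: edge_ls_closed.
have B'F3 i : ~ nonfree j (B' i) -> ~ domF F3 f (B' i).
  move=> /free_B B'i [y]; case/(gr_new gr3) => [/(st_level st2)[]|[[]//]].
  by rewrite leqNgt B'i.
have stJ := join_state tC st3 st4 r4 N34 (ltn0Sn _) T1N3 B'N3 T1s B's stab sep T1F3 B'F3 n3P'.
exists (joined j T1 Z F4), N4; split.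
  split=> //; first exact: leq_trans NN1 (leq_trans N12 (leq_trans N23 N34)).
  by move=> l x y /(gr_incl (run_grow r1))/i13/(gr_incl (run_grow r4)); left.
have i34 : incl F3 (joined j T1 Z F4) by move=> l x y /(gr_incl (run_grow r4)); left.
apply: (conn_trans (conn_mono i34 bB')).
apply: (conn_trans (join_conn T1 r4)).
exact: conn_mono i34 (conn_sym phiM TT1).
Qed.

Lemma extend_conn t F N T : commuting t -> state t F N ->
  exists F' N', extends t F N F' N' /\ conn phi (edge t F') base T.
Proof.
move=> tC st; have [bT|nbT] := pselect (conn phi (edge t F) base T).
  by exists F, N; split=> //; split.
have [Y TY Ystab] := valid_centre phiM T (st_valid st) (@edge_ls_closed t F).
case: (centre_class Y) => [[u YE]|[j [s [v]]]].
  case: nbT; apply: (conn_trans _ (conn_sym phiM TY)).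
  by rewrite YE; exact: conn_rs.
set Y' := rs (ls s Y) v => -[Y's Y'stab].
have YY' : conn phi (edge t F) (ls s Y) Y' by exact: conn_rs.
pose N0 := maxn N (\max_i level (Y' i)).
have st0 : state t F N0 := state_le (leq_maxl _ _) st.
have YN : low N0 Y'.
  by move=> i; apply: leq_trans (leq_maxr _ _); exact: (leq_bigmax i).
(* The tuple [Y'] lies in the component of [ls s Y], not necessarily in that of [Y]; this is
   harmless as the component of [base] is stable under permutations of coordinates. *)
have basels r : conn phi (edge t F) base (ls r base) by rewrite ls_base; exact: conn_rs.
have [||F' [N' [[NN' st' FF'] bY']]] := extend_symmetric tC st0 YN Y's.
- move=> r rY'; have : conn phi (edge t F) (ls (s^-1 * (r * s)) Y) Y.
    rewrite -lsM; apply/conn_lsV; rewrite invgK -lsM.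
    apply: (conn_trans (conn_ls r (@edge_ls_closed t F) YY')).
    exact: (conn_trans rY' (conn_sym phiM YY')).
  case/Ystab => u; rewrite -!lsM => /(congr1 (ls s)); rewrite lsM mulgV ls1 lrs => rY.
  by apply: (Y'stab r (v^-1 * (u * v))); rewrite /Y' lrs rY !rsM mulKVg.
- move=> r bY'; apply: nbT; apply: conn_trans (conn_sym phiM TY).
  have : conn phi (edge t F) base (ls (r * s) Y).
    apply: (conn_trans bY'); rewrite -lsM; apply: conn_ls; first exact: edge_ls_closed.
    exact: (conn_sym phiM YY').
  move=> /(conn_sym phiM)/conn_lsV/(conn_sym phiM).
  exact: (conn_trans (basels _)).
- exists F', N'; split; first by split=> //; exact: leq_trans (leq_maxl _ _) NN'.
  apply: (conn_trans _ (conn_mono FF' (conn_sym phiM TY))).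
  have := conn_trans bY' (conn_mono FF' (conn_sym phiM YY')).
  move=> /(conn_sym phiM)/conn_lsV/(conn_sym phiM).
  exact: (conn_trans (conn_mono FF' (basels _))).
Qed.

End PartialActions.

(** * The limit action *)

(* Bijections act on the right: (f * g) x = g (f x). *)
Record bijection (T : Type) := Bijection {
  bij_fun :> T -> T;
  bij_inv : T -> T;
  bij_funK : cancel bij_fun bij_inv;
  bij_invK : cancel bij_inv bij_fun }.

HB.instance Definition _ (T : Type) := gen_eqMixin (bijection T).
HB.instance Definition _ (T : Type) := gen_choiceMixin (bijection T).

Section BijectionGroup.
Variable T : Type.
Implicit Types f g h : bijection T.

Lemma bijP f g : f =1 g -> f = g.
Proof.
case: f g => [f f' fK f'K] [g g' gK g'K] /= /funext fg; subst g.
have f'g' : f' = g' by apply/funext => x; rewrite -{2}(f'K x) gK.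
by subst g'; congr Bijection; exact: Prop_irrelevance.
Qed.

Definition bij_one := @Bijection T id id (fun=> erefl) (fun=> erefl).
Definition bij_mul f g := Bijection
  (can_comp (bij_funK g) (bij_funK f)) (can_comp (bij_invK f) (bij_invK g)).
Definition bij_opp f := Bijection (bij_invK f) (bij_funK f).

Fact bij_mulA : associative bij_mul. Proof. by move=> f g h; exact: bijP. Qed.
Fact bij_mul1 : left_id bij_one bij_mul. Proof. by move=> f; exact: bijP. Qed.
Fact bij_mulr1 : right_id bij_one bij_mul. Proof. by move=> f; exact: bijP. Qed.
Fact bij_mulV : left_inverse bij_one bij_opp bij_mul.
Proof. by move=> f; apply: bijP => x /=; exact: bij_invK. Qed.
Fact bij_mulrV : right_inverse bij_one bij_opp bij_mul.
Proof. by move=> f; apply: bijP => x /=; exact: bij_funK. Qed.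

HB.instance Definition _ :=
  isGroup.Build (bijection T) bij_mulA bij_mul1 bij_mulr1 bij_mulV bij_mulrV.

Lemma bijME f g x : (f * g) x = g (f x). Proof. by []. Qed.
Lemma bijVE f x : f^-1 x = bij_inv f x. Proof. by []. Qed.

End BijectionGroup.

Fact pactK k (u : 'S_k) : cancel (fun p => pact p u) (fun p => pact p u^-1).
Proof. by move=> p /=; rewrite pactM mulgV pact1. Qed.
Fact pactVK k (u : 'S_k) : cancel (fun p => pact p u^-1) (fun p => pact p u).
Proof. by move=> p /=; rewrite pactM mulVg pact1. Qed.
Definition pact_bij k u : bijection (pt k) := Bijection (pactK u) (pactVK u).

(** * The initial partial action and the limit of its extensions *)

Section HNN.
Variables (k : nat) (J : finType) (C : J -> {group 'S_k}).
Local Notation letter := (J * bool)%type.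

(* G is the multiple HNN extension of 'S_k whose stable letters t (j, b)
   centralise C j. *)
Record is_hnn (G : groupType) (phi : 'S_k -> G) (t : letter -> G) : Prop := IsHnn {
  hnn_phiM : is_hom phi;
  hnn_comm : commuting C phi t;
  hnn_gen : forall P : G -> Prop,
    (forall u, P (phi u)) -> (forall l, P (t l)) ->
    (forall g h, P g -> P h -> P (g * h)) -> (forall g, P g -> P g^-1) ->
    forall g, P g;
  hnn_univ : forall (H : groupType) (psi : 'S_k -> H) (w : letter -> H),
    is_hom psi -> commuting C psi w ->
    exists f : G -> H, [/\ is_hom f, forall u, f (phi u) = psi u &
                          forall l, f (t l) = w l] }.

Variables (G : groupType) (phi : 'S_k -> G) (t : letter -> G).
Hypothesis Ghnn : is_hnn phi t.
Let phiM := hnn_phiM Ghnn.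
Let tC := hnn_comm Ghnn.

Hypothesis k_gt1 : (1 < k)%N.
Hypothesis nonfree_unique : forall j p q, nonfree C j p -> nonfree C j q -> p = q.
Hypothesis centre_class : forall T : tup k, (exists u, T = rs base u) \/
  exists j s v, symmetric C j (rs (ls s T) v) /\
    forall s' u, ls s' (rs (ls s T) v) = rs (rs (ls s T) v) u -> s' \in C j.
Variables (j0 : J) (x0 : 'I_k).
Hypothesis Cj0 : C j0 :=: 1.

(* The letter (j0, false) is made to fix x0 from the start: this provides an
   element of the stabiliser of x0 witnessing that the action is not split. *)
Definition seed_fun (i : 'I_k) : pt k := if i == x0 then inl x0 else inr (1, nat_of_ord i).

Lemma seed_inj : injective seed_fun.
Proof.
move=> i i'; rewrite /seed_fun; case: eqP => [->|_]; case: eqP => [->|_] //.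
by case=> /val_inj.
Qed.

Definition seed : tup k := mktup seed_inj.

Lemma seedE i : seed i = seed_fun i. Proof. exact: mktupE. Qed.

Definition initial (l : letter) (p q : pt k) :=
  nonfree C l.1 p /\ p = q \/
  l = (j0, false) /\ exists i, p = base i /\ q = seed i.

Lemma nonfree_j0 p : ~ nonfree C j0 p.
Proof. by case=> c [+ c1 _]; rewrite Cj0 inE => /eqP. Qed.

Lemma other_point (i : 'I_k) : exists i', i' <> i.
Proof.
have k0 : (0 < k)%N := ltnW k_gt1.
case: (eqVneq i (Ordinal k0)) => [->|i0]; last by exists (Ordinal k0); apply/nesym/eqP.
by exists (Ordinal k_gt1) => /(congr1 val).
Qed.

Lemma trivial_valid : valid phi (fun _ _ _ => False : Prop).
Proof.
exists (fun T => (T, 1)); split=> //.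
- by move=> T u; exists u^-1; rewrite /= rsM mulgV rs1 mul1g (homV phiM) mulVg.
- by move=> s T; exact: (sim_refl phiM).
- by move=> T; exact: conn_refl.
Qed.

Lemma trivial_conn T T' :
  conn phi (fun _ _ _ => False : Prop) T T' -> exists u, T' = rs T u.
Proof.
move: T'; apply: conn_ind_class => //; first by exists 1; rewrite rs1.
by move=> T1 u [v ->]; exists (v * u); rewrite rsM.
Qed.

Lemma initial_state : state C phi t initial k.
Proof.
have seed_level i : (level (seed i) <= k)%N.
  by rewrite seedE /seed_fun; case: eqP => [_|_] /=; [|exact: ltn_ord].
split.
- move=> l p q q' [[pn <-]|[-> [i [-> ->]]]] [[pn' <-]|[le [i' [pE ->]]]] //.
  + by move: pn; rewrite le => /nonfree_j0.
  + by case/nonfree_j0: pn'.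
  + by rewrite (tup_inj pE).
- move=> l p p' q [[pn <-]|[-> [i [-> ->]]]] [[pn' ->]|[le [i' [-> qE]]]] //.
  + by move: pn; rewrite le => /nonfree_j0.
  + by case/nonfree_j0: pn'.
  + by rewrite (tup_inj qE).
- move=> l c p q Cc [[pn <-]|[lE pq]].
    by left; rewrite (pact_nonfree nonfree_unique Cc).
  by move: Cc; rewrite lE Cj0 inE => /eqP ->; rewrite !pact1; right.
- by move=> l p pn; left.
- move=> l p q [[pn <-]|[_ [i [-> ->]]]]; first by rewrite (nonfree_level pn).
  by rewrite baseE.
- move=> j; exists 1%N => p q pf _ [_ <-] [[]//|[]].
  by case.
pose D (T : tup k) (g : G) (T' : tup k) :=
  exists s, [/\ T = ls s base, T' = ls s seed & g = t (j0, false)].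
apply: (valid_same_paths phiM (E := addE (fun _ _ _ => False : Prop) D)).
- apply: (proj1 (valid_graft phiM trivial_valid _ _ _ _)).
  + by [].
  + by move=> s T g T' [u [-> -> ->]]; exists (s * u); rewrite !lsM.
  + move=> T1 g1 T1' T2 g2 T2' [s1 [-> -> ->]] [s2 [-> -> ->]] /trivial_conn[u uE].
    have uEi i : seed (s2 i) = pact (seed (s1 i)) u.
      by rewrite -lsE uE rsE lsE.
    (* As [k > 1], some index other than [x0] exists; its seed lies in a regular orbit with group
       component 1, which determines [u]. *)
    have u1 : u = 1.
      have [i i0] := other_point x0; have := uEi (s1^-1 i).
      rewrite permKV !seedE /seed_fun; move/eqP/negbTE: i0 => ->.
      case: eqP => [//|_] [uV si].
      by rewrite -[u]mul1g -uV.
    have -> : s2 = s1.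
      apply/permP => i; apply: (@tup_inj _ seed).
      by rewrite uEi u1 pact1.
    by exists 1; rewrite !rs1 (hom1 phiM) mulg1 mul1g.
  + move=> T1 g1 T1' T2 g2 T2' [s1 [-> _ _]] [s2 [_ -> _]] /trivial_conn[u uE].
    have [i i0] := other_point x0.
    have := congr1 (fun T : tup k => level (T (s2^-1 i))) uE.
    rewrite rsE level_pact !lsE baseE permKV seedE /seed_fun.
    by move/eqP/negbTE: i0 => ->.
- move=> T g T' [l gE TT'].
  (* Any other letter moves only nonfree points, so all entries of the tuple would coincide, against
     [k > 1]. *)
  have [lE|lE] := pselect (l = (j0, false)); last first.
    have Tn i : nonfree C l.1 (T i) by case: (TT' i) => [[]//|[]].
    have [i ix] := other_point x0.
    by case: ix; apply: (@tup_inj _ T); apply: nonfree_unique (Tn _) (Tn _).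
  rewrite lE in TT' gE.
  have /boolp.choice[h hP] : forall i, exists a, T i = base a /\ T' i = seed a.
    by move=> i; case: (TT' i) => [[/nonfree_j0]|[]].
  have hI : injective h.
    by move=> i i' hii; apply: (@tup_inj _ T); case: (hP i) (hP i') => -> _ [-> _]; rewrite hii.
  apply: path_edge; right; exists (perm hI); split=> //;
    by apply: tupP => i; rewrite lsE permE; case: (hP i).
- move=> T g T' [//|[s [-> -> ->]]]; apply: path_edge; exists (j0, false) => // i.
  by right; split=> //; exists (s i); rewrite !lsE.
Qed.

Local Notation pmap := (letter -> pt k -> pt k -> Prop).

(* Tasks: a point to be put in the domain or in the range of a letter, or a
   tuple to be joined to base. *)
Local Notation task := ((letter * pt k * bool) + tup k)%type.

Definition done (x : task) (F : pmap) : Prop :=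
  match x with
  | inl (l, p, b) => domF (if b then F else conv F) l p
  | inr T => conn phi (edge t F) base T
  end.

Local Notation states := {F : pmap | exists N, state C phi t F N}.

Lemma extend_task (x : task) (F : states) :
  exists F' : states, incl (sval F) (sval F') /\ done x (sval F').
Proof.
case: F => F [N st].
suff [F' [N' [[_ st' FF'] dx]]] : exists F' N', extends C phi t F N F' N' /\ done x F'.
  by exists (exist _ F' (ex_intro _ N' st')).
case: x => [[[l p] []]|T] /=.
- exact: extend_dom.
- exact: extend_ran.
- exact: extend_conn.
Qed.

Lemma limit_sequence : exists F : nat -> pmap,
  [/\ forall n, exists N, state C phi t (F n) N, F 0%N = initial,
      forall m n, (m <= n)%N -> incl (F m) (F n) & forall x, exists n, done x (F n)].
Proof.
have /boolp.choice[ext extP] : forall a : task * states, exists F' : states,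
    incl (sval a.2) (sval F') /\ done a.1 (sval F').
  by move=> [x F]; exact: extend_task.
pose S0 : states := exist _ initial (ex_intro _ k initial_state).
(* Tasks form a countable type: stage [m.+1] carries out the task with code [m], if there is one. *)
pose S := fix S n := if n is m.+1 then
  (if unpickle m is Some x then ext (x, S m) else S m) else S0.
have Sincl m n : (m <= n)%N -> incl (sval (S m)) (sval (S n)).
  elim: n => [|n IH]; first by rewrite leqn0 => /eqP ->.
  rewrite leq_eqVlt => /orP[/eqP -> //|/IH mn] l p q /mn pq /=.
  case: unpickle => [x|//]; exact: (proj1 (extP (x, S n))).
exists (fun n => sval (S n)); split=> //; first by move=> n; case: (S n).
move=> x; exists (pickle x).+1; rewrite /= pickleK.
exact: (proj2 (extP (x, _))).
Qed.

(** Existence of [g] holds because [T] gets joined to [base] at some stage. For uniqueness, an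
    element fixing [base] involves finitely many letters and points, hence labels a loop of some
    stage, and stages are valid. *)
Lemma action_exists : exists a : G -> bijection (pt k),
  [/\ is_hom a, forall p u, a (phi u) p = pact p u,
      forall i, a (t (j0, false)) (inl i) = seed_fun i &
      forall T : tup k, exists! g, forall i, a g (base i) = T i].
Proof.
have [F [Fst F0 Fincl Fdone]] := limit_sequence.
have /boolp.choice[f fP] : forall lp : letter * pt k, exists q, exists n, F n lp.1 lp.2 q.
  move=> [l p]; have [n [q pq]] := Fdone (inl (l, p, true)).
  by exists q, n.
have /boolp.choice[f' f'P] : forall lp : letter * pt k, exists q, exists n, F n lp.1 q lp.2.
  move=> [l p]; have [n [q pq]] := Fdone (inl (l, p, false)).
  by exists q, n.
have Ffun m n l p q q' : F m l p q -> F n l p q' -> q = q'.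
  move=> /(Fincl _ _ (leq_maxl m n)) pq /(Fincl _ _ (leq_maxr m n)) pq'.
  by have [N st] := Fst (maxn m n); exact: (st_fun st pq pq').
have Finj m n l p p' q : F m l p q -> F n l p' q -> p = p'.
  move=> /(Fincl _ _ (leq_maxl m n)) pq /(Fincl _ _ (leq_maxr m n)) pq'.
  by have [N st] := Fst (maxn m n); exact: (st_inj st pq pq').
have fE n l p q : F n l p q -> f (l, p) = q.
  by move=> pq; have [m /= pq'] := fP (l, p); exact: Ffun pq' pq.
have fK l : cancel (fun p => f (l, p)) (fun p => f' (l, p)).
  move=> p /=; have [m /= pq] := fP (l, p); have [n /= pq'] := f'P (l, f (l, p)).
  exact: Finj pq' pq.
have f'K l : cancel (fun p => f' (l, p)) (fun p => f (l, p)).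
  by move=> p /=; have [n /= pq'] := f'P (l, p); exact: fE pq'.
pose w l := Bijection (fK l) (f'K l).
pose psi u := @pact_bij k u.
have psiM : is_hom psi by move=> u v; apply: bijP => p; rewrite bijME /= pactM.
have wC : commuting C psi w.
  move=> l c Cc; apply: bijP => p; rewrite !bijME /=.
  have [n /= pq] := fP (l, p); have [N st] := Fst n.
  exact: fE (st_equi st Cc pq).
have [a [aM aphi at_]] := hnn_univ Ghnn psiM wC.
have apact p u : a (phi u) p = pact p u by rewrite aphi.
have Apath g : forall T T' : tup k, (forall i, a g (T i) = T' i) ->
    exists n, path phi (edge t (F n)) T g T'.
  elim/(hnn_gen Ghnn): g => [u|l|g h IHg IHh|g IHg] T T' gT.
  - have -> : T' = rs T u by apply: tupP => i; rewrite rsE -gT apact.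
    by exists 0%N; exact: path_rs1.
  - have /boolp.choice[n nP] : forall i, exists n, F n l (T i) (T' i).
      by move=> i; have := fP (l, T i); rewrite -gT at_.
    exists (\max_i n i); apply: path_edge; exists l => // i.
    by apply: Fincl (nP i); exact: (leq_bigmax i).
  - have gI : injective (fun i => a g (T i)).
      by move=> i i' gii; exact: (tup_inj (can_inj (bij_funK (a g)) gii)).
    have [|m Tg] := IHg T (mktup gI); first by move=> i; rewrite mktupE.
    have [|n gT'] := IHh (mktup gI) T'.
      by move=> i; rewrite mktupE -gT aM.
    have up F1 F2 T1 g' T2 : incl F1 F2 -> path phi (edge t F1) T1 g' T2 ->
        path phi (edge t F2) T1 g' T2.
      by move=> F12; apply: (path_incl phiM); exact: edge_incl.
    exists (maxn m n).
    exact: (path_trans (up _ _ _ _ _ (Fincl _ _ (leq_maxl m n)) Tg)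
                       (up _ _ _ _ _ (Fincl _ _ (leq_maxr m n)) gT')).
  - have [|n T'T] := IHg T' T; last by exists n; exact: path_sym.
    by move=> i; rewrite -gT (homV aM) bijVE bij_invK.
have pathA n T g T' : path phi (edge t (F n)) T g T' -> forall i, a g (T i) = T' i.
  elim=> {T g T'}.
  - by move=> T i; rewrite (hom1 aM).
  - by move=> T g T' u _ IH i; rewrite aM bijME IH rsE apact.
  - move=> T g T' h T'' _ IH [l -> TT'] i; rewrite aM bijME IH at_ /=.
    exact: fE (TT' i).
  - move=> T g T' h T'' _ IH [l -> TT'] i; rewrite aM bijME IH (homV aM) bijVE.
    by rewrite at_ /= -(fE _ _ _ _ (TT' i)) fK.
exists a; split=> //.
- move=> i; rewrite at_ -seedE; apply: (fE 0%N); rewrite F0.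
  by right; split=> //; exists i; rewrite baseE.
- move=> T; have [n [g /pathA gT]] := Fdone (inr T).
  exists g; split=> // h hT.
  have [|m mP] := Apath (h * g^-1) base base.
    by move=> i; rewrite aM bijME hT -gT (homV aM) bijVE bij_funK.
  have [N st] := Fst m.
  have /(congr1 (fun x => x * g)) := valid_loop phiM (st_valid st) mP.
  by rewrite mulgVK mul1g.
Qed.

End HNN.

(** * Abelian normal subgroups and involutions *)

Section NonSplit.
Variables (G : groupType) (U : Type) (act : U -> G -> U) (H : set G) (V : set U).
Hypothesis actR : right_action act.
Hypothesis H_subgroup : subgroup H.
Hypothesis H_trans : forall v v' w w', V v -> V v' -> v <> v' -> V w -> V w' -> w <> w' ->
  exists h, [/\ H h, act v h = w & act v' h = w'].
Hypothesis H_faithful : forall h, H h -> (forall v, V v -> act v h = v) -> h = 1.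
Hypothesis H_stable : forall h v, H h -> V v -> V (act v h).
Hypothesis H_char2 : forall h v, H h -> involution h -> V v -> act v h <> v.
Variables (i j : G).
Hypotheses (Hi : H i) (Hj : H j) (inv_i : involution i) (inv_j : involution j).
Hypothesis ij : i * j <> j * i.

(* A nontrivial abelian normal subgroup would be regular, hence would contain
   all involutions. *)
Lemma nonsplit_criterion : no_abelian_normal H.
Proof.
case: actR => act1 actM; case: H_subgroup => H1 HM HV.
move=> N NH [N1 NM NV] Nnorm Nab; apply/seteqP; split; last by move=> _ ->.
move=> n Nn; apply: contrapT => n1.
have [v [Vv nv]] : exists v, V v /\ act v n <> v.
  apply: contrapT => nv; apply: n1; apply: H_faithful; first exact: NH.
  by move=> v Vv; apply: contrapT => vn; apply: nv; exists v.
(* A conjugate of [n] does it: the pair formed by [v] and its image under [n] can be moved to [w],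
   [w'] inside [H]. *)
have Ntrans w w' : V w -> V w' -> exists m, N m /\ act w m = w'.
  move=> Vw Vw'; case: (pselect (w = w')) => [<-|ww']; first by exists 1.
  have [||||||h [Hh vw vnw]] := @H_trans v (act v n) w w' => //.
    exact/H_stable/Vv/NH.
    exact/nesym.
  exists (n ^ h); split; first exact: Nnorm.
  have wv : act w h^-1 = v by rewrite -vw -actM mulgV act1.
  by rewrite conjgE !actM wv vnw.
have Nreg m w : N m -> V w -> act w m = w -> m = 1.
  move=> Nm Vw wm; apply: H_faithful; first exact: NH.
  move=> w' Vw'; have [m' [Nm' <-]] := Ntrans w w' Vw Vw'.
  by rewrite -actM -Nab // actM wm.
have N_inv h : H h -> involution h -> N h.
  move=> Hh hinv; have [h1 hh] := hinv.
  have Vh : V (act v h) by exact: H_stable.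
  have [m [Nm vm]] := Ntrans v (act v h) Vv Vh.
  have fix_v : act v (h * m^-1) = v by rewrite actM -vm -actM mulgV act1.
  have hV : h^-1 = h by rewrite -[LHS]mulg1 -hh mulKg.
  have Hhm : H (h * m^-1) by apply: HM => //; apply: HV; exact: NH.
  (* The square lies in [N] and fixes [v], hence is trivial by regularity; so [h * m^-1] is 1 or an
     involution with a fixed point, and the latter is excluded. *)
  have hm2 : h * m^-1 * (h * m^-1) = 1.
    apply: (Nreg _ v) => //; last by rewrite actM fix_v.
    rewrite mulgA; apply: NM; last exact: NV.
    have -> : h * m^-1 * h = m^-1 ^ h by rewrite conjgE hV mulgA.
    by apply: Nnorm => //; exact: NV.
  case: (pselect (h * m^-1 = 1)) => [hm1|hm1].
    have -> : h = m by rewrite -[h](mulgVK m) hm1 mul1g.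
    exact: Nm.
  by case: (H_char2 Hhm (conj hm1 hm2) Vv).
by apply: ij; apply: Nab; exact: N_inv.
Qed.

End NonSplit.

Lemma infinite_pt k : infinite_set [set: pt k]%classic.
Proof.
move=> /(finite_image (fun p : pt k => (level p).-1)).
have -> : ((fun p : pt k => (level p).-1) @` setT = setT)%classic.
  by apply/seteqP; split=> // n _; exists (inr (1, n)).
exact: infinite_nat.
Qed.

(** * From a regular orbit of tuples to a sharply transitive action *)

Section SharpAction.
Variables (k : nat) (G : groupType) (phi : 'S_k -> G) (a : G -> bijection (pt k)).
Hypotheses (phiM : is_hom phi) (aM : is_hom a).
Hypothesis aphi : forall p u, a (phi u) p = pact p u.
Hypothesis sharp : forall T : tup k, exists! g, forall i, a g (base i) = T i.

Definition hact (p : pt k) (g : G) : pt k := a g p.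

Lemma hact_right : right_action hact.
Proof.
split=> [x|x g h]; first by rewrite /hact (hom1 aM).
by rewrite /hact aM.
Qed.

Lemma hact_inj g : injective (hact^~ g).
Proof. exact: can_inj (bij_funK (a g)). Qed.

Lemma hact_sharply_transitive : sharply_transitive hact k.
Proof.
split; [exact: hact_right|by exists inl; exact: base_subproof|].
have [act1 actM] := hact_right.
move=> x y xI yI; have [g [gx gu]] := sharp (mktup xI).
have [h [hy hu]] := sharp (mktup yI).
exists (g^-1 * h); split=> [i|m mxy].
  rewrite -[x i](mktupE xI) -gx -[a g _]/(hact _ g) -actM mulKVg /hact hy.
  by rewrite mktupE.
rewrite (hu (g * m)) ?mulKg // => i.
by rewrite -[LHS]/(hact _ (g * m)) actM /hact gx !mktupE -mxy.
Qed.

Lemma tup_transitive (T T' : tup k) : exists g, forall i, hact (T i) g = T' i.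
Proof.
have [_ _ tr] := hact_sharply_transitive.
by have [g [gT _]] := tr T T' (@tup_inj _ T) (@tup_inj _ T'); exists g.
Qed.

Lemma tup_fixed (T : tup k) g : (forall i, hact (T i) g = T i) -> g = 1.
Proof.
have [_ _ /(_ T T (@tup_inj _ T) (@tup_inj _ T))[h [_ hu]]] := hact_sharply_transitive.
move=> gT; rewrite -(hu _ gT); apply: hu => i.
by have [-> _] := hact_right.
Qed.

Lemma phi_inj : injective phi.
Proof.
move=> u v uv; apply/permP => i.
by have := aphi (inl i) u; rewrite uv aphi => -[].
Qed.

Lemma point_transitive x (i : 'I_k) : exists g, hact (inl i) g = x.
Proof.
pose f j : pt k := if j == i then x else inr (1, (level x + j)%N).
have fI : injective f.
  have xf j : x <> inr (1, (level x + j)%N).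
    move=> /(congr1 (@level k)) /= xE; have := leq_addr j (level x).
    by rewrite leqNgt -ltnS -xE ltnSn.
  rewrite /f => j j'; case: eqP => [->|_]; case: eqP => [->|_] //.
  - by move=> /xf.
  - by move=> /esym/xf.
  - by case=> /addnI/val_inj.
have [g gf] := tup_transitive base (mktup fI).
by exists g; have := gf i; rewrite baseE mktupE /f eqxx.
Qed.

End SharpAction.

(** * Permutations of two and three points *)

Lemma I2_eq (i a b : 'I_2) : a <> i -> b <> i -> a = b.
Proof.
by move: i a b => [[|[|//]] ?] [[|[|//]] ?] [[|[|//]] ?] ai bi; apply: val_inj => //=;
  (case: ai; exact: val_inj) || (case: bi; exact: val_inj).
Qed.

Lemma S2_fixed (u : 'S_2) i : u i = i -> u = 1.
Proof.
move=> ui; apply/permP => j; rewrite perm1; case: (eqVneq j i) => [-> //|/eqP ji].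
by apply: (@I2_eq i) => // uji; apply: ji; apply: (@perm_inj _ u); rewrite ui.
Qed.

Lemma S2_eq (u v : 'S_2) : u <> 1 -> v <> 1 -> u = v.
Proof. by move=> u1 v1; apply/permP => i; apply: (@I2_eq i) => /S2_fixed. Qed.

(* Elements of 'S_3 encoded by their list of values, to decide identities by
   computation. *)
Definition S3code (g : 'S_3) : seq nat := [seq val (g i) | i <- enum 'I_3].
Definition id3 : seq nat := [:: 0; 1; 2]%N.
Definition S3codes : seq (seq nat) := permutations id3.
Definition mulcode (a b : seq nat) := [seq nth 0%N b i | i <- a].

Lemma S3codeE g (i : 'I_3) : nth 0%N (S3code g) i = g i.
Proof.
by rewrite /S3code (nth_map i) ?size_enum_ord // nth_ord_enum.
Qed.

Lemma S3code_inj : injective S3code.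
Proof. by move=> g h gh; apply/permP => i; apply: val_inj; rewrite /= -!S3codeE gh. Qed.

Lemma S3codeM g h : S3code (g * h) = mulcode (S3code g) (S3code h).
Proof. by rewrite /S3code /mulcode -map_comp; apply: eq_map => i /=; rewrite permM S3codeE. Qed.

Lemma S3code1 : S3code 1 = id3.
Proof.
rewrite /S3code (eq_map (g := val)) ?val_enum_ord // => i.
by rewrite perm1.
Qed.

Lemma S3code_mem g : S3code g \in S3codes.
Proof.
rewrite mem_permutations; apply: uniq_perm => //.
  rewrite map_inj_uniq ?enum_uniq //.
  by move=> i j /val_inj/perm_inj.
have sz : size (S3code g) = 3%N by rewrite size_map size_enum_ord.
have un : uniq (S3code g).
  rewrite map_inj_uniq ?enum_uniq //.
  by move=> i j /val_inj/perm_inj.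
have sub : {subset S3code g <= id3}.
  by move=> n /mapP[i _ ->]; case: (g i) => -[|[|[|]]].
by have [] := uniq_min_size un sub; rewrite sz.
Qed.

Lemma S3_forall (P : seq nat -> bool) : all P S3codes -> forall g, P (S3code g).
Proof. by move=> /allP PP g; apply: PP; exact: S3code_mem. Qed.

Lemma S3_forall2 (P : seq nat -> seq nat -> bool) :
  all (fun a => all (P a) S3codes) S3codes -> forall g h, P (S3code g) (S3code h).
Proof. by move=> /S3_forall PP g; apply: S3_forall; exact: PP. Qed.

Lemma S3eqE (g h : 'S_3) : (g == h) = (S3code g == S3code h).
Proof. exact: esym (inj_eq S3code_inj g h). Qed.

Section S3.
Variables s t : 'S_3.
Hypotheses (s1 : s <> 1) (ss : s * s = 1) (t1 : t <> 1) (ttt : t * t * t = 1).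

Lemma S3_involution_conj (r : 'S_3) : r <> 1 -> r * r = 1 -> exists v, s = r ^ v.
Proof.
(* For involutions of 'S_3 one has [(s * r) ^+ 3 = 1], equal or not, so conjugating [r] by
   [s * r * s] gives [s]. *)
move=> /eqP r1 /eqP rr; exists (s * r * s); apply: (mulgI (s * r * s)).
rewrite -conjgC; apply/eqP; move/eqP: s1 => s1'; move/eqP: ss => ss'.
move: s1' ss' r1 rr; rewrite !S3eqE !S3codeM S3code1.
pose P a b := [&& a != id3, mulcode a a == id3,
  b != id3 & mulcode b b == id3]%N ==>
  (mulcode (mulcode (mulcode a b) a) a == mulcode b (mulcode (mulcode a b) a)).
have /S3_forall2/(_ s r) : all (fun a => all (P a) S3codes) S3codes by [].
by move=> /implyP PP a1 a2 b1 b2; apply: PP; rewrite a1 a2 b1 b2.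
Qed.

Lemma S3_fixed_point : exists x0, s x0 = x0 /\ forall i, s i = i -> i = x0.
Proof.
have fixE i : (s i == i) = (nth 0%N (S3code s) i == i) by rewrite S3codeE.
pose P a := (a != id3) && (mulcode a a == id3) ==>
  has (fun i => (nth 0%N a i == i) &&
    all (fun j => (nth 0%N a j == j) ==> (j == i)) id3) id3.
have /S3_forall/(_ s)/implyP PP : all P S3codes by [].
have /PP/hasP[n] : (S3code s != id3) && (mulcode (S3code s) (S3code s) == id3).
  by move/eqP: s1; move/eqP: ss; rewrite !S3eqE S3codeM S3code1 => -> ->.
rewrite !inE => n3 /andP[fn /allP un].
have n3' : (n < 3)%N by case/or3P: n3 => /eqP ->.
exists (Ordinal n3'); split; first by apply/eqP; rewrite fixE.
move=> i /eqP; rewrite fixE => fi; apply/val_inj/eqP => /=.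
have /implyP : (nth 0%N (S3code s) i == i) ==> (val i == n).
  by apply: un; case: i {fi} => -[|[|[|]]].
exact.
Qed.

Lemma S3_order3_free i : t i <> i.
Proof.
move=> /eqP.
have fixE : (t i == i) = (nth 0%N (S3code t) i == i) by rewrite S3codeE.
pose P a := (a != id3) && (mulcode (mulcode a a) a == id3) ==>
  all (fun j => nth 0%N a j != j) id3.
have /S3_forall/(_ t)/implyP PP : all P S3codes by [].
have /PP/allP/(_ (val i)) : (S3code t != id3) &&
    (mulcode (mulcode (S3code t) (S3code t)) (S3code t) == id3).
  by move/eqP: t1; move/eqP: ttt; rewrite !S3eqE !S3codeM S3code1 => -> ->.
rewrite fixE => + fi; rewrite fi => /(_ _)/notF; apply.
by case: i {fi fixE} => -[|[|[|]]].
Qed.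

Lemma S3_trichotomy (g : 'S_3) : [\/ g = 1, g <> 1 /\ g * g = 1 | g = t \/ g = t * t].
Proof.
have /eqP t1' := t1; have /eqP ttt' := ttt.
have : [|| g == 1, g * g == 1, g == t | g == t * t].
  move: t1' ttt'; rewrite !S3eqE !S3codeM S3code1.
  pose P b a := (b != id3) && (mulcode (mulcode b b) b == id3) ==>
    [|| a == id3, mulcode a a == id3, a == b | a == mulcode b b]%N.
  have /S3_forall2/(_ t g) : all (fun a => all (P a) S3codes) S3codes by [].
  by move=> /implyP PP a1 a2; apply: PP; rewrite a1.
case: (pselect (g = 1)) => [|g1]; first by constructor 1.
move/eqP/negbTE: (g1) => -> /= /or3P[]/eqP gE; first by constructor 2.
  by constructor 3; left.
by constructor 3; right.
Qed.

Lemma S3_inverts : t ^ s = t * t.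
Proof.
apply: (mulgI s); rewrite -conjgC; apply/eqP.
have /eqP t1' := t1; have /eqP ttt' := ttt; have /eqP s1' := s1; have /eqP ss' := ss.
move: t1' ttt' s1' ss'; rewrite !S3eqE !S3codeM S3code1.
pose P b a := [&& b != id3, mulcode (mulcode b b) b == id3,
  a != id3 & mulcode a a == id3]%N ==>
  (mulcode b a == mulcode a (mulcode b b)).
have /S3_forall2/(_ t s) : all (fun a => all (P a) S3codes) S3codes by [].
by move=> /implyP PP a1 a2 b1 b2; apply: PP; rewrite a1 a2 b1 b2.
Qed.

Definition S3type (j : option bool) : {group 'S_3} :=
  match j with Some true => <[s]> | Some false => <[t]> | None => 1 end%G.

Lemma S3_cycle_s c : c \in <[s]> -> c = 1 \/ c = s.
Proof.
case/cycleP => n ->; elim: n => [|n]; first by left.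
by rewrite expgSr => -[->|->]; [right; rewrite mul1g|left].
Qed.

Lemma S3_cycle_t c : c \in <[t]> -> [\/ c = 1, c = t | c = t * t].
Proof.
case/cycleP => n ->; elim: n => [|n]; first by constructor 1.
by rewrite expgSr => -[->|->|->]; [constructor 2; rewrite mul1g|constructor 3|constructor 1].
Qed.

Lemma S3_nonfree j p : nonfree S3type j p ->
  j = Some true /\ exists2 i, p = inl i & s i = i.
Proof.
case=> c [Cc c1 pc].
have /eqP p0 : level p == 0%N by apply: contra_notT c1 => /pact_free; apply.
case: p p0 pc => [i _ [ci]|[]//]; case: j Cc => [[]|] /=.
- by case/S3_cycle_s => // cs; split=> //; exists i => //; rewrite -cs.
- case/S3_cycle_t => // ct; case: (@S3_order3_free i); first by rewrite -ct.
  by rewrite -{1}ci ct -permM ttt perm1.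
- by rewrite inE => /eqP.
Qed.

Lemma S3_nonfree_unique j p q : nonfree S3type j p -> nonfree S3type j q -> p = q.
Proof.
have [x0 [_ x0u]] := S3_fixed_point.
by case/S3_nonfree => _ [i -> /x0u ->] /S3_nonfree[_ [i' -> /x0u ->]].
Qed.

Lemma S3_same_fixed_point (r : 'S_3) i : s i = i -> r i = i -> r = 1 \/ r = s.
Proof.
move=> si ri; have /eqP s1' := s1; have /eqP ss' := ss.
have : (nth 0%N (S3code s) i == i) && (nth 0%N (S3code r) i == i).
  by rewrite !S3codeE si ri eqxx.
suff : (nth 0%N (S3code s) i == i) && (nth 0%N (S3code r) i == i) -> (r == 1) || (r == s).
  by move=> PP /PP /orP[]/eqP; [left|right].
move: s1' ss'; rewrite !S3eqE !S3codeM S3code1.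
pose P a b := (a != id3) && (mulcode a a == id3) ==>
  all (fun n => (nth 0%N a n == n) && (nth 0%N b n == n) ==> (b == id3) || (b == a)) id3.
have /S3_forall2/(_ s r)/implyP PP : all (fun a => all (P a) S3codes) S3codes by [].
move=> a1 a2; have /allP/(_ (val i)) := PP (introT andP (conj a1 a2)).
by move=> QQ; apply/implyP; apply: QQ; case: i {si ri} => -[|[|[|]]].
Qed.

Lemma I3_eq (i j a b : 'I_3) : i <> j -> a <> i -> a <> j -> b <> i -> b <> j -> a = b.
Proof.
move=> /eqP + /eqP + /eqP + /eqP + /eqP; rewrite -!val_eqE => ij ai aj bi bj.
apply/val_inj => /=; move: i j a b ij ai aj bi bj.
by do 4![case=> -[|[|[|//]]] /= ?].
Qed.

(** The entry at the fixed point [x0] of [s] is fixed by [s], hence of level 0. A symmetry [r]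
    moving [x0] carries this to [r x0] and then, by [s], to the third entry. *)
Lemma S3_symmetric_s (T : tup 3) (r : 'S_3) w : ls s T = rs T s ->
  ls r T = rs T w -> r \in <[s]> \/ exists u, T = rs base u.
Proof.
move=> Ts Tr; have [x0 [sx0 x0u]] := S3_fixed_point.
have Tsi i : T (s i) = pact (T i) s by rewrite -lsE Ts rsE.
have Tx0 : level (T x0) = 0%N.
  apply/eqP; apply: contra_notT s1 => /pact_free; apply.
  by rewrite -Tsi sx0.
case: (pselect (r x0 = x0)) => [rx0|rx0].
  left; case: (S3_same_fixed_point sx0 rx0) => ->; first exact: group1.
  exact: cycle_id.
right; apply: tup_level0 => i; have Ty : level (T (r x0)) = 0%N.
  by rewrite -lsE Tr rsE level_pact.
case: (pselect (i = x0)) => [-> //|ix]; case: (pselect (i = r x0)) => [-> //|iy].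
have -> : i = s (r x0).
  apply: (I3_eq (i := x0) (j := r x0)) => //; first exact: nesym.
    by rewrite -{2}sx0 => /perm_inj.
  by move=> /x0u.
by rewrite Tsi level_pact.
Qed.

Lemma ls_square (T : tup 3) (r u : 'S_3) : ls r T = rs T u -> ls (r * r) T = rs T (u * u).
Proof. by move=> Tr; rewrite -lsM Tr lrs Tr rsM. Qed.

(** Both actions are free, so the symmetries of [T] are the graph of an injective homomorphism from
    a subgroup of 'S_3. Conjugating on either side makes it an inclusion; if an involution occurs
    together with more symmetries, [T] is a translate of [base]. *)
Lemma S3_centre_class (T : tup 3) : (exists u, T = rs base u) \/
  exists j r v, symmetric S3type j (rs (ls r T) v) /\
    forall r' u, ls r' (rs (ls r T) v) = rs (rs (ls r T) v) u -> r' \in S3type j.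
Proof.
have sym1 j x (T' : tup 3) : S3type j = <[x]>%G -> ls x T' = rs T' x -> symmetric S3type j T'.
  move=> jx T'x c; rewrite jx => /cycleP[n ->]; elim: n => [|n IH].
    by rewrite !expg0 ls1 rs1.
  by rewrite expgS -lsM IH lrs T'x rsM.
have [[r [u [r1 rr Tr]]]|noinv] := pselect (exists r u, [/\ r <> 1, r * r = 1 & ls r T = rs T u]).
  have u1 : u <> 1 by move=> u1; apply: r1; apply: (@ls_free _ T); rewrite Tr u1 rs1.
  have uu : u * u = 1.
    by apply: (@rs_free _ T); rewrite -(ls_square Tr) rr ls1.
  have [a sa] := S3_involution_conj r1 rr; have [v sv] := S3_involution_conj u1 uu.
  set T' := rs (ls a^-1 T) v.
  have T's : ls s T' = rs T' s.
    have sar : s * a^-1 = a^-1 * r by rewrite sa conjgE -!mulgA mulgV mulg1.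
    have uv : u * v = v * s by rewrite sv -conjgC.
    by rewrite /T' lrs lsM sar -lsM Tr lrs !rsM uv.
  case: (pselect (exists w, T' = rs base w)) => [[w T'w]|nbase].
    left; have : ls a T' = rs (ls a base) w by rewrite T'w lrs.
    rewrite /T' lrs lsM mulgV ls1 ls_base rsM => /(congr1 (fun X => rs X v^-1)).
    by rewrite !rsM mulgV rs1 => ->; eexists.
  right; exists (Some true), a^-1, v; split; first exact: (@sym1 _ s).
  by move=> r' w /(S3_symmetric_s T's)[].
right; have [[r [u [r1 Tr]]]|triv] := pselect (exists r u, r <> 1 /\ ls r T = rs T u).
  have [u' Tt] : exists u', ls t T = rs T u'.
    case: (S3_trichotomy r) => [//|[_ rr]|[rt|rt]].
    - by case: noinv; exists r, u.
    - by exists u; rewrite -rt.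
    - exists (u * u); rewrite -(ls_square Tr) rt.
      by rewrite mulgA ttt mul1g.
  have Tstab r' w : ls r' T = rs T w -> r' \in <[t]>.
    move=> Tr'; case: (S3_trichotomy r') => [->|[r'1 rr]|[->|->]].
    - exact: group1.
    - by case: noinv; exists r', w.
    - exact: cycle_id.
    - by rewrite groupM ?cycle_id.
  have stabv v r' w : ls r' (rs (ls 1 T) v) = rs (rs (ls 1 T) v) w -> r' \in <[t]>.
    rewrite ls1 lrs => /(congr1 (fun X => rs X v^-1)); rewrite !rsM mulgV rs1.
    exact: Tstab.
  exists (Some false), 1.
  case: (S3_trichotomy u') => [u'1|[_ uu]|[u't|u't]].
  - by case: t1; apply: (@ls_free _ T); rewrite Tt u'1 rs1.
  - case: t1; have : ls (t * t) T = T by rewrite (ls_square Tt) uu rs1.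
    by move=> /ls_free t2; rewrite -ttt t2 mul1g.
  - exists 1; split; last exact: stabv.
    by apply: (@sym1 _ t) => //; rewrite rs1 ls1 Tt u't.
  (* Here [t] corresponds to its inverse on the right, which conjugation by [s] corrects. *)
  - exists s; split; last exact: stabv.
    apply: (@sym1 _ t) => //; rewrite ls1 lrs Tt u't !rsM.
    by rewrite [t * t * s]conjgC conjMg S3_inverts [t * t * (t * t)]mulgA ttt mul1g.
exists None, 1, 1; split; first by move=> c; rewrite inE => /eqP ->; rewrite !ls1 !rs1.
move=> r u; rewrite ls1 !rs1 => Tr; rewrite inE; apply/eqP; apply: contrapT => r1.
by apply: triv; exists r, u.
Qed.

(** Otherwise [s] and [s ^ t] would share the unique fixed point of [s], which would then be fixed
    by [t]. *)
Lemma S3_not_commute : s * s ^ t <> s ^ t * s.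
Proof.
move=> sst; have [x0 [sx0 x0u]] := S3_fixed_point.
have /x0u : s ((s ^ t) x0) = (s ^ t) x0 by rewrite -permM -sst permM sx0.
rewrite conjgE !permM => /(canRL (permK t)).
by move=> /x0u/(congr1 t); rewrite permKV => /esym/S3_order3_free.
Qed.

End S3.

(* G is the semidirect product of a free group, on the cosets of the C j, by
   'S_k; it acts on the reduced words of that free group. Words are written
   backwards: multiplying on the right by a letter acts on the head. *)
Section Involutions.
Variables (k : nat) (J : finType) (C : J -> {group 'S_k}).
Variables (G : groupType) (phi : 'S_k -> G) (t : J * bool -> G).
Hypothesis Ghnn : is_hnn C phi t.
Let phiM := hnn_phiM Ghnn.

Local Notation letter := ((J * bool) * {set 'S_k} * bool)%type.
Implicit Types (a b : letter) (w : seq letter).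

Definition opp a : letter := (a.1, ~~ a.2).
Definition lact u a : letter := (a.1.1, a.1.2 :* u, a.2).
(** Letters carry arbitrary subsets of 'S_k, which keeps their type simple; only those carrying a
    right coset stand for basis elements. *)
Definition proper_letter a := [exists v, a.1.2 == C a.1.1.1 :* v].
Definition push a w := if w is b :: w' then (if b == opp a then w' else a :: w) else [:: a].
Definition reduced w := sorted (fun a b => b != opp a) w.
Definition normal w := reduced w && all proper_letter w.
Definition winv w : seq letter := rev (map opp w).

Lemma oppK : involutive opp. Proof. by case=> [x b]; rewrite /opp /= negbK. Qed.

Lemma lact_opp u a : lact u (opp a) = opp (lact u a). Proof. by []. Qed.

Lemma lactM u v a : lact v (lact u a) = lact (u * v) a.
Proof. by rewrite /lact /= rcosetM. Qed.

Lemma lact1 a : lact 1 a = a.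
Proof. by case: a => [[l A] b]; rewrite /lact /= rcoset1. Qed.

Lemma lact_inj u : injective (lact u).
Proof. by apply: (can_inj (g := lact u^-1)) => a; rewrite lactM mulgV lact1. Qed.

Lemma proper_letterP a : reflect (exists v, a.1.2 = C a.1.1.1 :* v) (proper_letter a).
Proof.
by apply: (iffP existsP) => -[v /eqP]; exists v => //; apply/eqP.
Qed.

Lemma proper_lact u a : proper_letter (lact u a) = proper_letter a.
Proof.
suff sub v b : proper_letter b -> proper_letter (lact v b).
  by apply/idP/idP => [/(sub u^-1)|/sub//]; rewrite lactM mulgV lact1.
by case/proper_letterP => x bE; apply/proper_letterP; exists (x * v); rewrite /= bE rcosetM.
Qed.

Lemma normal_push a w : proper_letter a -> normal w -> normal (push a w).
Proof.
move=> pa /andP[]; case: w => [|b w] /= rw pw; first by rewrite /normal /= pa.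
case: eqP => [_|/eqP ba].
  by rewrite /normal /reduced (path_sorted rw); case/andP: pw.
by rewrite /normal /= ba rw pa.
Qed.

Lemma pushK a w : normal w -> push (opp a) (push a w) = w.
Proof.
case: w => [|b w] nw /=; first by rewrite oppK eqxx.
case: eqP => [bE|_] /=; last by rewrite oppK eqxx.
case: w nw => [_|c w]; first by rewrite bE.
by case/andP => /= /andP[cb _] _; rewrite -bE (negbTE cb).
Qed.

Lemma normal_lact u w : normal w -> normal (map (lact u) w).
Proof.
case/andP => rw pw; apply/andP; split; last first.
  by rewrite all_map; apply: sub_all pw => a /=; rewrite proper_lact.
rewrite /reduced sorted_map; apply: sub_sorted rw => a b /=.
by rewrite -lact_opp (inj_eq (@lact_inj u)).
Qed.

Lemma normal_winv w : normal w -> normal (winv w).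
Proof.
case/andP => rw pw; apply/andP; split; last by rewrite all_rev all_map.
rewrite /reduced /winv rev_sorted sorted_map; apply: sub_sorted rw => a b /=.
by rewrite oppK eq_sym.
Qed.

(** The basis element of a coset [C l.1 :* v] is [t l] conjugated by [phi v]; the representative
    does not matter since [t l] commutes with [C l.1]. *)
Definition ev a : G :=
  let g := (phi (repr a.1.2))^-1 * t a.1.1 * phi (repr a.1.2) in if a.2 then g^-1 else g.
Definition eval w : G := foldr (fun a g => g * ev a) 1 w.

Lemma ev_opp a : ev (opp a) = (ev a)^-1.
Proof. by rewrite /ev /=; case: a.2 => //=; rewrite invgK. Qed.

Lemma ev_coset l v (b : bool) : ev (l, C l.1 :* v, b) =
  let g := (phi v)^-1 * t l * phi v in if b then g^-1 else g.
Proof.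
rewrite /ev /=; suff -> : (phi (repr (C l.1 :* v)))^-1 * t l * phi (repr (C l.1 :* v)) =
  (phi v)^-1 * t l * phi v by [].
case: repr_rcosetP => c Cc; rewrite phiM invgM -!mulgA; congr (_ * _).
rewrite [t l * _]mulgA -(hnn_comm Ghnn Cc) !mulgA.
by rewrite mulVg mul1g.
Qed.

Lemma ev_lact u a : proper_letter a -> ev (lact u a) = (phi u)^-1 * ev a * phi u.
Proof.
case: a => [[l A] b] /proper_letterP[v /= ->]; rewrite /lact /= -rcosetM !ev_coset /=.
by rewrite phiM; case: b; rewrite !invgM ?invgK !mulgA.
Qed.

Lemma eval_cat w w' : eval (w ++ w') = eval w' * eval w.
Proof. by elim: w => [|a w IH] /=; rewrite ?mulg1 // IH mulgA. Qed.

Lemma eval_winv w : eval (winv w) = (eval w)^-1.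
Proof.
elim: w => [|a w IH] /=; first by rewrite invg1.
by rewrite /winv /= rev_cons -cats1 eval_cat -/(winv w) IH /= mul1g ev_opp invgM.
Qed.

Lemma eval_lact u w : all proper_letter w ->
  eval (map (lact u) w) = (phi u)^-1 * eval w * phi u.
Proof.
elim: w => [|a w IH] /=; first by rewrite mulg1 mulVg.
by case/andP => pa /IH ->; rewrite ev_lact // !mulgA mulgK.
Qed.

Lemma eval_push a w : eval (push a w) = eval w * ev a.
Proof.
case: w => [|b w] //=; case: eqP => [->|//] /=.
by rewrite ev_opp mulgVK.
Qed.

Local Notation nwords := {w : seq letter | normal w}.

Definition mkword w (nw : normal w) : nwords := exist (fun v => is_true (normal v)) w nw.

Definition nlact u (w : nwords) : nwords := mkword (normal_lact u (valP w)).

Definition npush a (pa : proper_letter a) (w : nwords) : nwords :=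
  mkword (normal_push pa (valP w)).

Fact nlactK u : cancel (nlact u) (nlact u^-1).
Proof.
by move=> w; apply: val_inj; rewrite /= -map_comp map_id_in // => a _ /=;
  rewrite lactM mulgV lact1.
Qed.

Fact nlactVK u : cancel (nlact u^-1) (nlact u).
Proof. by move=> w; rewrite -{1}(invgK u) nlactK. Qed.

Definition nlact_bij u := Bijection (nlactK u) (nlactVK u).

Fact npushK a (pa : proper_letter a) (pa' : proper_letter (opp a)) :
  cancel (npush pa) (npush pa').
Proof. by move=> w; apply: val_inj; rewrite /= pushK //; exact: (valP w). Qed.

Fact npushVK a (pa : proper_letter a) (pa' : proper_letter (opp a)) :
  cancel (npush pa') (npush pa).
Proof.
by move=> w; apply: val_inj; rewrite /= -{1}[a]oppK pushK //; exact: (valP w).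
Qed.

Definition npush_bij a pa pa' := Bijection (@npushK a pa pa') (npushVK pa pa').

Definition start l : letter := (l, C l.1 :* 1, false).
Fact start_proper l : proper_letter (start l).
Proof. by apply/proper_letterP; exists 1. Qed.
Fact start_opp_proper l : proper_letter (opp (start l)).
Proof. exact: start_proper. Qed.

Lemma push_lact u a w : map (lact u) (push a w) = push (lact u a) (map (lact u) w).
Proof.
case: w => [|b w] //=; rewrite -lact_opp (inj_eq (@lact_inj u)).
by case: eqP.
Qed.

(** Write [g] as [phi s] times a reduced word [r]. Then [g^-1 = g] says that [r] is its own inverse
    twisted by [s], so its first half is the twisted inverse of its second half, and [g] is a
    conjugate of [phi s]. *)
Lemma involution_conj g : involution g -> exists h s, g = h * phi s * h^-1.
Proof.
pose psi u := nlact_bij u.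
pose x l := npush_bij (start_proper l) (start_opp_proper l).
have psiM : is_hom psi.
  move=> u v; apply: bijP => w; apply: val_inj; rewrite bijME /= -map_comp.
  by apply: eq_map => a /=; rewrite lactM.
have xC : commuting C psi x.
  move=> l c Cc; apply: bijP => w; apply: val_inj; rewrite !bijME /= push_lact.
  by rewrite /lact /start /= -rcosetM mul1g rcoset1 rcoset_id.
have [f [fM fphi ft]] := hnn_univ Ghnn psiM xC.
have f_eval h : forall w : nwords, exists s, eval (val w) * h = phi s * eval (val (f h w)).
  elim/(hnn_gen Ghnn): h => [u|l|h1 h2 IH1 IH2|h IH] w.
  - exists u; rewrite fphi /= eval_lact; last by case/andP: (valP w).
    by rewrite !mulgA mulgV mul1g.
  - exists 1; rewrite ft /= eval_push (hom1 phiM) mul1g /start.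
    by rewrite ev_coset /= (hom1 phiM) invg1 mul1g mulg1.
  - have [s1 E1] := IH1 w; have [s2 E2] := IH2 (f h1 w).
    by exists (s1 * s2); rewrite fM bijME phiM mulgA E1 -!mulgA E2.
  - have [s E] := IH (f h^-1 w); exists s^-1; apply: (mulIg h).
    rewrite mulgVK -mulgA E (homV phiM) mulKg (homV fM) bijVE.
    by rewrite bij_invK.
have f_ev a (w : nwords) : proper_letter a -> val (f (ev a) w) = push a (val w).
  case: a => [[l A] b] pa; case/proper_letterP: (pa) => v /= AE; rewrite AE in pa *.
  have E (w' : nwords) : val (f ((phi v)^-1 * t l * phi v) w') =
      push (l, C l.1 :* v, false) (val w').
    rewrite !fM !bijME fphi ft -(homV phiM) fphi /= push_lact.
    rewrite /lact /= -rcosetM mul1g; congr push.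
    rewrite -map_comp map_id_in // => a _ /=.
    by rewrite -[LHS]/(lact v (lact v^-1 a)) lactM mulVg lact1.
  rewrite ev_coset /=; case: b pa => pa; last exact: E.
  rewrite (homV fM) bijVE.
  rewrite -[in RHS](bij_invK (f ((phi v)^-1 * t l * phi v)) w) E.
  by rewrite -[(l, _, true)]/(opp (l, C l.1 :* v, false)) pushK //; exact: valP.
(* Acting on the empty word recovers a reduced word from its value: normal forms are unique. *)
have f_word (w : nwords) (w0 : nwords) : val w0 = [::] -> val (f (eval (val w)) w0) = val w.
  move=> w00; case: w => w /=; elim: w => [|a w IH] nw /=; first by rewrite (hom1 fM).
  case/andP: (nw) => rw /= /andP[pa pw].
  have nw' : normal w by rewrite /normal /reduced pw (path_sorted rw).
  have IH' : val (f (eval w) w0) = w := IH nw'.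
  rewrite fM bijME -[sval]/val f_ev // IH'.
  by case: w rw {IH IH' nw pw nw'} => [//|b w] /= /andP[/negbTE -> _].
move=> [g1 gg]; pose w0 : nwords := @mkword [::] isT.
have [s] := f_eval g w0; rewrite /= mul1g; set r := f g w0 => gE.
have gV : g^-1 = g by rewrite -[LHS]mulg1 -gg mulKg.
have rE : val r = map (lact s^-1) (winv (val r)).
  have rf : r = f (eval (winv (val r)) * phi s^-1) w0.
    by rewrite eval_winv (homV phiM) -invgM -gE gV.
  rewrite [LHS](congr1 val rf) fM bijME fphi /=.
  by have /= -> := f_word (mkword (normal_winv (valP r))) w0 erefl.
(* In odd length the middle letter would be sent to itself with the opposite sign. *)
have [m rm] : exists m, size (val r) = m.*2.
  exists (size (val r))./2; rewrite -[LHS]odd_double_half.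
  case: (boolP (odd _)) => // od.
  have [a0] : exists a : letter, True by case: (val r) od => [//|a _ _]; exists a.
  set n := size (val r) in od; pose i := n./2.
  have nE : n = i.*2.+1 by rewrite -[LHS]odd_double_half od.
  have lt_in : (i < n)%N by rewrite nE ltnS -addnn leq_addr.
  move=> _; have := congr1 (nth a0 ^~ i) rE.
  rewrite (nth_map a0) ?size_rev ?size_map // nth_rev ?size_map //.
  have -> : (n - i.+1)%N = i by rewrite nE subSS -addnn addnK.
  by rewrite (nth_map a0) // => /(congr1 snd) /=; case: (_.2).
pose r1 := take m (val r); pose r2 := drop m (val r).
have r12 : val r = r1 ++ r2 by rewrite cat_take_drop.
have sz1 : size r1 = m by rewrite size_takel // rm -addnn leq_addr.
have sz2 : size r2 = m by rewrite size_drop rm -addnn addnK.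
have r1E : r1 = map (lact s^-1) (winv r2).
  move: rE; rewrite {1}r12 r12 /winv map_cat rev_cat map_cat => /eqP.
  rewrite eqseq_cat; last by rewrite !(size_map, size_rev) sz1 sz2.
  by case/andP => /eqP.
have p2 : all proper_letter (winv r2).
  have /andP[_] := normal_winv (valP r).
  by rewrite !all_rev !all_map r12 all_cat => /andP[].
exists (phi s * eval r2), s.
rewrite gE r12 eval_cat r1E eval_lact // eval_winv (homV phiM) invgK invgM.
by rewrite !mulgA.
Qed.

End Involutions.

(** * Actions of the HNN extensions *)

(** A stable letter with trivial [C j0] may be sent anywhere and all others to 1; this supplies the
    quotients in which two involutions are seen not to commute. *)
Lemma hnn_retract k (J : finType) (C : J -> {group 'S_k}) (G H : groupType)
    (phi : 'S_k -> G) (t : J * bool -> G) (j0 : J) (psi : 'S_k -> H) (x : H) :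
  is_hnn C phi t -> C j0 :=: 1 -> is_hom psi ->
  exists f : G -> H, [/\ is_hom f, forall u, f (phi u) = psi u & f (t (j0, false)) = x].
Proof.
move=> Ghnn Cj0 psiM; pose w l := if l == (j0, false) then x else 1.
have [|f [fM fphi ft]] := hnn_univ Ghnn (w := w) psiM.
  move=> l c; rewrite /w; case: eqP => [->|_ _]; last by rewrite mul1g mulg1.
  by rewrite Cj0 inE => /eqP ->; rewrite (hom1 psiM) mul1g mulg1.
by exists f; split=> //; rewrite ft /w eqxx.
Qed.

Definition S2type (j : bool) : {group 'S_2} := if j then [set: 'S_2]%G else 1%G.

Lemma S2_free j p : ~ nonfree S2type j p.
Proof.
case=> c [_ c1 pc]; have /eqP p0 : level p == 0%N.
  by apply: contra_notT c1 => /pact_free; apply.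
by case: p p0 pc => [i _ [/S2_fixed]|[]].
Qed.

Lemma S2_centre_class (T : tup 2) : (exists u, T = rs base u) \/
  exists j s v, symmetric S2type j (rs (ls s T) v) /\
    forall s' u, ls s' (rs (ls s T) v) = rs (rs (ls s T) v) u -> s' \in S2type j.
Proof.
right; have [[s [u [s1 Ts]]]|triv] := pselect (exists s u, s <> 1 /\ ls s T = rs T u).
  exists true, 1, 1; split=> [c _|s' u' _]; last by rewrite inE.
  rewrite ls1 rs1; case: (pselect (c = 1)) => [->|c1]; first by rewrite ls1 rs1.
  have u1 : u <> 1 by move=> u1; apply: s1; apply: (@ls_free _ T); rewrite Ts u1 rs1.
  by rewrite (S2_eq c1 s1) Ts (S2_eq s1 u1).
exists false, 1, 1; split; first by move=> c; rewrite inE => /eqP ->; rewrite !ls1 !rs1.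
move=> s u; rewrite ls1 !rs1 => Ts; rewrite inE; apply/eqP; apply: contrapT => s1.
by apply: triv; exists s, u.
Qed.

Lemma pair_tup (v v' : pt 2) : v <> v' -> exists T : tup 2, T ord0 = v /\ T ord_max = v'.
Proof.
move=> vv'; pose f (i : 'I_2) := if i == ord0 then v else v'.
have fI : injective f.
  move=> i i'; rewrite /f; case: eqP => [->|i0]; case: eqP => [->|i'0] //.
    by move=> /esym E; case: vv'.
  by move=> _; exact: (I2_eq i0 i'0).
by exists (mktup fI); rewrite !mktupE /f eqxx.
Qed.

Lemma I2_cases (P : 'I_2 -> Prop) : P ord0 -> P ord_max -> forall i, P i.
Proof.
move=> P0 P1 i; case: (pselect (i = ord0)) => [->//|i0].
by have -> : i = ord_max by exact: (I2_eq i0).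
Qed.

Lemma I3_cases (P : 'I_3 -> Prop) (x y z : 'I_3) : x != y -> x != z -> y != z ->
  P x -> P y -> P z -> forall i, P i.
Proof.
move=> /eqP xy /eqP xz /eqP yz Px Py Pz i; case: (pselect (i = x)) => [->//|ix].
case: (pselect (i = y)) => [->//|iy].
by have -> : i = z by apply: (I3_eq xy ix iy); exact: nesym.
Qed.

Lemma triple_tup (x v v' : pt 3) : x <> v -> x <> v' -> v <> v' ->
  exists T : tup 3, [/\ T ord0 = x, T (inord 1) = v & T (inord 2) = v'].
Proof.
move=> xv xv' vv'.
pose f (i : 'I_3) := if val i is n.+1 then (if n is 0 then v else v') else x.
have fI : injective f.
  move=> [[|[|[|//]]] ?] [[|[|[|//]]] ?]; rewrite /f /= => E;
    by [exact: val_inj|case: xv|case: xv'|case: vv'|case: xv; rewrite E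
       |case: xv'; rewrite E|case: vv'; rewrite E].
by exists (mktup fI); rewrite !mktupE /f /= !inordK.
Qed.

Lemma S3_generators : exists s t : 'S_3, [/\ s <> 1, s * s = 1, t <> 1 & t * t * t = 1].
Proof.
pose o : 'I_3 := Ordinal (isT : 1 < 3)%N.
exists (tperm ord0 ord_max), (tperm ord0 ord_max * tperm ord0 o); split.
- by move=> /(congr1 (fun u : 'S_3 => u ord0)); rewrite perm1 tpermL.
- exact: tperm2.
- by move=> /(congr1 (fun u : 'S_3 => u ord0)); rewrite perm1 permM tpermL tpermD.
apply/permP; apply: (I3_cases (x := ord0) (y := ord_max) (z := o)) => //;
  by rewrite !permM perm1 !permE /=.
Qed.

Lemma involutionJ (G : groupType) (x y : G) : involution x -> involution (x ^ y).
Proof.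
move=> [x1 xx]; split; last by rewrite -conjMg xx conj1g.
by move=> /(congr1 (fun z => z ^ y^-1)); rewrite conjgK conj1g.
Qed.

(** * The sharply 2-transitive action *)

Section Two.
Variables (G : groupType) (phi : 'S_2 -> G) (t : bool * bool -> G).
Hypothesis Ghnn : is_hnn S2type phi t.

Lemma hnn2_action : has_nonsplit_char2_action 2 G.
Proof.
have nfu j p q : nonfree S2type j p -> nonfree S2type j q -> p = q by move=> /S2_free.
have [a [aM aphi at_ sharp]] := action_exists Ghnn isT nfu S2_centre_class ord0
  (j0 := false) erefl.
have phiM := hnn_phiM Ghnn.
have hr := hact_right aM; have [act1 actM] := hr.
have hphi p u : hact a p (phi u) = pact p u by rewrite /hact aphi.
have htrans v v' w w' : v <> v' -> w <> w' ->
    exists h, hact a v h = w /\ hact a v' h = w'.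
  move=> /pair_tup[T [<- <-]] /pair_tup[T' [<- <-]].
  by have [g gT] := tup_transitive aM sharp T T'; exists g.
have hfix v v' g : v <> v' -> hact a v g = v -> hact a v' g = v' -> g = 1.
  move=> /pair_tup[T [<- <-]] gv gv'; apply: (tup_fixed aM sharp (T := T)).
  exact: I2_cases.
have hfaith g : g <> 1 -> exists y, hact a y g <> y.
  move=> g1; apply: contrapT => gy; apply: g1.
  by apply: (@hfix (inl ord0) (inl ord_max)) => //; apply: contrapT => gn; apply: gy;
    eexists; exact: gn.
have char2 g : involution g -> forall x, hact a x g <> x.
  move=> [g1 gg] x gx; have [y gy] := hfaith _ g1.
  have ggy : hact a (hact a y g) g = y by rewrite -actM gg act1.
  have [h [h0 h1]] := htrans (inl ord0) (inl ord_max) y (hact a y g) ltac:(by []) (nesym gy).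
  (* The involution [g] swaps [y] and its image, so by sharpness it is conjugate to [phi s], which
     swaps the two base points; and 'S_2 acts freely on [pt 2]. *)
  pose s : 'S_2 := tperm ord0 ord_max.
  have gE : h * g * h^-1 = phi s.
    have gV : g^-1 = g by rewrite -[LHS]mulg1 -gg mulKg.
    have iE : (h * g * h^-1)^-1 = h * g * h^-1 by rewrite !invgM invgK gV mulgA.
    have h0' : hact a y h^-1 = inl ord0 by rewrite -h0 -actM mulgV act1.
    have h1' : hact a (hact a y g) h^-1 = inl ord_max by rewrite -h1 -actM mulgV act1.
    have : phi s * (h * g * h^-1)^-1 = 1.
      apply: (@hfix (inl ord0) (inl ord_max)) => //; rewrite iE !actM hphi /=.
        by rewrite tpermL h1 ggy h0'.
      by rewrite tpermR h0 h1'.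
    by move=> /divg1_eq ->.
  have s1 : s <> 1.
    move=> s1; apply: g1; have := gE; rewrite s1 (hom1 phiM) => /divg1_eq.
    by rewrite -{2}[h]mulg1 => /mulgI.
  have gx' : hact a (hact a x h^-1) (phi s) = hact a x h^-1.
    by rewrite -gE -actM !mulgA mulVg mul1g actM gx.
  move: gx'; rewrite hphi => px.
  by apply: (@S2_free true (hact a x h^-1)); exists s; rewrite inE.
exists (pt 2), (hact a); split.
- exact: infinite_pt.
- exact: hact_sharply_transitive.
- exact: char2.
pose s : 'S_2 := tperm ord0 ord_max.
have s1 : s <> 1.
  by move=> /(congr1 (fun u : 'S_2 => u ord0)); rewrite perm1 tpermL => /(congr1 val).
have ss : s * s = 1 by exact: tperm2.
have inv_s : involution (phi s).
  split; last by rewrite -phiM ss (hom1 phiM).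
  by rewrite -(hom1 phiM) => /(phi_inj aphi).
have [r [c [r1 rr c1 ccc]]] := S3_generators.
(* The quotient 'S_3: 'S_2 goes onto the group generated by an involution, and a free stable letter
   to an element of order 3. *)
pose psi (u : 'S_2) : 'S_3 := if u == 1 then 1 else r.
have psiM : is_hom psi.
  move=> u v; rewrite /psi; case: eqP => [uv|uv]; case: eqP => u1; case: eqP => v1.
  - by rewrite mulg1.
  - by case: v1; rewrite -uv u1 mul1g.
  - by case: u1; rewrite -uv v1 mulg1.
  - by rewrite rr.
  - by case: uv; rewrite u1 v1 mulg1.
  - by rewrite mul1g.
  - by rewrite mulg1.
  - by case: uv; rewrite (S2_eq u1 s1) (S2_eq v1 s1).
have [f [fM fphi ft]] := hnn_retract (j0 := false) c Ghnn erefl psiM.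
apply: (@nonsplit_criterion _ _ (hact a) setT setT hr _ _ _ _ _
  (phi s) (phi s ^ t (false, false))) => //.
- by move=> v v' w w' _ _ vv' _ _ ww'; have [h [hv hv']] := htrans _ _ _ _ vv' ww'; exists h.
- by move=> h _ hV; apply: contrapT => /hfaith[y]; apply; exact: hV.
- by move=> h v _ /char2.
- exact: involutionJ.
move=> /(congr1 f); rewrite !fM (homV fM) ft fphi /psi.
case: eqP => // _; rewrite -conjgE.
exact: S3_not_commute.
Qed.

End Two.

(** * The sharply 3-transitive action *)

Section Three.
Variables s t : 'S_3.
Hypotheses (s1 : s <> 1) (ss : s * s = 1) (t1 : t <> 1) (ttt : t * t * t = 1).
Variables (G : groupType) (phi : 'S_3 -> G) (w : option bool * bool -> G).
Hypothesis Ghnn : is_hnn (S3type s t) phi w.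

Lemma hnn3_action : has_nonsplit_char2_action 3 G.
Proof.
have [x0 [sx0 x0u]] := S3_fixed_point s1 ss.
have [a [aM aphi aw sharp]] := action_exists Ghnn isT (S3_nonfree_unique s1 ss t1 ttt)
  (S3_centre_class s1 ss t1 ttt) x0 (j0 := None) erefl.
have phiM := hnn_phiM Ghnn.
have hr := hact_right aM; have [act1 actM] := hr.
have hphi p u : hact a p (phi u) = pact p u by rewrite /hact aphi.
set e := w (None, false) in aw.
have char2 g : involution g -> exists! x, hact a x g = x.
  move=> [g1 gg]; have [h [r gE]] := involution_conj Ghnn (conj g1 gg).
  have r1 : r <> 1 by move=> r1; apply: g1; rewrite gE r1 (hom1 phiM) mulg1 mulgV.
  have rr : r * r = 1.
    apply: (phi_inj aphi); rewrite phiM (hom1 phiM).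
    have -> : phi r = g ^ h by rewrite gE conjgE !mulgA mulVg mul1g mulgVK.
    by rewrite -conjMg gg conj1g.
  have [i0 [ri0 i0u]] := S3_fixed_point r1 rr.
  exists (hact a (inl i0) h^-1); split.
    by rewrite gE -actM !mulgA mulVg mul1g actM hphi /= ri0.
  move=> x gx; have : hact a (hact a x h) (phi r) = hact a x h.
    by rewrite -{2}gx gE -!actM mulgVK.
  rewrite hphi => px; have /eqP p0 : level (hact a x h) == 0%N.
    by apply: contra_notT r1 => /pact_free; apply.
  have -> : x = hact a (hact a x h) h^-1 by rewrite -actM mulgV act1.
  by case: (hact a x h) p0 px => [i _ /= [/i0u ->]|[]].
exists (pt 3), (hact a); split.
- exact: infinite_pt.
- exact: hact_sharply_transitive.
- exact: char2.
move=> x; have [g gx] := point_transitive aM sharp x x0.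
have gVx : hact a x g^-1 = inl x0 by rewrite -gx -actM mulgV act1.
have inv_s : involution (phi s).
  split; last by rewrite -phiM ss (hom1 phiM).
  by rewrite -(hom1 phiM) => /(phi_inj aphi).
(* Because [e] was seeded to fix [x0], both [phi s] and [phi s ^ e] lie in the stabiliser of [x0];
   conjugation by [g] carries them to that of [x]. *)
have e_x0 : hact a (inl x0) e = inl x0 by rewrite /hact aw /seed_fun eqxx.
have eV_x0 : hact a (inl x0) e^-1 = inl x0 by rewrite -{1}e_x0 -actM mulgV act1.
have stabJ u : hact a (inl x0) u = inl x0 -> hact a x (u ^ g) = x.
  by move=> ux; rewrite conjgE !actM gVx ux gx.
have s_x0 : hact a (inl x0) (phi s) = inl x0 by rewrite hphi /= sx0.
apply: (@nonsplit_criterion _ _ (hact a) (stabiliser (hact a) x) (fun p => p <> x) hr _ _ _ _ _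
  (phi s ^ g) ((phi s ^ e) ^ g)).
- split; first exact: act1.
    by move=> u v ux vx; rewrite /stabiliser /= actM ux.
  by move=> u ux; rewrite /stabiliser /= -{1}ux -actM mulgV act1.
- move=> p p' q q' px p'x pp' qx q'x qq'.
  have [T [Tx Tp Tp']] := triple_tup (nesym px) (nesym p'x) pp'.
  have [T' [T'x T'q T'q']] := triple_tup (nesym qx) (nesym q'x) qq'.
  have [h hT] := tup_transitive aM sharp T T'; exists h.
  by rewrite /stabiliser /= -{1}Tx -T'x -Tp -Tp' !hT.
- move=> h hx hV; apply: (tup_fixed aM sharp (T := base)) => i.
  by case: (pselect (base i = x)) => [->|/hV].
- by move=> h p hx px; rewrite -hx => /hact_inj.
- move=> h p hx /char2[y [_ yu]] px ph.
  by apply: px; rewrite -(yu _ ph) (yu _ hx).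
- exact: stabJ.
- by apply: (stabJ); rewrite conjgE !actM eV_x0 s_x0.
- exact: involutionJ.
- by do 2!apply: involutionJ.
- have [f [fM fphi fe]] := hnn_retract (j0 := None) t Ghnn erefl (psi := id) (fun _ _ => erefl).
  rewrite -!conjMg => /conjg_inj /(congr1 f); rewrite !fM (homV fM) fe fphi.
  exact: S3_not_commute.
Qed.

End Three.

(** * Presentations and universal properties *)

Section WordValues.
Variable X : choiceType.

Definition word_value (H : groupType) (g : X -> H) (w : word X) : H :=
  foldr (fun l x => (if l.2 then (g l.1)^-1 else g l.1) * x) 1 w.

Lemma word_value_cat (H : groupType) (g : X -> H) u v :
  word_value g (u ++ v) = word_value g u * word_value g v.
Proof. by elim: u => [|l u IH] /=; rewrite ?mul1g // IH mulgA. Qed.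

Lemma word_value_inv (H : groupType) (g : X -> H) w : word_value g (inv_word w) = (word_value g w)^-1.
Proof.
elim: w => [|[x b] w IH]; first by rewrite /= invg1.
rewrite -cat1s inv_word_cat !word_value_cat IH invgM; congr (_ * _).
by case: b; rewrite /= !mulg1 ?invgK.
Qed.

Lemma word_value_hom (H K : groupType) (f : H -> K) (g : X -> H) w :
  is_hom f -> word_value (f \o g) w = f (word_value g w).
Proof.
move=> fM; elim: w => [|[x b] w IH] /=; first by rewrite (hom1 fM).
by rewrite fM IH; case: b; rewrite //= (homV fM).
Qed.

End WordValues.

Lemma word_value_map (X Y : choiceType) (f : X -> Y) (H : groupType) (g : Y -> H) w :
  word_value g (map (fun l => (f l.1, l.2)) w) = word_value (g \o f) w.
Proof. by elim: w => [|l w IH] //=; rewrite IH. Qed.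

Lemma hom_ext_gen (X : Type) (G H : groupType) (f : X -> G) (h h' : G -> H) :
  is_hom h -> is_hom h' ->
  (forall P : G -> Prop, P 1 -> (forall x, P (f x)) -> (forall x, P (f x)^-1) ->
    (forall g k, P g -> P k -> P (g * k)) -> forall g, P g) ->
  (forall x, h (f x) = h' (f x)) -> h =1 h'.
Proof.
move=> hM h'M fgen E; apply: fgen => [|//|x|g k Eg Ek].
- by rewrite !hom1.
- by rewrite !homV // E.
- by rewrite hM h'M Eg Ek.
Qed.

Section Presented.
Variables (X : choiceType) (R : set (word X)).

Lemma presented_ind (P : presented_group R -> Prop) : P 1 ->
  (forall x, P (gen R x)) -> (forall x, P (gen R x)^-1) ->
  (forall g h, P g -> P h -> P (g * h)) -> forall g, P g.
Proof.
move=> P1 Pg PV PM g; rewrite -(class_of_repr g).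
elim: (generic_quotient.repr g) => [|[x b] w IH]; first exact: P1.
rewrite -cat1s -pmulE; apply: PM => //; case: b; last exact: Pg.
have -> : class_of R [:: (x, true)] = (gen R x)^-1 by rewrite /gen -[RHS]/(pinv _) pinvE.
exact: PV.
Qed.

Lemma presented_univ (H : groupType) (g : X -> H) :
  (forall r, R r -> word_value g r = 1) ->
  exists f : presented_group R -> H, is_hom f /\ forall x, f (gen R x) = g x.
Proof.
move=> gR; have geqv u v : word_eqv R u v -> word_value g u = word_value g v.
  elim=> {u v} [//|u v _ -> //|u v w _ -> _ -> //|u [x b] v|u r v Rr].
    rewrite !word_value_cat; congr (_ * _); rewrite /= mulg1.
    by case: b; rewrite /= ?mulgV ?mulVg mul1g.
  by rewrite !word_value_cat (gR r Rr) mul1g.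
have fE w : word_value g (generic_quotient.repr (class_of R w)) = word_value g w.
  exact/geqv/repr_class_of.
exists (fun x => word_value g (generic_quotient.repr x)); split=> [x y|x]; last by rewrite /gen fE /= mulg1.
by rewrite -[x * y]/(pmul x y) /pmul fE word_value_cat.
Qed.

Lemma class_of_value w : class_of R w = word_value (gen R) w.
Proof.
elim: w => [//|[x b] w IH]; rewrite -cat1s -pmulE IH.
transitivity ((class_of R [:: (x, b)] : presented_group R) * word_value (gen R) w) => //.
by congr (_ * _); case: b => //=; rewrite -[RHS]/(pinv _) pinvE.
Qed.

Lemma presented_rel r : R r -> word_value (gen R) r = 1.
Proof.
move=> Rr; rewrite -class_of_value; apply/class_ofP.
by have := word_eqv_rel [::] [::] Rr; rewrite cats0.
Qed.

End Presented.

Lemma free_group_univ (X : choiceType) (H : groupType) (g : X -> H) :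
  exists f : free_group X -> H, is_hom f /\ forall x, f (gen set0 x) = g x.
Proof. by apply: presented_univ. Qed.

Lemma prod_hom (A B H : groupType) (f : A -> H) (g : B -> H) :
  is_hom f -> is_hom g -> (forall a b, f a * g b = g b * f a) ->
  is_hom (fun x : A * B => f x.1 * g x.2).
Proof.
move=> fM gM fg [a b] [a' b'] /=; rewrite fM gM !mulgA; congr (_ * _).
by rewrite -!mulgA fg.
Qed.

Lemma hom_commute (G H : groupType) (f : G -> H) x y :
  is_hom f -> commute x y -> commute (f x) (f y).
Proof. by move=> fM xy; rewrite /commute -!fM xy. Qed.

Lemma inl_hom (A B : groupType) : is_hom (fun a : A => (a, 1) : A * B).
Proof. by move=> a a'; congr (_, _); rewrite mulg1. Qed.

Lemma inr_hom (A B : groupType) : is_hom (fun b : B => (1, b) : A * B).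
Proof. by move=> b b'; congr (_, _); rewrite mulg1. Qed.

Section AmalgamUniversal.
Variables (A B : groupType) (C : Type) (iA : C -> A) (iB : C -> B).

Lemma amalgam_l_hom : is_hom (amalgam_l iA iB).
Proof.
move=> a a'; have := presented_rel (amalgam_rel_l iA iB a a').
by rewrite /= mulg1 mulgA => /divg1_eq.
Qed.

Lemma amalgam_r_hom : is_hom (amalgam_r iA iB).
Proof.
move=> b b'; have := presented_rel (amalgam_rel_r iA iB b b').
by rewrite /= mulg1 mulgA => /divg1_eq.
Qed.

Lemma amalgam_eq c : amalgam_l iA iB (iA c) = amalgam_r iA iB (iB c).
Proof.
by have := presented_rel (amalgam_rel_id iA iB c); rewrite /= mulg1 => /divg1_eq.
Qed.

Lemma amalgam_ind (P : amalgam iA iB -> Prop) :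
  (forall a, P (amalgam_l iA iB a)) -> (forall b, P (amalgam_r iA iB b)) ->
  (forall g h, P g -> P h -> P (g * h)) -> forall g, P g.
Proof.
move=> Pl Pr PM; apply: presented_ind => //.
- by rewrite -(hom1 amalgam_l_hom).
- by case.
- by case=> [a|b]; [rewrite -(homV amalgam_l_hom)|rewrite -(homV amalgam_r_hom)].
Qed.

Lemma amalgam_univ (H : groupType) (f : A -> H) (g : B -> H) :
  is_hom f -> is_hom g -> (forall c, f (iA c) = g (iB c)) ->
  exists h : amalgam iA iB -> H, [/\ is_hom h,
    forall a, h (amalgam_l iA iB a) = f a & forall b, h (amalgam_r iA iB b) = g b].
Proof.
move=> fM gM fg.
pose x (y : A + B) := match y with inl a => f a | inr b => g b end.
have [r|h [hM hx]] := @presented_univ _ (amalgam_rel iA iB) H x.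
  case=> [a a'|b b'|c] /=.
  - by rewrite fM mulg1 mulgA mulgV.
  - by rewrite gM mulg1 mulgA mulgV.
  - by rewrite fg mulg1 mulgV.
by exists h; split=> // [a|b]; rewrite hx.
Qed.

End AmalgamUniversal.

(** * Finite presentations, described by universal properties *)

Record presents (X : finType) (r : seq (word X)) (G : groupType) (f : X -> G) : Prop :=
  Presents {
  pres_rel : forall w, w \in r -> word_value f w = 1;
  pres_gen : forall P : G -> Prop, P 1 -> (forall x, P (f x)) ->
    (forall x, P (f x)^-1) -> (forall g h, P g -> P h -> P (g * h)) -> forall g, P g;
  pres_univ : forall (H : groupType) (g : X -> H),
    (forall w, w \in r -> word_value g w = 1) ->
    exists h : G -> H, is_hom h /\ forall x, h (f x) = g x }.

Definition fp (G : groupType) :=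
  exists (X : finType) (r : seq (word X)) (f : X -> G), presents r f.

Lemma pres_word (X : finType) (r : seq (word X)) (G : groupType) (f : X -> G) (g : G) :
  presents r f -> exists w, g = word_value f w.
Proof.
move=> pr; elim/(pres_gen pr): g => [|x|x|g h [u ->] [v ->]].
- by exists [::].
- by exists [:: (x, false)]; rewrite /= mulg1.
- by exists [:: (x, true)]; rewrite /= mulg1.
- by exists (u ++ v); rewrite word_value_cat.
Qed.

(** Allowing any finite type of generators lets a sum of types present a product or an amalgam; the
    generators are numbered only here. *)
Lemma fp_finitely_presented (G : groupType) : fp G -> finitely_presented G.
Proof.
case=> X [r [f pr]].
pose ren (w : word X) : word 'I_#|X| := [seq (enum_rank l.1, l.2) | l <- w].
exists #|X|, (map ren r); set R := [set` map ren r]%classic.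
have [|h [hM hf]] := pres_univ pr (g := gen R \o enum_rank).
  move=> w rw; rewrite -[LHS](word_value_map enum_rank); apply: presented_rel.
  exact: map_f.
have [|h' [h'M h'f]] := @presented_univ _ R G (f \o enum_val).
  move=> w /= /mapP[v rv ->]; rewrite word_value_map -(pres_rel pr rv).
  by congr (word_value _ v); apply/funext => x /=; rewrite enum_rankK.
have hK : cancel h h'.
  apply: (hom_ext_gen (h := h' \o h) (h' := id) _ _ (pres_gen pr)) => //.
    by move=> x y /=; rewrite hM h'M.
  by move=> x /=; rewrite hf h'f /= enum_rankK.
have h'K : cancel h' h.
  apply: (hom_ext_gen (h := h \o h') (h' := id) _ _ (@presented_ind _ R)) => //.
    by move=> x y /=; rewrite h'M hM.
  by move=> x /=; rewrite h'f /= hf /= enum_valK.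
pose m := isMultiplicative.Build G (presented_group R) h hM.
by exists (HB.pack h m : {multiplicative G -> presented_group R}); exists h'.
Qed.

Lemma fp_finite (gT : finGroupType) : fp gT.
Proof.
pose rel (x : gT * gT) : word gT := [:: (x.1, false); (x.2, false); (x.1 * x.2, true)].
exists gT, (map rel (enum [set: gT * gT])), id; split.
- by move=> w /mapP[x _ ->]; rewrite /= mulg1 mulgA mulgV.
- by move=> P _ Px _ _ g; exact: Px.
- move=> H g gr; exists g; split=> // x y.
  have /gr : rel (x, y) \in map rel (enum [set: gT * gT]) by apply: map_f; rewrite mem_enum inE.
  by rewrite /= mulg1 mulgA => /divg1_eq.
Qed.

Lemma fp_free (X : finType) : fp (free_group X).
Proof.
exists X, [::], (gen set0); split=> //; first exact: presented_ind.
by move=> H g _; exact: free_group_univ.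
Qed.

Section Combine.
Variables (X Y : finType).

Definition lift_l (w : word X) : word (X + Y)%type := [seq (inl l.1, l.2) | l <- w].
Definition lift_r (w : word Y) : word (X + Y)%type := [seq (inr l.1, l.2) | l <- w].

Lemma word_value_l (H : groupType) (g : X + Y -> H) w :
  word_value g (lift_l w) = word_value (g \o inl) w.
Proof. exact: word_value_map. Qed.

Lemma word_value_r (H : groupType) (g : X + Y -> H) w :
  word_value g (lift_r w) = word_value (g \o inr) w.
Proof. exact: word_value_map. Qed.

End Combine.

Lemma fp_prod (A B : groupType) : fp A -> fp B -> fp (A * B)%type.
Proof.
move=> [X [r [f prA]]] [Y [q [g prB]]].
pose com (z : X * Y) : word (X + Y)%type :=
  [:: (inl z.1, false); (inr z.2, false); (inl z.1, true); (inr z.2, true)].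
pose fg (z : X + Y) : A * B := match z with inl x => (f x, 1) | inr y => (1, g y) end.
pose rels := map (@lift_l X Y) r ++ map (@lift_r X Y) q ++ map com (enum [set: X * Y]).
have relsl w : w \in r -> lift_l Y w \in rels by move=> rw; rewrite mem_cat map_f.
have relsr w : w \in q -> lift_r X w \in rels.
  by move=> qw; rewrite !mem_cat (map_f (@lift_r X Y)) ?orbT.
have relsc z : com z \in rels.
  by rewrite !mem_cat (map_f com) ?orbT // mem_enum inE.
exists (X + Y)%type, rels, fg; split.
- move=> w; rewrite !mem_cat => /or3P[]/mapP[v vr ->].
  + rewrite word_value_l (word_value_hom f v (@inl_hom A B)).
    by rewrite (pres_rel prA vr).
  + rewrite word_value_r (word_value_hom g v (@inr_hom A B)).
    by rewrite (pres_rel prB vr).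
  + by congr (_, _); rewrite /= !(invg1, mul1g, mulg1) mulgV.
- move=> P P1 Px PV PM [a b].
  have -> : (a, b) = (a, 1) * (1, b) :> A * B by congr (_, _); rewrite ?mulg1 ?mul1g.
  apply: (PM _ _).
    elim/(pres_gen prA): a => [|x|x|x y Ha Hb]; first exact: P1.
    + exact: (Px (inl x)).
    + by have := PV (inl x); congr P; congr (_, _); rewrite invg1.
    + by rewrite inl_hom; exact: PM.
  elim/(pres_gen prB): b => [|x|x|x y Ha Hb]; first exact: P1.
  + exact: (Px (inr x)).
  + by have := PV (inr x); congr P; congr (_, _); rewrite invg1.
  + by rewrite inr_hom; exact: PM.
- move=> H h hr.
  have [|hA [hAM hAf]] := pres_univ prA (g := h \o inl).
    by move=> w /relsl/hr; rewrite word_value_l.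
  have [|hB [hBM hBf]] := pres_univ prB (g := h \o inr).
    by move=> w /relsr/hr; rewrite word_value_r.
  have com0 x y : commute (hA (f x)) (hB (g y)).
    have := hr _ (relsc (x, y)); rewrite /= mulg1 !mulgA hAf hBf /= => E.
    by apply: divg1_eq; rewrite invgM mulgA.
  have comA x b : commute (hA (f x)) (hB b).
    elim/(pres_gen prB): b => [|y|y|b b' Hb Hb'] //.
    + by rewrite (hom1 hBM); exact: commute1.
    + by rewrite (homV hBM); exact: commuteV.
    + by rewrite hBM; exact: commuteM.
  have comAB b a : commute (hB b) (hA a).
    elim/(pres_gen prA): a => [|x|x|a a' Ha Ha'].
    + by rewrite (hom1 hAM); exact: commute1.
    + exact/commute_sym/comA.
    + by rewrite (homV hAM); exact/commuteV/commute_sym/comA.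
    + by rewrite hAM; exact: commuteM.
  exists (fun x => hA x.1 * hB x.2); split.
    by apply: prod_hom => // a b; rewrite comAB.
  by case=> [x|y] /=; rewrite ?hAf ?hBf ?(hom1 hAM) ?(hom1 hBM) ?mulg1 ?mul1g.
Qed.

(** The defining multiplication tables may be infinite, but relators of the two factors suffice,
    together with one relator for each element of the finite type [C], formed from words chosen for
    its two images. *)
Lemma fp_amalgam (A B : groupType) (C : finType) (iA : C -> A) (iB : C -> B) :
  fp A -> fp B -> fp (amalgam iA iB).
Proof.
move=> [X [r [f prA]]] [Y [q [g prB]]].
have /boolp.choice[u uE] c := pres_word (iA c) prA.
have /boolp.choice[v vE] c := pres_word (iB c) prB.
pose idw c : word (X + Y)%type := lift_l Y (u c) ++ inv_word (lift_r X (v c)).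
pose fg (z : X + Y) : amalgam iA iB :=
  match z with inl x => amalgam_l iA iB (f x) | inr y => amalgam_r iA iB (g y) end.
pose rels := map (@lift_l X Y) r ++ map (@lift_r X Y) q ++ map idw (enum C).
have relsl w : w \in r -> lift_l Y w \in rels by move=> rw; rewrite mem_cat map_f.
have relsr w : w \in q -> lift_r X w \in rels.
  by move=> qw; rewrite !mem_cat (map_f (@lift_r X Y)) ?orbT.
have relsc c : idw c \in rels by rewrite !mem_cat (map_f idw) ?orbT // mem_enum.
have fgl w : word_value fg (lift_l Y w) = amalgam_l iA iB (word_value f w).
  by rewrite word_value_l (word_value_hom f w (@amalgam_l_hom _ _ _ iA iB)).
have fgr w : word_value fg (lift_r X w) = amalgam_r iA iB (word_value g w).
  by rewrite word_value_r (word_value_hom g w (@amalgam_r_hom _ _ _ iA iB)).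
exists (X + Y)%type, rels, fg; split.
- move=> w; rewrite !mem_cat => /or3P[]/mapP[z zr ->].
  + by rewrite fgl (pres_rel prA zr) (hom1 (@amalgam_l_hom _ _ _ iA iB)).
  + by rewrite fgr (pres_rel prB zr) (hom1 (@amalgam_r_hom _ _ _ iA iB)).
  + by rewrite word_value_cat word_value_inv fgl fgr -uE -vE amalgam_eq mulgV.
- move=> P P1 Px PV PM; apply: amalgam_ind => // [a|b].
    elim/(pres_gen prA): a => [|x|x|x y Ha Hb].
    + by rewrite (hom1 (@amalgam_l_hom _ _ _ iA iB)).
    + exact: (Px (inl x)).
    + by rewrite (homV (@amalgam_l_hom _ _ _ iA iB)); exact: (PV (inl x)).
    + by rewrite amalgam_l_hom; exact: PM.
  elim/(pres_gen prB): b => [|x|x|x y Ha Hb].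
  + by rewrite (hom1 (@amalgam_r_hom _ _ _ iA iB)).
  + exact: (Px (inr x)).
  + by rewrite (homV (@amalgam_r_hom _ _ _ iA iB)); exact: (PV (inr x)).
  + by rewrite amalgam_r_hom; exact: PM.
- move=> H h hr.
  have [|hA [hAM hAf]] := pres_univ prA (g := h \o inl).
    by move=> w /relsl/hr; rewrite word_value_l.
  have [|hB [hBM hBf]] := pres_univ prB (g := h \o inr).
    by move=> w /relsr/hr; rewrite word_value_r.
  have [|k [kM kl kr]] := amalgam_univ (iA := iA) (iB := iB) hAM hBM.
    move=> c; have := hr _ (relsc c).
    rewrite word_value_cat word_value_inv word_value_l word_value_r => /divg1_eq.
    rewrite uE vE -(word_value_hom f _ hAM) -(word_value_hom g _ hBM).
    have -> : hA \o f = h \o inl by apply/funext => x; rewrite /= hAf.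
    by have -> : hB \o g = h \o inr by apply/funext => y; rewrite /= hBf.
  by exists k; split=> // -[x|y] /=; rewrite ?kl ?kr ?hAf ?hBf.
Qed.

(** * The two groups as multiple HNN extensions *)

Notation gen2 := (gen (@set0 (word 'I_2))).
Definition index2 (b : bool) : 'I_2 := if b then ord_max else ord0.

Lemma F2_ind (P : F2 -> Prop) : P 1 -> (forall b, P (gen2 (index2 b))) ->
  (forall g h, P g -> P h -> P (g * h)) -> (forall g, P g -> P g^-1) -> forall g, P g.
Proof.
move=> P1 Pg PM PV; apply: presented_ind => // [|i].
  by apply: I2_cases; [exact: (Pg false)|exact: (Pg true)].
by apply: PV; move: i; apply: I2_cases; [exact: (Pg false)|exact: (Pg true)].
Qed.

Lemma F2_univ (H : groupType) (x : bool -> H) :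
  exists f : F2 -> H, is_hom f /\ forall b, f (gen2 (index2 b)) = x b.
Proof.
have [f [fM fg]] := free_group_univ (fun i : 'I_2 => x (i == ord_max)).
by exists f; split=> // b; rewrite fg; case: b.
Qed.

Lemma F2_commute (H : groupType) (f : F2 -> H) y : is_hom f ->
  (forall b, commute y (f (gen2 (index2 b)))) -> forall g, commute y (f g).
Proof.
move=> fM yf; apply: F2_ind => [|//|g h yg yh|g yg].
- by rewrite (hom1 fM); exact: commute1.
- by rewrite fM; exact: commuteM.
- by rewrite (homV fM); exact: commuteV.
Qed.

Definition phi2 (u : 'S_2) : group2 := amalgam_l _ _ (u, 1).
Definition stable2 (l : bool * bool) : group2 :=
  if l.1 then amalgam_l _ _ (1, gen2 (index2 l.2)) else amalgam_r _ _ (gen2 (index2 l.2)).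

(** Generators of the free group that centralises 'S_2 are the stable letters of type [true]; those
    of the free factor have type [false]. *)
Lemma group2_hnn : is_hnn S2type phi2 stable2.
Proof.
pose lM := @amalgam_l_hom _ _ _ (of_void ('S_2 * F2)%type) (of_void F2).
pose rM := @amalgam_r_hom _ _ _ (of_void ('S_2 * F2)%type) (of_void F2).
split.
- by move=> u v; rewrite /phi2 inl_hom lM.
- case=> [[] b] c /=; rewrite /stable2 /phi2 /=.
    by move=> _; rewrite -!lM; congr amalgam_l; congr (_, _); rewrite ?mul1g ?mulg1.
  by rewrite inE => /eqP ->; rewrite (hom1 lM) mul1g mulg1.
- move=> P Pphi Pt PM PV; apply: amalgam_ind => // [[u x]|x].
    have -> : (u, x) = (u, 1) * (1, x) :> 'S_2 * F2.
      by congr (_, _); rewrite ?mul1g ?mulg1.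
    rewrite lM; apply: (PM _ _); first exact: Pphi.
    elim/F2_ind: x => [|b|x y Px Py|x Px].
    + exact: Pphi.
    + exact: (Pt (true, b)).
    + by rewrite inr_hom lM; exact: PM.
    + by rewrite (homV (@inr_hom _ _)) (homV lM); exact: PV.
  elim/F2_ind: x => [|b|x y Px Py|x Px].
  + by rewrite (hom1 rM) -(hom1 lM); exact: Pphi.
  + exact: (Pt (false, b)).
  + by rewrite rM; exact: PM.
  + by rewrite (homV rM); exact: PV.
- move=> H psi w psiM wC.
  have [f [fM fg]] := F2_univ (fun b => w (true, b)).
  have [f' [f'M f'g]] := F2_univ (fun b => w (false, b)).
  have fpM := prod_hom psiM fM.
  have [|//|h [hM hl hr]] := amalgam_univ (iA := of_void _) (iB := of_void _) (fpM _) f'M.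
    move=> u x; apply: F2_commute => // b; rewrite fg.
    by apply: (wC (true, b)); rewrite inE.
  exists h; split=> //.
    by move=> u; rewrite hl /= (hom1 fM) mulg1.
  case=> [[] b]; rewrite /stable2 /=; first by rewrite hl /= (hom1 psiM) mul1g fg.
  by rewrite hr f'g.
Qed.

Lemma group2_fp : finitely_presented group2.
Proof.
apply: fp_finitely_presented; apply: fp_amalgam; last exact: fp_free.
by apply: fp_prod; [exact: fp_finite|exact: fp_free].
Qed.

Section GroupThree.
Variables s t : 'S_3.

Local Notation Fs := ([subg <[s]> ] * F2)%type.
Local Notation Ft := ([subg <[t]> ] * F2)%type.

Lemma group3_fp : finitely_presented (group3 s t).
Proof.
have fpF (gT : finGroupType) : fp (gT * F2)%type.
  by apply: fp_prod; [exact: fp_finite|exact: fp_free].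
apply: fp_finitely_presented; apply: fp_amalgam; last exact: fp_free.
apply: fp_amalgam; last exact: fpF.
apply: fp_amalgam; last exact: fpF.
exact: fp_finite.
Qed.

Definition phi3 (u : 'S_3) : group3 s t :=
  amalgam_l _ _ (amalgam_l _ _ (amalgam_l _ _ u)).

Definition stable3 (l : option bool * bool) : group3 s t :=
  match l.1 with
  | Some true => amalgam_l _ _ (amalgam_l _ _ (amalgam_r _ _ (1, gen2 (index2 l.2))))
  | Some false => amalgam_l _ _ (amalgam_r _ _ (1, gen2 (index2 l.2)))
  | None => amalgam_r _ _ (gen2 (index2 l.2))
  end.

(** Amalgamating [A] with [gT * F2] over [gT] amounts to adding two stable letters that commute with
    the image of [gT]. This lemma and the next two give generation, commutation and the universal
    property, and are applied once for each of [s] and [t]. *)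
Lemma F2_amalgam_ind (gT : finGroupType) (A : groupType) (iA : gT -> A)
    (P : amalgam iA (fun c : gT => (c, 1) : gT * F2) -> Prop) :
  (forall a, P (amalgam_l _ _ a)) ->
  (forall b, P (amalgam_r _ _ (1, gen2 (index2 b)))) ->
  (forall g h, P g -> P h -> P (g * h)) -> (forall g, P g -> P g^-1) -> forall g, P g.
Proof.
pose rM := @amalgam_r_hom _ _ _ iA (fun c : gT => (c, 1) : gT * F2).
move=> Pl Pt PM PV; apply: amalgam_ind => // -[c x].
have -> : (c, x) = (c, 1) * (1, x) :> gT * F2.
  by congr (_, _); rewrite ?mul1g ?mulg1.
rewrite rM; apply: (PM _ _); first by rewrite -amalgam_eq.
elim/F2_ind: x => [|b|x y Px Py|x Px].
- by rewrite (hom1 rM) -(hom1 (@amalgam_l_hom _ _ _ iA (fun c : gT => (c, 1) : gT * F2))).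
- exact: Pt.
- by rewrite inr_hom rM; exact: PM.
- by rewrite (homV (@inr_hom _ _)) (homV rM); exact: PV.
Qed.

Lemma F2_amalgam_commute (gT : finGroupType) (A : groupType) (iA : gT -> A) c b :
  commute (amalgam_l iA (fun c : gT => (c, 1) : gT * F2) (iA c))
          (amalgam_r _ _ (1, gen2 (index2 b))).
Proof.
rewrite amalgam_eq; apply: (hom_commute (@amalgam_r_hom _ _ _ _ _)).
by congr (_, _); rewrite ?mul1g ?mulg1.
Qed.

Lemma F2_amalgam_univ (gT : finGroupType) (A H : groupType) (iA : gT -> A)
    (f : A -> H) (x : bool -> H) : is_hom iA -> is_hom f ->
  (forall c b, commute (f (iA c)) (x b)) ->
  exists h : amalgam iA (fun c : gT => (c, 1) : gT * F2) -> H, [/\ is_hom h,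
    forall a, h (amalgam_l _ _ a) = f a &
    forall b, h (amalgam_r _ _ (1, gen2 (index2 b))) = x b].
Proof.
move=> iAM fM fx; have [g [gM gx]] := F2_univ x.
have fiM : is_hom (f \o iA) by move=> c d; rewrite /= iAM fM.
have fgM : is_hom (fun z : gT * F2 => (f \o iA) z.1 * g z.2).
  by apply: prod_hom => // c; apply: F2_commute => // b; rewrite gx; exact: fx.
have [|h [hM hl hr]] := @amalgam_univ _ _ _ iA (fun c : gT => (c, 1) : gT * F2) H _ _ fM fgM.
  by move=> c; rewrite /= (hom1 gM) mulg1.
by exists h; split=> // b; rewrite hr /= (hom1 iAM) (hom1 fM) mul1g gx.
Qed.

Lemma sgval_hom (gT : finGroupType) (K : {group gT}) : is_hom (@sgval gT K).
Proof. by []. Qed.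

Lemma group3_hnn : is_hnn (S3type s t) phi3 stable3.
Proof.
pose l1 := @amalgam_l_hom _ _ _ (@sgval _ <[s]>%G) (fun c => (c, 1) : Fs).
pose r1 := @amalgam_r_hom _ _ _ (@sgval _ <[s]>%G) (fun c => (c, 1) : Fs).
pose i2 : [subg <[t]> ] -> group3_s s := fun c => amalgam_l _ _ (sgval c).
pose l2 := @amalgam_l_hom _ _ _ i2 (fun c => (c, 1) : Ft).
pose r2 := @amalgam_r_hom _ _ _ i2 (fun c => (c, 1) : Ft).
pose l3 := @amalgam_l_hom _ _ _ (of_void (group3_st s t)) (of_void F2).
pose r3 := @amalgam_r_hom _ _ _ (of_void (group3_st s t)) (of_void F2).
have i2M : is_hom i2 by move=> c d; rewrite /i2 -l1.
have phiM : is_hom phi3 by move=> u v; rewrite /phi3 l1 l2 l3.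
have cs c b : c \in <[s]> -> commute (phi3 c) (stable3 (Some true, b)).
  move=> Cc; apply: (hom_commute l3); apply: (hom_commute l2).
  by have := F2_amalgam_commute (@sgval _ <[s]>%G) (subg <[s]>%G c) b; rewrite subgK.
have ct c b : c \in <[t]> -> commute (phi3 c) (stable3 (Some false, b)).
  move=> Cc; apply: (hom_commute l3).
  have i2c : i2 (subg <[t]>%G c) = amalgam_l _ _ c by rewrite /i2 subgK.
  by have := F2_amalgam_commute i2 (subg <[t]>%G c) b; rewrite i2c.
split=> //.
- case=> [[[]|] b] c; [exact: cs|exact: ct|].
  by rewrite inE => /eqP ->; rewrite (hom1 phiM) mul1g mulg1.
- move=> P Pphi Pt PM PV; apply: amalgam_ind => // [g|x].
    elim/F2_amalgam_ind: g => [g|b|g h Pg Ph|g Pg].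
    + elim/F2_amalgam_ind: g => [u|b|g h Pg Ph|g Pg].
      * exact: Pphi.
      * exact: (Pt (Some true, b)).
      * by rewrite l2 l3; exact: PM.
      * by rewrite (homV l2) (homV l3); exact: PV.
    + exact: (Pt (Some false, b)).
    + by rewrite l3; exact: PM.
    + by rewrite (homV l3); exact: PV.
  elim/F2_ind: x => [|b|x y Px Py|x Px].
  + by rewrite (hom1 r3) -(hom1 phiM); exact: Pphi.
  + exact: (Pt (None, b)).
  + by rewrite r3; exact: PM.
  + by rewrite (homV r3); exact: PV.
- move=> H psi w psiM wC.
  have [|h1 [h1M h1l h1r]] := F2_amalgam_univ (x := fun b => w (Some true, b))
      (@sgval_hom _ <[s]>%G) psiM.
    by move=> c b; apply: (wC (Some true, b)); exact: subgP.
  have [|h2 [h2M h2l h2r]] := F2_amalgam_univ (x := fun b => w (Some false, b)) i2M h1M.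
    by move=> c b; rewrite /i2 h1l; apply: (wC (Some false, b)); exact: subgP.
  have [f [fM fx]] := F2_univ (fun b => w (None, b)).
  have [//|h [hM hl hr]] := amalgam_univ (iA := of_void _) (iB := of_void _) h2M fM.
  exists h; split=> //.
    by move=> u; exact: etrans (hl _) (etrans (h2l _) (h1l u)).
  by case=> [[[]|] b]; [exact: etrans (hl _) (etrans (h2l _) (h1r b))
    |exact: etrans (hl _) (h2r b)|exact: etrans (hr _) (fx b)].
Qed.

End GroupThree.

Theorem corollary2 :
  (forall k : nat, k = 2 \/ k = 3 ->
     exists G : groupType, finitely_presented G /\ has_nonsplit_char2_action k G)
  /\ (finitely_presented group2 /\ has_nonsplit_char2_action 2 group2)
  /\ (forall s t : 'S_3, #[s]%g = 2 -> #[t]%g = 3 ->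
        finitely_presented (group3 s t) /\ has_nonsplit_char2_action 3 (group3 s t)).
Proof.
have g2 : finitely_presented group2 /\ has_nonsplit_char2_action 2 group2.
  by split; [exact: group2_fp|exact: hnn2_action group2_hnn].
have g3 (s t : 'S_3) : s <> 1 -> s * s = 1 -> t <> 1 -> t * t * t = 1 ->
    finitely_presented (group3 s t) /\ has_nonsplit_char2_action 3 (group3 s t).
  move=> s1 ss t1 ttt; split; first exact: group3_fp.
  exact: hnn3_action s1 ss t1 ttt _ _ _ (group3_hnn s t).
split; [|split=> //].
  move=> k [->|->]; first by exists group2.
  have [s [t [s1 ss t1 ttt]]] := S3_generators.
  by exists (group3 s t); exact: g3.
move=> s t s2 t3; apply: g3.
- by move=> s1; move: s2; rewrite s1 order1.
- by have := expg_order s; rewrite s2 expg2.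
- by move=> t1; move: t3; rewrite t1 order1.
- by have := expg_order t; rewrite t3 expgS expg2 mulgA.
Qed.
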